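(* Let $p\ge2$, let $a_1,\ldots,a_n\in\mathbb C$ be distinct points, and let $$\frac{dy}{dz}=\biggl(\sum_{i=1}^n\frac{B_i}{z-a_i}\biggr)y,\qquad y(z)\in\mathbb C^p,\quad B_i\in\mathrm{Mat}(p,\mathbb C),$$ be a Fuchsian system on the Riemann sphere with singular points $a_1,\ldots,a_n$ (so that $\infty$ is not a singular point, i.e. $\sum_{i=1}^nB_i=0$). Let $\beta_i^1,\ldots,\beta_i^p$ be the eigenvalues of the residue matrix $B_i$. Suppose that $$\mathrm{Re}\,\beta_i^j>-\frac1{n(p-1)},\qquad i=1,\ldots,n,\quad j=1,\ldots,p,$$ and that for every $i=1,\ldots,n$ and every pair $\beta_i^j,\beta_i^l$ with $\beta_i^j\not\equiv\beta_i^l\ (\mathrm{mod}\ \mathbb Z)$ at least one of the following conditions holds: $$\mathrm{Re}\,\beta_i^j-\mathrm{Re}\,\beta_i^l\notin\mathbb Q\qquad\text{or}\qquad \mathrm{Im}\,\beta_i^j\neq\mathrm{Im}\,\beta_i^l .$$ Then the system is solvable by quadratures if and only if the matrices $B_1,\ldots,B_n$ are simultaneously triangular, i.e. there exists $C\in\mathrm{GL}(p,\mathbb C)$ such that all the matrices $CB_iC^{-1}$, $i=1,\ldots,n$, are upper-triangular.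
   Context: Solvability by quadratures: let $Y(z)$ be a fundamental matrix of the system and let $F$ be the differential field obtained by adjoining all entries of $Y(z)$ to the field $\mathbb C(z)$ of rational functions (the Picard–Vessiot extension). The system is solvable by quadratures if there is a chain of differential fields $\mathbb C(z)=F_1\subseteq\cdots\subseteq F_m$ with $F\subseteq F_m$ and $F_{i+1}=F_i\langle x_i\rangle$ ($i=1,\ldots,m-1$), where each $x_i$ is either algebraic over $F_i$, or an exponential of an element of $F_i$, or an integral of an element of $F_i$. *)

(* Defs.v *)
From HB Require Import structures.
From mathcomp Require Import all_boot all_order all_algebra.
From mathcomp Require Import complex.
From mathcomp Require Import boolp classical_sets reals.
From mathcomp Require Import ring.

Set Implicit Arguments.
Unset Strict Implicit.
Unset Printing Implicit Defensive.

Import Order.TTheory GRing.Theory Num.Theory.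
Local Open Scope ring_scope.
Local Open Scope classical_set_scope.

HB.mixin Record isDifferential K of GRing.Field K := {
  der : K -> K;
  derD : forall x y : K, der (x + y) = der x + der y;
  derM : forall x y : K, der (x * y) = der x * y + x * der y
}.

#[short(type="diffFieldType")]
HB.structure Definition DiffField :=
  { K of GRing.Field K & isDifferential K }.

Notation ratfun k := {fraction {poly k}}.
Notation "p %:F" := (tofrac p) : ring_scope.

(* The derivation d/dz of k(z), by the quotient rule on a representative. *)
Definition ratfun_der (k : fieldType) (f : ratfun k) : ratfun k :=
  let n := \n_(repr f) in let d := \d_(repr f) in
  (n^`() * d - n * d^`())%:F / (d ^+ 2)%:F.

Lemma ratfun_repr (k : fieldType) (f : ratfun k) :
  f = (\n_(repr f))%:F / (\d_(repr f))%:F.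
Proof.
have d0 := denom_ratioP (repr f).
have d0F : (\d_(repr f))%:F != 0 :> ratfun k by rewrite tofrac_eq0.
apply: (mulIf d0F); rewrite mulfVK //.
rewrite -{1}[f]reprK -[repr f in LHS]Ratio_numden.
rewrite /tofrac; unlock FracField.tofrac.
rewrite -[LHS]/(FracField.mul _ _) !piE /FracField.mulf.
apply/eqmodP; rewrite /= FracField.equivfE.
by rewrite !numden_Ratio ?mulr1 ?mul1r ?oner_neq0 // mulrC.
Qed.

Lemma quotientD_morph (A : comNzRingType) (L : fieldType)
    (f : {rmorphism A -> L}) (n d n' d' dn dd dn' dd' : A) :
  f d != 0 -> f d' != 0 ->
  f n / f d + f n' / f d' = f (n * d' + n' * d) / f (d * d') /\
  f ((dn * d' + n * dd' + (dn' * d + n' * dd)) * (d * d') -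
       (n * d' + n' * d) * (dd * d' + d * dd')) / f ((d * d') ^+ 2) =
  f (dn * d - n * dd) / f (d ^+ 2) + f (dn' * d' - n' * dd') / f (d' ^+ 2).
Proof.
by move=> d0 d'0; rewrite !(rmorphD, rmorphN, rmorphM, rmorphXn);
  split; field; apply/andP.
Qed.

Lemma quotientM_morph (A : comNzRingType) (L : fieldType)
    (f : {rmorphism A -> L}) (n d n' d' dn dd dn' dd' : A) :
  f d != 0 -> f d' != 0 ->
  f n / f d * (f n' / f d') = f (n * n') / f (d * d') /\
  f ((dn * n' + n * dn') * (d * d') - n * n' * (dd * d' + d * dd')) /
    f ((d * d') ^+ 2) =
  f (dn * d - n * dd) / f (d ^+ 2) * (f n' / f d') +
  f n / f d * (f (dn' * d' - n' * dd') / f (d' ^+ 2)).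
Proof.
by move=> d0 d'0; rewrite !(rmorphD, rmorphN, rmorphM, rmorphXn);
  split; field; apply/andP.
Qed.

Lemma quotient_identity (L : comNzRingType) (n d n' d' dn dd dn' dd' : L) :
  n * d' = n' * d -> dn * d' + n * dd' = dn' * d + n' * dd ->
  (dn * d - n * dd) * d' ^+ 2 = (dn' * d' - n' * dd') * d ^+ 2.
Proof.
move=> e e'.
have -> : (dn' * d' - n' * dd') * d ^+ 2 =
  d' * d * (dn' * d) - d * dd' * (n' * d) by ring.
have -> : dn' * d = dn * d' + n * dd' - n' * dd by rewrite e' addrK.
rewrite -e.
have -> : d' * d * (dn * d' + n * dd' - n' * dd) =
  d' * d * (dn * d' + n * dd') - d' * dd * (n' * d) by ring.
by rewrite -e; ring.
Qed.

Lemma eq_ratfun (k : fieldType) (n d n' d' : {poly k}) : d != 0 -> d' != 0 ->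
  (n%:F / d%:F == n'%:F / d'%:F :> ratfun k) = (n * d' == n' * d).
Proof.
move=> d0 d'0; rewrite eqr_div ?tofrac_eq0 //.
by rewrite -(tofracM n d') -(tofracM n' d) tofrac_eq.
Qed.

Lemma ratfun_derE (k : fieldType) (n d : {poly k}) : d != 0 ->
  ratfun_der (n%:F / d%:F) = (n^`() * d - n * d^`())%:F / (d ^+ 2)%:F.
Proof.
move=> d0; rewrite /ratfun_der; set f := n%:F / d%:F.
have := ratfun_repr f; have := denom_ratioP (repr f).
move: (\n_(repr f)) (\d_(repr f)) => n' d' d'0 /eqP.
rewrite eq_ratfun // => /eqP e.
apply/eqP; rewrite eq_ratfun ?expf_neq0 //; apply/eqP.
by apply/esym/quotient_identity; rewrite // -!derivM e.
Qed.

Lemma ratfun_derD (k : fieldType) (f g : ratfun k) :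
  ratfun_der (f + g) = ratfun_der f + ratfun_der g.
Proof.
rewrite (ratfun_repr f) (ratfun_repr g).
have := denom_ratioP (repr f); have := denom_ratioP (repr g).
move: (\n_(repr f)) (\d_(repr f)) (\n_(repr g)) (\d_(repr g)) => n d n' d'.
move=> d'0 d0.
have d0F : d%:F != 0 :> ratfun k by rewrite tofrac_eq0.
have d'0F : d'%:F != 0 :> ratfun k by rewrite tofrac_eq0.
have [E1 E2] := @quotientD_morph {poly k} (ratfun k) (@tofrac _) n d n' d'
  n^`() d^`() n'^`() d'^`() d0F d'0F.
rewrite E1 (ratfun_derE _ (mulf_neq0 d0 d'0)).
by rewrite (ratfun_derE n d0) (ratfun_derE n' d'0) -E2 derivD !derivM.
Qed.

Lemma ratfun_derM (k : fieldType) (f g : ratfun k) :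
  ratfun_der (f * g) = ratfun_der f * g + f * ratfun_der g.
Proof.
rewrite (ratfun_repr f) (ratfun_repr g).
have := denom_ratioP (repr f); have := denom_ratioP (repr g).
move: (\n_(repr f)) (\d_(repr f)) (\n_(repr g)) (\d_(repr g)) => n d n' d'.
move=> d'0 d0.
have d0F : d%:F != 0 :> ratfun k by rewrite tofrac_eq0.
have d'0F : d'%:F != 0 :> ratfun k by rewrite tofrac_eq0.
have [E1 E2] := @quotientM_morph {poly k} (ratfun k) (@tofrac _) n d n' d'
  n^`() d^`() n'^`() d'^`() d0F d'0F.
rewrite E1 (ratfun_derE _ (mulf_neq0 d0 d'0)).
by rewrite (ratfun_derE n d0) (ratfun_derE n' d'0) -E2 !derivM.
Qed.

HB.instance Definition _ (k : fieldType) :=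
  isDifferential.Build (ratfun k) (@ratfun_derD k) (@ratfun_derM k).

Lemma der_poly (k : fieldType) (p : {poly k}) :
  der (p%:F : ratfun k) = (p^`())%:F.
Proof.
have -> : p%:F = p%:F / 1%:F :> ratfun k by rewrite tofrac1 divr1.
rewrite [LHS]ratfun_derE ?oner_neq0 //.
by rewrite derivC mulr0 subr0 mulr1 expr1n tofrac1 divr1.
Qed.

Definition diff_morphism (K L : diffFieldType) (f : K -> L) : Prop :=
  forall x, f (der x) = der (f x).

Record diff_subfield (K : diffFieldType) (S : set K) : Prop := DiffSubfield {
  dsf1 : S 1;
  dsfB : forall x y, S x -> S y -> S (x - y);
  dsf_div : forall x y, S x -> S y -> S (x / y);
  dsf_der : forall x, S x -> S (der x)
}.

Definition diff_adjoin (K : diffFieldType) (S A : set K) : set K :=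
  smallest (@diff_subfield K) (S `|` A).

Definition algebraic_over (K : diffFieldType) (S : set K) (x : K) : Prop :=
  exists p : {poly K}, [/\ p != 0, forall i, S p`_i & root p x].

(* x = exp(a) with a in S: determined, up to a nonzero constant factor, by
   x' = a' x. *)
Definition exponential_over (K : diffFieldType) (S : set K) (x : K) : Prop :=
  x != 0 /\ exists2 a, S a & der x = der a * x.

Definition integral_over (K : diffFieldType) (S : set K) (x : K) : Prop :=
  exists2 a, S a & der x = a.

Definition quadrature_step (K : diffFieldType) (S T : set K) : Prop :=
  exists x : K,
    [\/ algebraic_over S x, exponential_over S x | integral_over S x] /\
    T = diff_adjoin S [set x].

(* The chain lives in a differential field K containing F and is indexed from
   0: E 0 = k(z).  Here F is the extension of k(z) generated by a fundamental
   matrix, with iota the inclusion of k(z); see picard_vessiot. *)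
Definition solvable_by_quadratures (k : fieldType) (F : diffFieldType)
    (iota : {rmorphism ratfun k -> F}) : Prop :=
  exists (K : diffFieldType) (j : {rmorphism F -> K}), diff_morphism j /\
  exists (m : nat) (E : nat -> set K),
    [/\ E 0%N = range (j \o iota),
        forall i, (i < m)%N -> quadrature_step (E i) (E i.+1)
      & range j `<=` E m].

Definition fuchsian_mx (k : fieldType) (n p : nat) (a : 'I_n -> k)
    (B : 'I_n -> 'M[k]_p) : 'M[ratfun k]_p :=
  \sum_(i < n) (('X - (a i)%:P)%:F)^-1 *: map_mx (fun c => (c%:P)%:F) (B i).

Definition fundamental_matrix (k : fieldType) (p : nat) (A : 'M[ratfun k]_p)
    (F : diffFieldType) (iota : {rmorphism ratfun k -> F}) (Y : 'M[F]_p) :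
    Prop :=
  Y \in unitmx /\ map_mx der Y = map_mx iota A *m Y.

(* F is generated over k(z) by the entries of the fundamental matrix Y and has
   k as its field of constants. *)
Record picard_vessiot (k : fieldType) (p : nat) (A : 'M[ratfun k]_p)
    (F : diffFieldType) (iota : {rmorphism ratfun k -> F}) (Y : 'M[F]_p) :
    Prop := PicardVessiot {
  pv_morph : diff_morphism iota;
  pv_fundamental : fundamental_matrix A iota Y;
  pv_generated :
    diff_adjoin (range iota) [set Y q.1 q.2 | q in [set: 'I_p * 'I_p]] = setT;
  pv_constants : forall x : F, der x = 0 -> exists c : k, x = iota (c%:P)%:F
}.

Definition upper_triangular (k : fieldType) (p : nat) (M : 'M[k]_p) : Prop :=
  forall r s : 'I_p, (s < r)%N -> M r s = 0.

Definition simultaneously_triangular (k : fieldType) (n p : nat)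
    (B : 'I_n -> 'M[k]_p) : Prop :=
  exists2 C : 'M[k]_p, C \in unitmx &
    forall i, upper_triangular (C *m B i *m invmx C).

(* Main.v *)
(** Necessity. A column of Y spans a line invariant under the connection d/dz - A,
    with coordinates in the last field of the chain. Going down the chain, this
    line is replaced by one algebraic over the previous field F_i: if the adjoined
    x is transcendental, choose a valuation ring R containing F_i but not x; it
    restricts to the place x = oo of F_i(x), where t = 1/x satisfies t' = c t with
    c in R. A derivation with this property preserves R and its maximal ideal on
    the elements algebraic over F_i(x), so the line, in projective coordinates,
    specialises to the residue field. One reaches a line algebraic over C(z).

    At a place over a_i, a term of fractional exponent in the expansion of the
    projective coordinates would produce two eigenvalues of B_i whose difference
    is rational but not an integer; so the coordinates are unramified everywhere.
    A polynomial multiple G of such a coordinate is regular at all finite places.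
    A derivative of G of high enough order also vanishes at infinity and hence is
    zero: G is a polynomial and the line is rational.

    Let w be a primitive polynomial vector of degree m on the line, w' = A w - u w.
    The residue of u at a_i is an eigenvalue of B_i, and these residues add up to
    -m. By the lower bound on the real parts their sum is larger than -1, so w is
    constant, a common eigenvector of the B_i, and one argues by induction on p.

    Sufficiency. After adjoining integrals of the diagonal entries and their
    exponentials, a triangular system is solved by integrals from the last row up.
    *)

From HB Require Import structures.
Require Import Defs.
From mathcomp Require Import all_boot all_order all_algebra.
From mathcomp Require Import complex.
From mathcomp Require Import boolp classical_sets reals.
From mathcomp Require Import ring lra zify.
Set Implicit Arguments.
Unset Strict Implicit.
Unset Printing Implicit Defensive.
Import Order.TTheory GRing.Theory Num.Theory.
Local Open Scope ring_scope.

(** * Derivations and differential subfields *)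

(** The functions that occur are algebraic over a field [E(t)] whose coefficients form an arbitrary
    differential field of characteristic zero, so Puiseux expansions are replaced by a valuation
    ring obtained from Zorn's lemma. On [L] it may be neither discrete nor complete; only its trace
    on the base is understood. That a logarithmic derivation preserves it is therefore proved in two
    stages. The trace form bounds the denominators that the derivation can introduce on a finite
    extension. This bound is then removed: if [g] is a polynomial over the coefficients with [g(w)]
    in the maximal ideal and [g'(w)] a unit, the derivative of [w] is controlled by that of [g(w)],
    whose positive value absorbs a fixed fraction of the pole.

    Projective coordinates are specialised because one of them can be normalised to 1, so that the
    line does not collapse.

    The same valuation rings serve as the points over the Riemann sphere of an algebraic function
    over C(z): regularity and vanishing are membership statements, and Liouville's theorem needs no
    theory of curves. *)

Lemma rmorphism_of (A B : nzRingType) (f : A -> B) :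
  (forall x y, f (x - y) = f x - f y) -> f 1 = 1 ->
  (forall x y, f (x * y) = f x * f y) ->
  exists g : {rmorphism A -> B}, forall x, g x = f x.
Proof.
move=> fB f1 fM.
pose fA := GRing.isZmodMorphism.Build A B f fB.
pose fR := GRing.isMonoidMorphism.Build A B f (conj f1 fM).
pose g : {rmorphism A -> B} := HB.pack f fA fR.
by exists g.
Qed.

Section Derivation.
Variable K : fieldType.
Variable d : K -> K.
Hypothesis dD : forall x y, d (x + y) = d x + d y.
Hypothesis dM : forall x y, d (x * y) = d x * y + x * d y.

Lemma derivation0 : d 0 = 0.
Proof. by apply: (addIr (d 0)); rewrite -dD !add0r. Qed.

Lemma derivation1 : d 1 = 0.
Proof. by apply: (addIr (d 1)); rewrite -{3}[1]mulr1 dM mulr1 mul1r add0r. Qed.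

Lemma derivationN x : d (- x) = - d x.
Proof. by apply: (addIr (d x)); rewrite -dD !addNr derivation0. Qed.

Lemma derivationB x y : d (x - y) = d x - d y.
Proof. by rewrite dD derivationN. Qed.

Lemma derivationV x : d x^-1 = - (d x / x ^+ 2).
Proof.
have [->|x0] := eqVneq x 0; first by rewrite invr0 derivation0 mul0r oppr0.
have := dM x x^-1; rewrite divff // derivation1 => /esym/eqP.
rewrite addrC addr_eq0 => /eqP e; apply: (mulfI x0); rewrite e.
by field.
Qed.

Lemma derivation_div x y : y != 0 -> d (x / y) = (d x * y - x * d y) / y ^+ 2.
Proof. by move=> y0; rewrite dM derivationV; field. Qed.

Lemma derivationX x n : d (x ^+ n.+1) = n.+1%:R * x ^+ n * d x.
Proof.
elim: n => [|n IH]; first by rewrite !mul1r.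
rewrite exprS dM IH.
have -> : n.+2%:R = 1 + n.+1%:R :> K by rewrite -natr1 addrC.
by rewrite exprS; ring.
Qed.

Lemma derivation_sum I (r : seq I) (P : pred I) (F : I -> K) :
  d (\sum_(i <- r | P i) F i) = \sum_(i <- r | P i) d (F i).
Proof. exact: (big_morph d dD derivation0). Qed.

Lemma derivation_horner (p : {poly K}) x :
  d p.[x] = (map_poly d p).[x] + p^`().[x] * d x.
Proof.
elim/poly_ind: p => [|p c IH].
  rewrite horner0 derivation0 deriv0 horner0 mul0r addr0 /map_poly.
  by rewrite size_poly0 poly_def big_ord0 horner0.
have -> : map_poly d (p * 'X + c%:P) = map_poly d p * 'X + (d c)%:P.
  apply/polyP => i; rewrite coef_map_id0 ?derivation0 //.
  rewrite !coefD !coefMX !coefC; case: i => [|i] /=; first by rewrite !add0r.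
  by rewrite !addr0 coef_map_id0 ?derivation0.
rewrite derivE !hornerE dD dM IH; ring.
Qed.

End Derivation.

(** * Differential subfields as types *)

Section SubfieldType.
Variables (K : diffFieldType) (S : set K) (Sf : diff_subfield S).

Definition inS : {pred K} := fun x => `[< S x >].

Fact inS_divring : divring_closed inS.
Proof.
split; first exact/asboolP/(dsf1 Sf).
- by move=> x y /asboolP Sx /asboolP Sy; apply/asboolP/(dsfB Sf).
- by move=> x y /asboolP Sx /asboolP Sy; apply/asboolP/(dsf_div Sf).
Qed.

HB.instance Definition _ := GRing.isDivringClosed.Build K inS inS_divring.

Definition sub_type := {x : K | inS x}.

HB.instance Definition _ := [isSub of sub_type for sval].
HB.instance Definition _ := [Choice of sub_type by <:].
HB.instance Definition _ := [SubChoice_isSubIntegralDomain of sub_type by <:].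
HB.instance Definition _ := [SubIntegralDomain_isSubField of sub_type by <:].

Definition derE (x : sub_type) : sub_type :=
  Sub (der (val x)) (asboolT (dsf_der Sf (asboolW (valP x)))).

Fact derE_D x y : derE (x + y) = derE x + derE y.
Proof. by apply: val_inj; rewrite /= derD. Qed.

Fact derE_M x y : derE (x * y) = derE x * y + x * derE y.
Proof. by apply: val_inj; rewrite /= derM. Qed.

HB.instance Definition _ := isDifferential.Build sub_type derE_D derE_M.

(** A chain of quadratures is given by subsets of one field, whereas the descent needs each member
    as a differential field of its own, with an embedding. *)
Lemma diff_subfield_type : exists (E' : diffFieldType) (f : {rmorphism E' -> K}),
  diff_morphism f /\ range f = S.
Proof.
exists sub_type, val; split=> //; apply/seteqP; split=> [_ [x _ <-]|x Sx] /=.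
  exact: asboolW (valP x).
by exists (Sub x (asboolT Sx)) => //; rewrite SubK.
Qed.

End SubfieldType.

(** * The residue field of a differential local ring *)

Section ResidueField.
Variables (L : diffFieldType) (A m : set L).
Hypotheses (A1 : A 1) (AB : forall x y, A x -> A y -> A (x - y))
  (AM : forall x y, A x -> A y -> A (x * y)) (Ad : forall x, A x -> A (der x)).
Hypotheses (m0 : m 0) (m1 : ~ m 1)
  (mD : forall x y, m x -> m y -> m (x + y))
  (mM : forall a x, A a -> m x -> m (a * x)) (md : forall x, m x -> m (der x))
  (Ainv : forall x, A x -> ~ m x -> A x^-1).

Definition mem_subring : {pred L} := fun x => `[< A x >].

Fact mem_subring_closed : subring_closed mem_subring.
Proof.
split; first exact/asboolP.
- by move=> x y /asboolP Ax /asboolP Ay; apply/asboolP/AB.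
- by move=> x y /asboolP Ax /asboolP Ay; apply/asboolP/AM.
Qed.

HB.instance Definition _ := GRing.isSubringClosed.Build L mem_subring mem_subring_closed.

Definition subring_type := {x : L | mem_subring x}.

HB.instance Definition _ := [isSub of subring_type for sval].
HB.instance Definition _ := [Choice of subring_type by <:].
HB.instance Definition _ := [SubChoice_isSubComNzRing of subring_type by <:].

Definition mem_ideal : {pred subring_type} := fun x => `[< m (val x) >].

Fact mem_ideal_closed : idealr_closed mem_ideal.
Proof.
split; first exact/asboolP.
  by apply/asboolPn.
move=> a u v /asboolP mu /asboolP mv; apply/asboolP => /=.
by apply: mD => //; apply: mM => //; apply: asboolW (valP a).
Qed.

HB.instance Definition _ := isIdealr.Build subring_type mem_ideal mem_ideal_closed.

Definition residue_quot := {ideal_quot mem_ideal}.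

Let mkA x (Ax : A x) : subring_type := Sub x (asboolT Ax).

Local Notation proj := (\pi_residue_quot)%qT.

Fact proj_eq (x y : subring_type) : proj x = proj y <-> m (val x - val y).
Proof.
split=> [/eqP|h]; first by rewrite -Quotient.idealrBE => /asboolP.
by apply/eqP; rewrite -Quotient.idealrBE; apply/asboolP.
Qed.

Definition invQ (q : residue_quot) : residue_quot := proj (insubd 0 (val (repr q))^-1).

Fact mulVQ q : q != 0 -> invQ q * q = 1.
Proof.
move=> q0; rewrite -{2}[q]reprK /invQ.
have nm : ~ m (val (repr q)).
  move=> mq; case/eqP: q0; rewrite -[q]reprK -(rmorph0 (\pi_residue_quot)%qT).
  by apply/proj_eq; rewrite subr0.
rewrite -rmorphM -(rmorph1 (\pi_residue_quot)%qT); apply/proj_eq.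
rewrite /= insubdK; last by apply/asboolP/Ainv => //; apply: asboolW (valP (repr q)).
rewrite mulVf ?subrr //; apply/eqP => e; apply: nm.
by have -> : val (repr q) = 0 by exact: e.
Qed.

Definition invQ' (q : residue_quot) : residue_quot := if q == 0 then 0 else invQ q.

Fact mulVQ' q : q != 0 -> invQ' q * q = 1.
Proof. by move=> q0; rewrite /invQ' (negPf q0) mulVQ. Qed.

Fact invQ0 : invQ' 0 = 0. Proof. by rewrite /invQ' eqxx. Qed.

HB.instance Definition _ := GRing.ComNzRing.on residue_quot.
HB.instance Definition _ := GRing.ComNzRing_isField.Build residue_quot mulVQ' invQ0.

Definition derA (x : subring_type) : subring_type := mkA (Ad (asboolW (valP x))).

Definition derQ (q : residue_quot) : residue_quot := proj (derA (repr q)).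

Fact derQ_proj x : derQ (proj x) = proj (derA x).
Proof.
apply/proj_eq => /=; rewrite -(derivationB (@derD L)); apply: md.
by apply/proj_eq; rewrite reprK.
Qed.

Fact derQ_D x y : derQ (x + y) = derQ x + derQ y.
Proof.
rewrite -[x]reprK -[y]reprK -rmorphD !derQ_proj -rmorphD; congr proj.
by apply: val_inj; rewrite /= derD.
Qed.

Fact derQ_M x y : derQ (x * y) = derQ x * y + x * derQ y.
Proof.
rewrite -[x]reprK -[y]reprK -rmorphM !derQ_proj -!rmorphM -rmorphD; congr proj.
by apply: val_inj; rewrite /= derM.
Qed.

HB.instance Definition _ := isDifferential.Build residue_quot derQ_D derQ_M.

(** Specialised lines live here: the derivation preserves both [A] and [m], so it descends to the
    quotient. [res] is total on [L], with value 0 outside [A], so that no membership proofs occur in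
    its arguments. *)
Lemma residue_diff_field : exists (k : diffFieldType) (res : L -> k),
  [/\ res 1 = 1,
      forall x y, A x -> A y -> res (x - y) = res x - res y,
      forall x y, A x -> A y -> res (x * y) = res x * res y,
      forall x, A x -> res (der x) = der (res x)
    & forall x, A x -> res x = 0 <-> m x].
Proof.
pose res (x : L) : residue_quot := proj (insubd 0 x).
have resE x (Ax : A x) : res x = proj (mkA Ax).
  by rewrite /res; congr proj; apply: val_inj; rewrite insubdK //; apply/asboolP.
exists residue_quot, res; split.
- by rewrite resE -(rmorph1 (\pi_residue_quot)%qT); congr proj; apply: val_inj.
- move=> x y Ax Ay; rewrite (resE _ (AB Ax Ay)) !resE -rmorphB.
  by congr proj; apply: val_inj.
- move=> x y Ax Ay; rewrite (resE _ (AM Ax Ay)) !resE -rmorphM.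
  by congr proj; apply: val_inj.
- move=> x Ax; rewrite (resE _ (Ad Ax)) resE [RHS]derQ_proj.
  by congr proj; apply: val_inj.
- move=> x Ax; rewrite resE -[X in _ = X <-> _](rmorph0 (\pi_residue_quot)%qT).
  by rewrite proj_eq /= subr0.
Qed.

End ResidueField.

(** * Valuation rings *)

Record subring (L : fieldType) (A : set L) : Prop := Subring {
  sr1 : A 1;
  srB : forall x y, A x -> A y -> A (x - y);
  srM : forall x y, A x -> A y -> A (x * y)
}.

Section Subring.
Variables (L : fieldType) (A : set L) (sA : subring A).

Lemma sr0 : A 0. Proof. by rewrite -(subrr 1); apply: srB sA _ _ _ _; apply: sr1. Qed.

Lemma srN x : A x -> A (- x).
Proof. by move=> Ax; rewrite -[- x]add0r; apply: (srB sA) => //; apply: sr0. Qed.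

Lemma srD x y : A x -> A y -> A (x + y).
Proof. by move=> Ax Ay; rewrite -[y]opprK; apply: (srB sA) => //; apply: srN. Qed.

Lemma srX x n : A x -> A (x ^+ n).
Proof.
move=> Ax; elim: n => [|n IH]; first exact: (sr1 sA).
by rewrite exprS; apply: (srM sA).
Qed.

Lemma sr_nat n : A n%:R.
Proof.
elim: n => [|n IH]; first exact: sr0.
by rewrite -natr1; apply: srD => //; apply: (sr1 sA).
Qed.

Lemma sr_sum I (r : seq I) (P : pred I) (F : I -> L) :
  (forall i, P i -> A (F i)) -> A (\sum_(i <- r | P i) F i).
Proof. by move=> AF; apply: (big_ind A) => //; [exact: sr0 | exact: srD]. Qed.

Lemma sr_prod I (r : seq I) (P : pred I) (F : I -> L) :
  (forall i, P i -> A (F i)) -> A (\prod_(i <- r | P i) F i).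
Proof. by move=> AF; apply: (big_ind A) => //; [exact: (sr1 sA) | exact: (srM sA)]. Qed.

Lemma sr_horner (p : {poly L}) x : (forall i, A p`_i) -> A x -> A p.[x].
Proof.
move=> Ap Ax; rewrite horner_coef; apply: sr_sum => i _.
by apply: (srM sA) => //; apply: srX.
Qed.

Lemma sr_coefM (p q : {poly L}) :
  (forall i, A p`_i) -> (forall i, A q`_i) -> forall i, A (p * q)`_i.
Proof. by move=> Ap Aq i; rewrite coefM; apply: sr_sum => j _; apply: (srM sA). Qed.

Definition sr_adjoin (y : L) : set L :=
  fun z => exists2 p : {poly L}, (forall i, A p`_i) & z = p.[y].

Lemma sub_sr_adjoin y : (A `<=` sr_adjoin y)%classic.
Proof.
move=> a Aa; exists a%:P; rewrite ?hornerC // => i.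
by rewrite coefC; case: ifP => // _; apply: sr0.
Qed.

Lemma sr_adjoin_gen y : sr_adjoin y y.
Proof.
exists 'X; rewrite ?hornerX // => i; rewrite coefX.
by case: eqP => _; [apply: (sr1 sA) | apply: sr0].
Qed.

Lemma sr_adjoin_subring y : subring (sr_adjoin y).
Proof.
split; first exact/sub_sr_adjoin/(sr1 sA).
  move=> _ _ [p Ap ->] [q Aq ->]; exists (p - q); last by rewrite !hornerE.
  by move=> i; rewrite coefB; apply: (srB sA).
move=> _ _ [p Ap ->] [q Aq ->]; exists (p * q); last by rewrite hornerM.
exact: sr_coefM.
Qed.

End Subring.

Lemma diff_subfield_subring (K : diffFieldType) (S : set K) :
  diff_subfield S -> subring S.
Proof.
move=> Sf; have S1 := dsf1 Sf.
have SV y : S y -> S y^-1 by move=> Sy; rewrite -[y^-1]mul1r; apply: (dsf_div Sf).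
split=> // x y Sx Sy; first exact: (dsfB Sf).
by rewrite -[y]invrK; apply: (dsf_div Sf) => //; apply: SV.
Qed.

Record valring (L : fieldType) (R : set L) : Prop := Valring {
  vr_subring :> subring R;
  vr_total : forall x, R x \/ R x^-1
}.

(** The nonunits of [R]. Zero is listed separately because [0^-1 = 0] belongs to [R]; a nonzero
    element whose inverse is outside [R] lies in [R] by totality. *)
Definition maxid (L : fieldType) (R : set L) (x : L) : Prop := x = 0 \/ ~ R x^-1.

Section Valring.
Variables (L : fieldType) (R : set L) (V : valring R).
Local Notation m := (maxid R).

Lemma maxid_in x : m x -> R x.
Proof. by case=> [->|nx]; [exact: (sr0 V) | case: (vr_total V x)]. Qed.

Lemma maxid0 : m 0. Proof. by left. Qed.

Lemma maxid1 : ~ m 1.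
Proof.
case=> [/eqP|]; first by rewrite oner_eq0.
by rewrite invr1; apply; apply: (sr1 V).
Qed.

Lemma maxidPn x : ~ m x -> x != 0 /\ R x^-1.
Proof.
move=> nm; split; first by apply/eqP => x0; apply: nm; left.
by apply: contrapT => nR; apply: nm; right.
Qed.

Lemma maxid_inv x : x != 0 -> ~ m x <-> R x^-1.
Proof.
move=> x0; split=> [/maxidPn[_]|Rx] //.
by case=> [x00|nR]; [rewrite x00 eqxx in x0 | exact: nR].
Qed.

Lemma maxidV x : ~ R x -> m x^-1.
Proof. by move=> nR; right; rewrite invrK. Qed.

Lemma maxidM a x : R a -> m x -> m (a * x).
Proof.
move=> Ra [->|nx]; first by rewrite mulr0; left.
have [->|a0] := eqVneq a 0; first by rewrite mul0r; left.
right=> h; apply: nx.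
have -> : x^-1 = a * (a * x)^-1 by rewrite invfM mulrA divff // mul1r.
exact: (srM V).
Qed.

Lemma maxidN x : m x -> m (- x).
Proof. by rewrite -mulN1r; apply: maxidM; apply: (srN V); apply: (sr1 V). Qed.

Lemma maxidD x y : m x -> m y -> m (x + y).
Proof.
have main u v : m u -> m v -> R (u / v) -> m (u + v).
  move=> mu mv Ruv; have [v0|v0] := eqVneq v 0; first by rewrite v0 addr0.
  have -> : u + v = (u / v + 1) * v by rewrite mulrDl mul1r divfK.
  by apply: maxidM => //; apply: (srD V) => //; apply: (sr1 V).
move=> mx my; case: (vr_total V (x / y)) => h; first exact: main.
by rewrite addrC; apply: main => //; move: h; rewrite invf_div.
Qed.

Lemma maxidB x y : m x -> m y -> m (x - y).
Proof. by move=> mx /maxidN; apply: maxidD. Qed.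

Lemma maxid_sum I (r : seq I) (P : pred I) (F : I -> L) :
  (forall i, P i -> m (F i)) -> m (\sum_(i <- r | P i) F i).
Proof. by move=> mF; apply: (big_ind m) => //; [exact: maxid0 | exact: maxidD]. Qed.

Lemma maxid_mul_unit x y : R x -> R y -> ~ m x -> ~ m y -> ~ m (x * y).
Proof.
move=> Rx Ry /maxidPn[x0 Rx'] /maxidPn[y0 Ry'].
by apply/maxid_inv; rewrite ?mulf_neq0 // invfM; apply: (srM V).
Qed.

Lemma vr_integral (p : {poly L}) x :
  p \is monic -> (forall i, R p`_i) -> root p x -> R x.
Proof.
move=> pm Rp /rootP px; case: (vr_total V x) => // Rx.
apply: contrapT => nx; have mx := maxidV nx.
have x0 : x != 0 by apply/eqP => x0; apply: nx; rewrite x0; exact: (sr0 V).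
case: (posnP (size p)) => [/eqP|s0].
  by rewrite size_poly_eq0 => /eqP p0; move: pm; rewrite p0 monicE lead_coef0 eq_sym oner_eq0.
set n := (size p).-1; have sp : size p = n.+1 by rewrite prednK.
(* The equation divided by [x ^+ n]: if [x] is not in [R], all terms on the right lie in the maximal
   ideal. *)
have e : 1 = - \sum_(i < n) p`_i * x^-1 ^+ (n - i).
  move: px; rewrite horner_coef sp big_ord_recr /= -[p`_n]/(lead_coef p).
  rewrite (monicP pm) mul1r => /(canRL (addKr _)); rewrite addr0 => e.
  have -> : 1 = x ^+ n / x ^+ n by rewrite divff ?expf_neq0.
  rewrite {1}e mulNr mulr_suml; congr (- _); apply: eq_bigr => i _.
  rewrite -mulrA; congr (_ * _); rewrite exprVn.
  have -> : x ^+ n = x ^+ i * x ^+ (n - i) by rewrite -exprD subnKC // ltnW.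
  by rewrite invfM mulrA divff ?mul1r ?expf_neq0.
apply: maxid1; rewrite e; apply: maxidN; apply: maxid_sum => i _.
apply: maxidM => //; case: (n - i)%N (subn_gt0 i n) => [|k _].
  by rewrite ltn_ord.
by rewrite exprSr; apply: maxidM => //; apply: (srX V).
Qed.

Lemma vr_root x n : R (x ^+ n.+1) -> R x.
Proof.
move=> h; have pm := monicXnsubC (x ^+ n.+1) (ltn0Sn n).
apply: (vr_integral pm).
- move=> i; rewrite coefB coefXn coefC; apply: (srB V).
    by case: eqP => _; [apply: (sr1 V) | apply: (sr0 V)].
  by case: ifP => // _; apply: (sr0 V).
- by rewrite rootE !hornerE subrr.
Qed.

(** An entry of largest absolute value, without a value group: totality of [R] compares any two
    entries, and the maximum is kept along a list. *)
Lemma vr_max (I : finType) (v : I -> L) : (exists i, v i != 0) ->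
  exists i, v i != 0 /\ forall j, R (v j / v i).
Proof.
case=> i0 vi0.
suff H (s : seq I) : exists i, v i != 0 /\ forall j, j \in i0 :: s -> R (v j / v i).
  by have [i [vi h]] := H (enum I); exists i; split=> // j; apply: h; rewrite inE mem_enum orbT.
elim: s => [|k s [i [vi IH]]].
  by exists i0; split=> // j; rewrite inE => /eqP ->; rewrite divff //; apply: (sr1 V).
have [vk0|vk] := eqVneq (v k) 0.
  exists i; split=> // j; rewrite !inE => /or3P[/eqP->|/eqP->|js].
  - by apply: IH; rewrite inE eqxx.
  - by rewrite vk0 mul0r; apply: (sr0 V).
  - by apply: IH; rewrite inE js orbT.
case: (vr_total V (v k / v i)) => h.
  exists i; split=> // j; rewrite !inE => /or3P[/eqP->|/eqP->|js] //.
  - by apply: IH; rewrite inE eqxx.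
  - by apply: IH; rewrite inE js orbT.
exists k; split=> // j hj.
have [->|jk] := eqVneq j k; first by rewrite divff //; apply: (sr1 V).
have -> : v j / v k = (v j / v i) * (v k / v i)^-1 by rewrite invf_div mulrA divfK.
by apply: (srM V) => //; apply: IH; move: hj; rewrite !inE (negPf jk).
Qed.

End Valring.

(* A maximal subring among those containing A and avoiding x is a valuation
   ring. *)
Lemma chevalley (L : fieldType) (A : set L) (x : L) :
  subring A -> A x^-1 -> ~ A x ->
  exists R : set L, [/\ valring R, (A `<=` R)%classic & ~ R x].
Proof.
move=> sA At nAx.
pose good (B : set L) := [/\ subring B, (A `<=` B)%classic & ~ B x].
pose P (B : set L) := (forall y, ~ B y) \/ good B.
have [R [PR Rmax]] : exists R, P R /\ forall B, (R `<` B)%classic -> ~ P B.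
  apply: Zorn_bigcup => F FP Ftot.
  have [[B0 [FB0 [y0 B0y0]]]|nF] := pselect (exists B, F B /\ exists y, B y); last first.
    by left=> y [B FB By]; apply: nF; exists B; split => //; exists y.
  have gF B : F B -> (exists y, B y) -> good B.
    by move=> FB [y By]; case: (FP _ FB) => // /(_ y).
  have [sB0 AB0 nB0] := gF _ FB0 (ex_intro _ _ B0y0).
  have join y z : (\bigcup_(X in F) X)%classic y -> (\bigcup_(X in F) X)%classic z ->
      exists B, [/\ F B, B y & B z].
    move=> [B FB By] [C FC Cz]; case: (Ftot _ _ FB FC) => h.
      by exists C; split => //; apply: h.
    by exists B; split => //; apply: h.
  right; split; first split.
  - by exists B0 => //; apply: (sr1 sB0).
  - move=> y z Uy Uz; have [B [FB By Bz]] := join _ _ Uy Uz.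
    exists B => //; have [sB _ _] := gF _ FB (ex_intro _ _ By); exact: (srB sB).
  - move=> y z Uy Uz; have [B [FB By Bz]] := join _ _ Uy Uz.
    exists B => //; have [sB _ _] := gF _ FB (ex_intro _ _ By); exact: (srM sB).
  - by move=> y Ay; exists B0 => //; apply: AB0.
  - by move=> [B FB Bx]; have [_ _] := gF _ FB (ex_intro _ _ Bx).
case: PR => [R0|[sR AR nRx]].
  case: (Rmax A); last by right; split.
  by split=> [y /R0 //|/(_ 1)]; move=> h; apply: (R0 1); apply: h; apply: (sr1 sA).
have x0 : x != 0 by apply/eqP => x0; apply: nRx; rewrite x0; apply: (sr0 sR).
have Rt := AR _ At; set t := x^-1 in Rt.
have tx : t * x = 1 by rewrite mulVf.
(* By maximality, adjoining an element outside [R] brings in [x]. *)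
have adj y : ~ R y -> exists2 p : {poly L}, (forall i, R p`_i) & x = p.[y].
  move=> nRy; apply: contrapT => nx; apply: (Rmax (sr_adjoin R y)).
    split; first exact: sub_sr_adjoin.
    by move=> h; apply: nRy; apply: h; apply: sr_adjoin_gen.
  right; split; first exact: sr_adjoin_subring.
    by move=> z /AR; apply: sub_sr_adjoin.
  by move=> [p Rp xp]; apply: nx; exists p.
have pow1 a n : R a -> exists2 b, R b & (1 - t * a) ^+ n = 1 - t * b.
  move=> Ra; elim: n => [|n [b Rb IH]].
    by exists 0; [apply: (sr0 sR) | rewrite mulr0 subr0].
  exists (a + b - t * a * b); last by rewrite exprS IH; ring.
  by apply: (srB sR); [apply: (srD sR) | do 2!apply: (srM sR) => //].
(* If [u = 1 - t * a] had no inverse in [R], then [x] would be a polynomial in [u^-1], so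
   [x * u ^+ N] would lie in [R] for some [N]; as [u ^+ N = 1 - t * b], this product is [x - b]. *)
have unit1 a : R a -> R (1 - t * a)^-1.
  move=> Ra; apply: contrapT => nRu; set u := 1 - t * a in nRu.
  have u0 : u != 0.
    by apply/eqP => u0; apply: nRu; rewrite u0 invr0; apply: (sr0 sR).
  have [p Rp xp] := adj _ nRu.
  have [b Rb ub] := pow1 a (size p) Ra.
  have Ru : R u by apply: (srB sR); [apply: (sr1 sR)|apply: (srM sR)].
  have Rr : R (x * u ^+ size p).
    rewrite {1}xp horner_coef mulr_suml; apply: (sr_sum sR) => i _.
    have -> : u ^+ size p = u ^+ i * u ^+ (size p - i) by rewrite -exprD subnKC // ltnW.
    rewrite exprVn mulrA -[_ * _^-1 * _]mulrA mulVf ?expf_neq0 // mulr1.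
    by apply: (srM sR) => //; apply: (srX sR).
  apply: nRx; have -> : x = x * u ^+ size p + b.
    by rewrite ub mulrBr mulr1 mulrA [x * t]mulrC tx mul1r subrK.
  exact: (srD sR).
(* Multiplied by [t], the relation in [y^-1] reads [u = t * (x - q_0)], where [u = 1 - t * q_0] is a
   unit. As [q] is not longer than [p], this expresses [y ^+ n] by lower powers and removes the
   leading term of [p]. *)
have step (y : L) (p q : {poly L}) : (forall i, R p`_i) -> (forall i, R q`_i) -> y != 0 ->
    x = p.[y] -> x = q.[y^-1] -> (size q <= size p)%N ->
    exists p' : {poly L}, [/\ (size p' < size p)%N, forall i, R p'`_i & x = p'.[y]].
  move=> Rp Rq y0 xp xq spq.
  case sp: (size p) => [|n].
    move: sp => /eqP; rewrite size_poly_eq0 => /eqP p0.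
    by move: x0; rewrite xp p0 horner0 eqxx.
  set u := 1 - t * q`_0; have Ru := unit1 _ (Rq 0).
  have u0 : u != 0.
    apply/eqP => u0; apply: nRx; have -> : x = q`_0; last exact: Rq.
    by rewrite -[LHS]mulr1; move/eqP: u0; rewrite subr_eq0 => /eqP ->; rewrite mulrA [x * t]mulrC tx mul1r.
  exists (\poly_(i < n) (p`_i + p`_n * (u^-1 * t * q`_(n - i)))); split.
  - exact: leq_ltn_trans (size_poly _ _) _.
  - move=> i; rewrite coef_poly; case: ifP => _; last exact: (sr0 sR).
    by apply: (srD sR) => //; do 3!apply: (srM sR) => //.
  rewrite horner_poly {1}xp horner_coef sp big_ord_recr /=.
  under [RHS]eq_bigr do rewrite mulrDl.
  rewrite big_split /=; congr (_ + _).
  under eq_bigr do rewrite -mulrA.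
  rewrite -mulr_sumr; congr (_ * _).
  have qe : x - q`_0 = \sum_(i < n) q`_(n - i) * y ^- (n - i).
    rewrite {1}xq (@horner_coef_wide _ n.+1) -?sp // sp big_ord_recl /= expr0 mulr1.
    rewrite addrC addKr (reindex_inj rev_ord_inj) /=; apply: eq_bigr => i _.
    by rewrite /bump /= exprVn add1n subnSK.
  have : u^-1 * t * (x - q`_0) = 1 by rewrite -mulrA mulrBr tx mulVf.
  rewrite qe => /(congr1 (fun z => z * y ^+ n)); rewrite mul1r => <-.
  rewrite mulr_sumr mulr_suml; apply: eq_bigr => i _.
  have -> : y ^+ n = y ^+ (n - i) * y ^+ i by rewrite -exprD subnK // ltnW.
  by field; rewrite expf_neq0 // u0.
exists R; split=> //; split=> // y; apply: contrapT => /not_orP[nRy nRy'].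
have y0 : y != 0 by apply/eqP => y0; apply: nRy; rewrite y0; apply: (sr0 sR).
have [p Rp xp] := adj _ nRy; have [q Rq xq] := adj _ nRy'.
have [N leN] : exists N, (size p + size q <= N)%N by exists (size p + size q)%N.
elim: N y p q y0 Rp Rq xp xq leN {nRy nRy'} => [|N IH] y p q y0 Rp Rq xp xq leN.
  move: leN; rewrite leqn0 addn_eq0 size_poly_eq0 => /andP[/eqP p0 _].
  by move: x0; rewrite xp p0 horner0 eqxx.
have [le|/ltnW le] := leqP (size q) (size p).
  have [p' [sp' Rp' xp']] := step _ _ _ Rp Rq y0 xp xq le.
  apply: (IH y p' q) => //; rewrite -ltnS; apply: leq_trans leN.
  by rewrite ltn_add2r.
have [||p' [sp' Rp' xp']] := step _ _ _ Rq Rp _ xq _ le; rewrite ?invr_eq0 ?invrK //.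
apply: (IH y p p') => //; rewrite -ltnS; apply: leq_trans leN.
by rewrite ltn_add2l.
Qed.

(** * Integrality and traces *)

Section Gauss.
Variables (F : fieldType) (R : set F) (V : valring R).

Lemma common_denominator (I : finType) (c : I -> F) :
  exists D : F, [/\ D != 0, R D & forall i, R (D * c i)].
Proof.
(* The extra entry 1 forces the inverse of the largest entry to lie in [R]. *)
pose v (o : option I) := if o is Some i then c i else 1.
have [|o [vo h]] := vr_max V (v := v); first by exists None; apply: oner_neq0.
exists (v o)^-1; split; first by rewrite invr_eq0.
  by have := h None; rewrite /= mul1r.
by move=> i; rewrite mulrC; apply: (h (Some i)).
Qed.

Lemma primitive_scaling (p : {poly F}) : p != 0 ->
  exists (c : F) (i : nat), [/\ c != 0, forall j, R (c * p`_j), ~ maxid R (c * p`_i)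
    & forall j, (j < i)%N -> maxid R (c * p`_j)].
Proof.
move=> p0; have sp : (0 < size p)%N by rewrite size_poly_gt0.
have [|k [pk h]] := vr_max V (v := fun k : 'I_(size p) => p`_k).
  have lt : ((size p).-1 < size p)%N by rewrite prednK.
  by exists (Ordinal lt); rewrite /= -/(lead_coef p) lead_coef_eq0.
have hR j : R ((p`_k)^-1 * p`_j).
  have [ltj|lej] := ltnP j (size p); first by rewrite mulrC; apply: (h (Ordinal ltj)).
  by rewrite [p`_j]nth_default // mulr0; apply: (sr0 V).
have ex : exists i, `[< ~ maxid R ((p`_k)^-1 * p`_i) >].
  by exists k; apply/asboolP; rewrite mulVf //; apply: maxid1.
exists (p`_k)^-1, (ex_minn ex); case: ex_minnP => i /asboolP ni imin.
split=> //; first by rewrite invr_eq0.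
move=> j ltji; apply: contrapT => nm.
have /asboolP/imin : ~ maxid R ((p`_k)^-1 * p`_j) by [].
by rewrite leqNgt ltji.
Qed.

(** Scale [p] and [q] by [c] and [d] to primitive polynomials. The coefficient of the product at the
    sum of the first unit indices is a unit, so [c * d] is one. As leading coefficients of the
    scaled polynomials, [c] and [d] lie in [R]; hence [c] is a unit. *)
Lemma gauss_monic (p q : {poly F}) : p \is monic -> q \is monic ->
  (forall i, R (p * q)`_i) -> forall i, R p`_i.
Proof.
move=> pm qm Rpq.
have [c [i [c0 Rc ni hi]]] := primitive_scaling (monic_neq0 pm).
have [d [j [d0 Rd nj hj]]] := primitive_scaling (monic_neq0 qm).
have Rc1 : R c.
  by have := Rc (size p).-1; rewrite -/(lead_coef p) (monicP pm) mulr1.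
have Rd1 : R d.
  by have := Rd (size q).-1; rewrite -/(lead_coef q) (monicP qm) mulr1.
have nunit : ~ maxid R (c * d).
  move=> mcd; have : maxid R (\sum_(k < (i + j).+1) (c * p`_k) * (d * q`_(i + j - k))).
    under eq_bigr do rewrite mulrACA.
    by rewrite -mulr_sumr -coefM mulrC; apply: (maxidM V).
  rewrite (bigD1 (inord i)) //= inordK ?ltnS ?leq_addr // addKn.
  set S := (X in _ + X) => mS'.
  suff mS : maxid R S.
    have := maxidB V mS' mS; rewrite addrK.
    exact: (maxid_mul_unit V (Rc i) (Rd j) ni nj).
  apply: (maxid_sum V) => k /eqP ki.
  have [lt|] := ltnP k i; first by rewrite mulrC; apply: (maxidM V) => //; apply: hi.
  rewrite leq_eqVlt => /predU1P[e|lt].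
    by case: ki; apply: val_inj; rewrite /= inordK ?ltnS ?leq_addr.
  apply: (maxidM V) => //; apply: hj; move: lt (ltn_ord k); lia.
have Rc' : R c^-1.
  have [cd0 Rcd] := maxidPn nunit.
  have -> : c^-1 = d * (c * d)^-1 by field; rewrite d0.
  exact: (srM V).
move=> k; have -> : p`_k = c^-1 * (c * p`_k) by rewrite mulKf.
exact: (srM V).
Qed.

End Gauss.

(** In matrices over polynomials, [Q(X) - Q(A)] is divisible by [X - A], by the factorisation of the
    differences of powers; take determinants. *)
Lemma char_poly_dvd (F : fieldType) n (A : 'M[F]_n.+1) (Q : {poly F}) :
  horner_mx A Q = 0 -> char_poly A %| Q ^+ n.+1.
Proof.
move=> QA; pose M : 'M[{poly F}]_n.+1 := map_mx polyC A.
pose f (p : {poly F}) : 'M[{poly F}]_n.+1 := p%:M.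
have cXM : GRing.comm (f 'X) M by rewrite /GRing.comm /f /= -!mulmxE scalar_mxC.
have fD : {morph f : x y / x + y} by move=> x y; rewrite /f raddfD.
have f0 : f 0 = 0 by rewrite /f raddf0.
have QX : f Q = \sum_(i < size Q) (f (Q`_i)%:P) * f 'X ^+ i.
  rewrite -{1}[Q]coefK poly_def (big_morph f fD f0); apply: eq_bigr => i _.
  by rewrite /f -mul_polyC scalar_mxM -mulmxE rmorphXn.
have QM : 0 = \sum_(i < size Q) (f (Q`_i)%:P) * M ^+ i.
  have : map_mx polyC (horner_mx A Q) = 0 by rewrite QA map_mx0.
  rewrite -{1}[Q]coefK poly_def !raddf_sum => e; rewrite -[LHS]e; apply: eq_bigr => i _.
  rewrite /= linearZ /= rmorphXn /= horner_mx_X map_mxZ /= -mul_scalar_mx mulmxE.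
  by congr (_ * _); rewrite rmorphXn.
have [S QS] : exists S, f Q = char_poly_mx A *m S.
  exists (\sum_(i < size Q) (f (Q`_i)%:P) * \sum_(j < i) f 'X ^+ (i.-1 - j) * M ^+ j).
  rewrite -[LHS]subr0 [X in _ - X]QM QX -sumrB mulmx_sumr; apply: eq_bigr => i _.
  rewrite -mulrBr mulmxE mulrA -[LHS]/(f _ * _).
  have -> : char_poly_mx A * f (Q`_i)%:P = f (Q`_i)%:P * char_poly_mx A.
    by rewrite -!mulmxE scalar_mxC.
  by rewrite -mulrA (subrXX_comm _ cXM).
have : \det (f Q) = Q ^+ n.+1 by rewrite det_scalar.
by rewrite QS det_mulmx => <-; apply: dvdp_mulIl.
Qed.

(** The characteristic polynomial is a monic divisor of a power of [Q], so Gauss's lemma applies and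
    no splitting field is involved. *)
Lemma char_poly_integral (F : fieldType) (R : set F) (V : valring R) n
    (A : 'M[F]_n.+1) (Q : {poly F}) :
  Q \is monic -> (forall i, R Q`_i) -> horner_mx A Q = 0 ->
  forall i, R (char_poly A)`_i.
Proof.
move=> Qm RQ QA; have := char_poly_dvd QA; rewrite dvdp_eq => /eqP e.
have cm := char_poly_monic A.
have qm : Q ^+ n.+1 %/ char_poly A \is monic.
  have : Q ^+ n.+1 \is monic by rewrite monic_exp.
  by rewrite {1}e monicMr.
apply: (gauss_monic V cm qm) => i; rewrite mulrC -e.
move: i; elim: (n.+1) => [|k IH] i; last by rewrite exprS; apply: (sr_coefM V).
by rewrite expr0 coefC; case: ifP => _; [apply: (sr1 V) | apply: (sr0 V)].
Qed.

Lemma trace_integral (F : fieldType) (R : set F) (V : valring R) n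
    (A : 'M[F]_n.+1) (Q : {poly F}) :
  Q \is monic -> (forall i, R Q`_i) -> horner_mx A Q = 0 -> R (\tr A).
Proof.
move=> Qm RQ QA; rewrite -[\tr A]opprK -char_poly_trace //.
by apply: (srN V); apply: char_poly_integral QA _.
Qed.

Definition ev (F L : fieldType) (f : {rmorphism F -> L}) (h : L) (p : {poly F}) : L :=
  (map_poly f p).[h].

Section Evaluation.
Variables (F L : fieldType) (f : {rmorphism F -> L}) (h : L).
Implicit Types p q : {poly F}.

Lemma ev0 : ev f h 0 = 0. Proof. by rewrite /ev rmorph0 horner0. Qed.
Lemma ev1 : ev f h 1 = 1. Proof. by rewrite /ev rmorph1 hornerC. Qed.
Lemma evC c : ev f h c%:P = f c. Proof. by rewrite /ev map_polyC hornerC. Qed.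
Lemma evX : ev f h 'X = h. Proof. by rewrite /ev map_polyX hornerX. Qed.
Lemma evXn n : ev f h 'X^n = h ^+ n. Proof. by rewrite /ev map_polyXn hornerXn. Qed.
Lemma evD p q : ev f h (p + q) = ev f h p + ev f h q.
Proof. by rewrite /ev rmorphD hornerD. Qed.
Lemma evN p : ev f h (- p) = - ev f h p.
Proof. by rewrite /ev rmorphN hornerN. Qed.
Lemma evM p q : ev f h (p * q) = ev f h p * ev f h q.
Proof. by rewrite /ev rmorphM hornerM. Qed.
Lemma evZ c p : ev f h (c *: p) = f c * ev f h p.
Proof. by rewrite -mul_polyC evM evC. Qed.
Lemma evX_ p n : ev f h (p ^+ n) = ev f h p ^+ n.
Proof. by rewrite /ev rmorphXn horner_exp. Qed.
Lemma ev_comp p q : ev f h (p \Po q) = ev f (ev f h q) p.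
Proof. by rewrite /ev map_comp_poly horner_comp. Qed.
Lemma ev_sum p n : (size p <= n)%N -> ev f h p = \sum_(i < n) f p`_i * h ^+ i.
Proof.
move=> le; rewrite /ev (@horner_coef_wide _ n) ?size_map_poly //.
by apply: eq_bigr => i _; rewrite coef_map.
Qed.

(* C is the matrix of the multiplication by h on F(h). *)
Lemma algebraic_mx : algebraicOver f h ->
  exists d (C : 'M[F]_d.+1), [/\
    forall p, horner_mx C p = 0 <-> ev f h p = 0,
    forall p, ev f h p != 0 -> exists q, ev f h (p * q) = 1
  & forall p, (size p <= d.+1)%N -> ev f h p = 0 -> p = 0].
Proof.
case=> p0 p00 rp0.
pose P n := `[< exists p : {poly F}, [/\ p != 0, ev f h p = 0 & size p = n] >].
have exP : exists n, P n.
  by exists (size p0); apply/asboolP; exists p0; split => //; apply/rootP.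
have [n /asboolP[G0 [G00 hG0 sG0]] minn] := ex_minnP exP.
pose G := (lead_coef G0)^-1 *: G0.
have Gm : G \is monic.
  by rewrite monicE lead_coefZ mulVf ?lead_coef_eq0.
have hG : ev f h G = 0 by rewrite evZ hG0 mulr0.
have sG : size G = n by rewrite size_scale // invr_eq0 lead_coef_eq0.
have minG p : p != 0 -> ev f h p = 0 -> (size G <= size p)%N.
  by move=> pn0 hp; rewrite sG; apply: minn; apply/asboolP; exists p.
have G0n := monic_neq0 Gm.
have bez p : ev f h p != 0 -> exists u v, u * p + v * G = 1.
  move=> hp; have cop : coprimep p G.
    have := dvdp_gcdr p G; rewrite dvdp_eq => /eqP e.
    have /eqP : ev f h (G %/ gcdp p G) * ev f h (gcdp p G) = 0 by rewrite -evM -e.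
    rewrite mulf_eq0 => /orP[/eqP q0|/eqP g0].
      have qn0 : G %/ gcdp p G != 0.
        by apply/eqP => q00; move: e; rewrite q00 mul0r => /eqP; rewrite (negPf G0n).
      have gn0 : gcdp p G != 0 by rewrite gcdp_eq0 negb_and G0n orbT.
      have := minG _ qn0 q0; rewrite [in X in (X <= _)%N]e size_mul //.
      rewrite /coprimep; have := gn0; rewrite -size_poly_gt0; have := qn0; rewrite -size_poly_gt0.
      move: (size (gcdp p G)) (size (G %/ gcdp p G)) => a b.
      by rewrite eqn_leq => b0 a0 le; apply/andP; split; lia.
    case/eqP: hp; have := dvdp_gcdl p G; rewrite dvdp_eq => /eqP ->.
    by rewrite evM g0 mulr0.
  have [[u v] /= /eqpP[[c1 c2] /= /andP[c10 c20] e]] := Bezoutp p G.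
  have /size_poly1P[c cn0 gc] : size (gcdp p G) == 1%N by [].
  move: e; rewrite gc => e.
  exists ((c2 * c)^-1 *: (c1 *: u)), ((c2 * c)^-1 *: (c1 *: v)).
  rewrite -!scalerAl -!scalerDr e -mul_polyC -mul_polyC -!polyCM.
  by rewrite mulVf // mulf_neq0.
have sG2 : (1 < size G)%N.
  rewrite ltnNge; apply/negP => /size1_polyC e.
  move: hG; rewrite e evC => /eqP; rewrite fmorph_eq0 => /eqP c0.
  by move: G0n; rewrite e c0 eqxx.
have [d [C charC]] : exists d (C : 'M[F]_d.+1), char_poly C = G.
  have := companionmxK Gm; case: (size G).-1 (companionmx G) => [C|d C e]; last by exists d, C.
  by rewrite /char_poly det_mx00 => e; move: sG2; rewrite -e size_poly1.
have sGd : size G = d.+2 by rewrite -charC size_char_poly.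
have GC : horner_mx C G = 0 by rewrite -charC; exact: Cayley_Hamilton.
exists d, C; split.
- move=> p; split=> [pC|hp].
    apply/eqP; apply: contraT => /bez[u [v e]].
    have := congr1 (horner_mx C) e; rewrite rmorphD !rmorphM /= pC GC !mulr0 addr0 rmorph1.
    by move/eqP; rewrite eq_sym oner_eq0.
  have : G %| p.
    have := divp_eq p G; move=> /(congr1 (ev f h)); rewrite hp evD evM hG mulr0 add0r => e.
    rewrite /dvdp; apply: contraT => r0.
    by have := minG _ r0 (esym e); rewrite leqNgt ltn_modp G0n.
  by rewrite dvdp_eq => /eqP ->; rewrite rmorphM /= GC mulr0.
- move=> p /bez[u [v e]]; exists u.
  by have := congr1 (ev f h) e; rewrite evD ev1 !evM hG mulr0 addr0 mulrC.
- move=> p sp hp; apply/eqP; apply: contraT => pn0.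
  by have := minG _ pn0 hp; rewrite sGd ltnNge sp.
Qed.

End Evaluation.

Lemma poly_lift (A B : nzRingType) (f : {rmorphism A -> B}) (D : set A)
    (p : {poly B}) : D 0 -> (forall i, exists2 c, D c & f c = p`_i) ->
  exists2 q : {poly A}, (forall i, D q`_i) & map_poly f q = p.
Proof.
move=> D0 h.
have [c Dc] := choice (fun i => let: ex_intro2 c Dc fc := h i in
  ex_intro (fun c => D c /\ f c = p`_i) c (conj Dc fc)).
exists (\poly_(i < size p) c i).
  by move=> i; rewrite coef_poly; case: ifP => // _; have [] := Dc i.
apply/polyP => i; rewrite coef_map /= coef_poly; have [_ fc] := Dc i.
by case: ltnP => // le; rewrite rmorph0 nth_default.
Qed.

Lemma valring_preim (F L : fieldType) (f : {rmorphism F -> L}) (R : set L) :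
  valring R -> valring (fun x => R (f x)).
Proof.
move=> V; split; first split.
- by rewrite rmorph1; apply: (sr1 V).
- by move=> x y; rewrite rmorphB; apply: (srB V).
- by move=> x y; rewrite rmorphM; apply: (srM V).
by move=> x; rewrite fmorphV; apply: (vr_total V).
Qed.

Lemma maxid_preim (F L : fieldType) (f : {rmorphism F -> L}) (R : set L) x :
  maxid (fun x => R (f x)) x <-> maxid R (f x).
Proof.
rewrite /maxid fmorphV; split=> [[->|]|[/eqP|]]; [by left; rewrite rmorph0|by right| |by right].
by rewrite fmorph_eq0 => /eqP ->; left.
Qed.

Lemma horner_mx_comp (F : fieldType) n (A : 'M[F]_n.+1) (p q : {poly F}) :
  horner_mx A (p \Po q) = horner_mx (horner_mx A q) p.
Proof.
elim/poly_ind: p => [|p c IH]; first by rewrite comp_poly0 !rmorph0.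
rewrite comp_polyD comp_polyM comp_polyX comp_polyC !rmorphD !rmorphM /= IH.
by rewrite horner_mx_X !horner_mx_C.
Qed.

Lemma horner_mx_sum (F : fieldType) n (A : 'M[F]_n.+1) (p : {poly F}) k :
  (size p <= k)%N -> horner_mx A p = \sum_(i < k) p`_i *: A ^+ i.
Proof.
move=> le; rewrite -{1}[p](poly_rV_K le) horner_rVpoly mulmx_sum_row linear_sum.
by apply: eq_bigr => i _; rewrite !mxE linearZ /= rowK mxvecK.
Qed.

(** * Bounded denominators of a derivation on a finite extension *)

Section Bounded.
Variables (F L : fieldType) (f : {rmorphism F -> L}) (R : set L) (V : valring R).
Hypothesis char0 : forall n, n.+1%:R != 0 :> F.
Let O : set F := fun x => R (f x).
Let VO : valring O := valring_preim f V.

(** The integral closure of [O] in [L], as an intersection of valuation rings: in this form it is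
    visibly a ring. Integral equations are supplied by the next lemma. *)
Definition dominated_integral (w : L) : Prop :=
  forall R' : set L, valring R' -> (forall x, R (f x) -> R' (f x)) -> R' w.
Local Notation Lam := dominated_integral.

(** If [w] were not a polynomial in [w^-1] over [O], some valuation ring containing [O] and [w^-1]
    would avoid [w]. Multiplying [w = p(w^-1)] by a power of [w] gives the equation. *)
Lemma dominated_integral_poly w : Lam w ->
  exists Q : {poly F}, [/\ Q \is monic, forall i, O Q`_i & ev f w Q = 0].
Proof.
move=> lw; pose A : set L := fun y => exists2 c, O c & f c = y.
have sA : subring A.
  split.
  - by exists 1; rewrite ?rmorph1 //; apply: (sr1 VO).
  - move=> _ _ [c Oc <-] [d Od <-]; exists (c - d); rewrite ?rmorphB //.
    exact: (srB VO).
  - move=> _ _ [c Oc <-] [d Od <-]; exists (c * d); rewrite ?rmorphM //.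
    exact: (srM VO).
have [w0|w0] := eqVneq w 0.
  exists 'X; rewrite monicX evX; split=> // i; rewrite coefX.
  by case: eqP => _; [apply: (sr1 VO) | apply: (sr0 VO)].
have [p Ap wp] : sr_adjoin A w^-1 w.
  apply: contrapT => nw.
  have [R' [V' AR' nR']] := chevalley (sr_adjoin_subring sA _) (sr_adjoin_gen sA _) nw.
  apply: nR'; apply: lw => // x Rx; apply: AR'; apply: sub_sr_adjoin => //.
  by exists x.
have [q Oq qp] := poly_lift (sr0 VO) Ap.
pose n := (size p).-1; pose r := \poly_(i < n.+1) q`_(n - i).
exists ('X^(n.+1) - r); split.
- rewrite monicE lead_coefDl ?lead_coefXn //.
  by rewrite size_polyN size_polyXn ltnS size_poly.
- move=> i; rewrite coefB coefXn coef_poly; apply: (srB VO).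
    by case: eqP => _; [apply: (sr1 VO) | apply: (sr0 VO)].
  by case: ifP => // _; apply: (sr0 VO).
have lep : (size p <= n.+1)%N by rewrite /n; case: (size p).
rewrite evD evN evXn; apply/eqP; rewrite subr_eq0; apply/eqP.
rewrite (ev_sum _ _ (size_poly _ _)) exprSr {2}wp -qp.
rewrite -/(ev f w^-1 q) (@ev_sum _ _ _ _ _ n.+1); last first.
  by apply: leq_trans lep; rewrite -qp size_map_poly.
rewrite mulr_sumr (reindex_inj rev_ord_inj) /=; apply: eq_bigr => i _.
rewrite coef_poly ltn_ord subSS mulrCA; congr (_ * _).
have le_in : (i <= n)%N by rewrite -ltnS.
by rewrite exprVn -{1}(subnK le_in) exprD; field; rewrite expf_neq0.
Qed.

(** In a primitive relation [r] for [w], let [j] be the last index of a unit coefficient and write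
    [r = p0 + q * 'X^j]. Then [q(w)] is a unit of [R], since only its constant coefficient is
    outside the maximal ideal. Both [q(w)] and [w * q(w)] are integral: in a valuation ring
    containing [w] this is plain, and otherwise the relation writes the latter as a polynomial in
    [w^-1]. *)
Lemma dominated_localization w : algebraicOver f w -> R w ->
  exists p q : {poly F}, [/\ Lam (ev f w p), Lam (ev f w q),
    ev f w q != 0, R (ev f w q)^-1 & w = ev f w p / ev f w q].
Proof.
move=> [r0 r00 /rootP hr0] Rw.
have [w0|w0] := eqVneq w 0.
  exists 0, 1; rewrite ev0 ev1 mul0r invr1 oner_neq0; split => //.
  - by move=> R' V' _; apply: (sr0 V').
  - by move=> R' V' _; apply: (sr1 V').
  - exact: (sr1 V).
have [c [k [c0 Oc ck _]]] := primitive_scaling VO r00.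
pose r := c *: r0.
have hr : ev f w r = 0 by rewrite evZ [ev _ _ _]hr0 mulr0.
have Or i : O r`_i by rewrite coefZ.
have exj : exists j, `[< ~ maxid O r`_j >] by exists k; apply/asboolP; rewrite coefZ.
have ubj j : `[< ~ maxid O r`_j >] -> (j <= size r)%N.
  move=> /asboolP nm; rewrite leqNgt; apply/negP => lt; apply: nm.
  by rewrite nth_default ?(ltnW lt) //; left.
case: (ex_maxnP exj ubj) => j /asboolP nj jmax {exj ubj}.
have mj i : (j < i)%N -> maxid O r`_i.
  move=> lt; apply: contrapT => nm; have /asboolP/jmax : ~ maxid O r`_i by [].
  by rewrite leqNgt lt.
pose q := drop_poly j r; pose p0 := take_poly j r.
have rE : r = p0 + q * 'X^j by rewrite poly_take_drop.
have Oq i : O q`_i by rewrite coef_drop_poly.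
have Op i : O p0`_i.
  by rewrite coef_take_poly; case: ifP => // _; apply: (sr0 VO).
have ab : ev f w (q * 'X) = - \sum_(i < j) f p0`_i * w^-1 ^+ (j.-1 - i).
  have := hr; rewrite rE evD evM evXn => /(canRL (addKr _)); rewrite addr0.
  rewrite (@ev_sum _ _ _ _ p0 j) ?size_take_poly // => e.
  rewrite evM evX; apply: (mulIf (expf_neq0 j w0)).
  rewrite mulrAC e !mulNr; congr (- _); rewrite !mulr_suml; apply: eq_bigr => i _.
  rewrite -!mulrA; congr (_ * _); rewrite exprVn.
  have -> : w ^+ j = w ^+ (j.-1 - i) * w * w ^+ i.
    rewrite -exprSr -exprD; congr (_ ^+ _); move: (ltn_ord i); lia.
  by field; rewrite expf_neq0.
have Lq : Lam (ev f w q) /\ Lam (ev f w (q * 'X)).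
  have main (R' : set L) : valring R' -> (forall x, R (f x) -> R' (f x)) ->
      R' (ev f w q) /\ R' (ev f w (q * 'X)).
    move=> V' RR'; case: (vr_total V' w) => R'w.
      have R'q : R' (ev f w q).
        by apply: (sr_horner V') => // i; rewrite coef_map; apply: RR'; apply: Oq.
      by split=> //; rewrite evM evX; apply: (srM V').
    have R'a : R' (ev f w (q * 'X)).
      rewrite ab; apply: (srN V'); apply: (sr_sum V') => i _; apply: (srM V').
        by apply: RR'; apply: Op.
      exact: (srX V').
    split=> //; have -> : ev f w q = ev f w (q * 'X) * w^-1 by rewrite evM evX mulfK.
    exact: (srM V').
  by split=> R' V' RR'; have [] := main _ V' RR'.
have [nq0 Rq] : ev f w q != 0 /\ R (ev f w q)^-1.
  apply: maxidPn => mq.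
  have : maxid R (f q`_0); last first.
    by move=> /(maxid_preim f R (q`_0)).2; rewrite coef_drop_poly add0n; apply: nj.
  have [s1 sq] : exists s1, (size q <= s1.+1)%N by exists (size q).
  have := mq; rewrite (ev_sum _ _ sq) big_ord_recl /= expr0 mulr1.
  set T := \sum_(i < _) _ => mqT.
  suff mT : maxid R T by have := maxidB V mqT mT; rewrite addrK.
  apply: (maxid_sum V) => i _; rewrite mulrC; apply: (maxidM V); first exact: (srX V).
  by apply: (maxid_preim f R _).1; rewrite coef_drop_poly; apply: mj; rewrite /bump /=; lia.
by exists (q * 'X), q; split; [exact: Lq.2|exact: Lq.1| | |rewrite evM evX mulrC mulKf].
Qed.

Lemma dominated_subring : subring Lam.
Proof.
split; first by move=> R' V' _; apply: (sr1 V').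
  by move=> x y lx ly R' V' h; apply: (srB V'); [apply: lx | apply: ly].
by move=> x y lx ly R' V' h; apply: (srM V'); [apply: lx | apply: ly].
Qed.

Section Lattice.
Variables (h : L) (d : nat) (C : 'M[F]_d.+1).
Hypothesis kerC : forall p, horner_mx C p = 0 <-> ev f h p = 0.
Hypothesis invC : forall p, ev f h p != 0 -> exists q, ev f h (p * q) = 1.
Hypothesis freeC : forall p : {poly F}, (size p <= d.+1)%N -> ev f h p = 0 -> p = 0.
Hypothesis Lh : Lam h.

Lemma trace_dominated p : Lam (ev f h p) -> O (\tr (horner_mx C p)).
Proof.
move=> /dominated_integral_poly[Q [Qm OQ hQ]].
apply: (trace_integral VO Qm OQ); rewrite -horner_mx_comp.
by apply/kerC; rewrite ev_comp.
Qed.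

Lemma char_poly_ev : ev f h (char_poly C) = 0.
Proof. by apply/kerC; apply: Cayley_Hamilton. Qed.

Lemma ev_char_poly p : ev f (ev f h p) (char_poly (horner_mx C p)) = 0.
Proof.
by rewrite -ev_comp; apply/kerC; rewrite horner_mx_comp; apply: Cayley_Hamilton.
Qed.

Lemma ev_small p : exists2 q : {poly F}, (size q <= d.+1)%N & ev f h q = ev f h p.
Proof.
exists (p %% char_poly C).
  by rewrite -ltnS -(size_char_poly C) ltn_modp monic_neq0 ?char_poly_monic.
by rewrite [in RHS](divp_eq p (char_poly C)) evD evM char_poly_ev mulr0 add0r.
Qed.

(* The Gram matrix of the trace form in the basis 1, h, ..., h^d; its
   determinant is a common denominator for the coordinates of all integral
   elements. *)
Let T := \matrix_(i < d.+1, j < d.+1) \tr (C ^+ (i + j)).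

Fact gram_dominated i j : O (T i j).
Proof.
rewrite mxE -{1}(horner_mx_X C) -rmorphXn; apply: trace_dominated.
by rewrite evXn; apply: (srX dominated_subring).
Qed.

Fact gram_mul (p : {poly F}) j : (size p <= d.+1)%N ->
  (poly_rV p *m T) 0 j = \tr (horner_mx C (p * 'X^j)).
Proof.
move=> sp; rewrite mxE rmorphM /= rmorphXn /= horner_mx_X (horner_mx_sum _ sp).
rewrite mulr_suml raddf_sum; apply: eq_bigr => i _.
by rewrite !mxE /= -scalerAl linearZ /= exprD.
Qed.

(** Nondegeneracy of the trace form: a nonzero [p(h)] has an inverse [q(h)], and the trace of their
    product is the degree, nonzero in characteristic zero. *)
Fact gram_unit : \det T != 0.
Proof.
apply/eqP => /eqP/det0P[v v0 vT]; pose p := rVpoly v.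
have sp : (size p <= d.+1)%N by apply: size_poly.
have p0 : ev f h p != 0.
  apply: contra_neq v0 => /(freeC sp) pz.
  by rewrite -[v]rVpolyK -/p pz linear0.
have [q0] := invC p0; have [q sq qe] := ev_small q0; rewrite evM -qe -evM => pq.
have : horner_mx C (p * q) = 1.
  apply/eqP; rewrite -subr_eq0 -(rmorph1 (horner_mx C)) -rmorphB; apply/eqP.
  by apply/kerC; rewrite evD evN ev1 pq subrr.
move=> /(congr1 (fun M => \tr M)); rewrite mxtrace1 -{1}(coefK q) poly_def.
rewrite mulr_sumr raddf_sum raddf_sum /= big1 => [|i _].
  by move/esym/eqP; rewrite (negPf (char0 d)).
rewrite -scalerAr linearZ linearZ /=.
have := gram_mul (Ordinal (leq_trans (ltn_ord i) sq)) sp.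
by rewrite rVpolyK vT mxE /= => <-; rewrite mulr0.
Qed.

(** Cramer's rule for the Gram matrix: the products of an integral element with the powers of [h]
    have traces in [O]. *)
Lemma dominated_lattice p : Lam (ev f h p) ->
  exists2 b : {poly F}, (forall i, O b`_i) & f (\det T) * ev f h p = ev f h b.
Proof.
have [q sq <-] := ev_small p => Lq; exists (\det T *: q); last by rewrite evZ.
move=> i; rewrite coefZ; have [lti|lei] := ltnP i d.+1; last first.
  by rewrite nth_default ?(leq_trans sq) // mulr0; apply: (sr0 VO).
have -> : q`_i = poly_rV q 0 (Ordinal lti) by rewrite mxE.
have -> : \det T * poly_rV q 0 (Ordinal lti) =
    (poly_rV q *m T *m \adj T) 0 (Ordinal lti).
  by rewrite -mulmxA mul_mx_adj mul_mx_scalar !mxE.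
rewrite mxE; apply: (sr_sum VO) => j _; apply: (srM VO).
  rewrite gram_mul //; apply: trace_dominated; rewrite evM evXn.
  by apply: (srM dominated_subring) => //; apply: (srX dominated_subring).
rewrite mxE; apply: (srM VO); first exact/(srX VO)/(srN VO)/(sr1 VO).
rewrite /determinant; apply: (sr_sum VO) => s _; apply: (srM VO).
  exact/(srX VO)/(srN VO)/(sr1 VO).
by apply: (sr_prod VO) => k _; rewrite mxE mxE; apply: gram_dominated.
Qed.

Fact det_dominated : O (\det T).
Proof.
rewrite /determinant; apply: (sr_sum VO) => s _; apply: (srM VO).
  exact/(srX VO)/(srN VO)/(sr1 VO).
by apply: (sr_prod VO) => k _; apply: gram_dominated.
Qed.

Variable th : L -> L.
Hypothesis thD : forall x y, th (x + y) = th x + th y.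
Hypothesis thM : forall x y, th (x * y) = th x * y + x * th y.
Hypothesis thO : forall x, R (f x) -> R (th (f x)).

(** On [O[h]] the derivation is bounded, because differentiating the equation of [h] puts
    [G'(h) * th h] in [R]. Multiplication by [\det T] carries integral elements into [O[h]], and an
    element of [R] in [F(h)] is a quotient of integral ones whose denominator is a unit of [R]. *)
Lemma derivation_bounded : exists2 D : F, D != 0 &
  forall p, R (ev f h p) -> R (f D * th (ev f h p)).
Proof.
have Rh : R h by apply: Lh.
have th_ev (b : {poly F}) : (forall i, O b`_i) -> exists2 x, R x & exists2 y, R y &
    th (ev f h b) = x + y * th h.
  move=> Ob; rewrite /ev (derivation_horner thD thM).
  exists (map_poly th (map_poly f b)).[h].
    apply: (sr_horner V) => // i; rewrite coef_map_id0 ?derivation0 // coef_map.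
    exact/thO/Ob.
  exists (map_poly f b)^`().[h] => //.
  apply: (sr_horner V) => // i; rewrite coef_deriv coef_map -mulr_natr.
  by apply: (srM V); [apply: Ob | apply: (sr_nat V)].
have [Q [Qm OQ hQ]] := dominated_integral_poly Lh.
have Ochar := char_poly_integral VO Qm OQ ((kerC Q).2 hQ).
set G := char_poly C in Ochar.
have sG : size G = d.+2 by rewrite size_char_poly.
have G'0 : ev f h G^`() != 0.
  apply/eqP => /freeC; rewrite -ltnS -sG lt_size_deriv ?monic_neq0 ?char_poly_monic //.
  move=> /(_ isT) /(congr1 (fun p : {poly F} => p`_d)); rewrite coef_deriv coef0.
  have -> : G`_d.+1 = 1 by have /monicP := char_poly_monic C; rewrite /lead_coef sG.
  by move/eqP; rewrite (negPf (char0 d)).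
have thhE : exists2 x, R x & ev f h G^`() * th h = x.
  exists (- (map_poly th (map_poly f G)).[h]).
    apply/(srN V)/(sr_horner V) => // i; rewrite coef_map_id0 ?derivation0 // coef_map.
    exact/thO/Ochar.
  have := derivation_horner thD thM (map_poly f G) h.
  rewrite -/(ev f h G) char_poly_ev derivation0 // => /esym/eqP.
  by rewrite addrC addr_eq0 deriv_map => /eqP.
have [q] := invC G'0; rewrite evM => Gq.
have [D1 [D10 OD1 OD1q]] := common_denominator VO (fun i : 'I_(size q) => q`_i).
have RD1 : R (f D1 * th h).
  case: thhE => x Rx xe.
  have -> : f D1 * th h = ev f h (D1 *: q) * x by rewrite evZ -xe; ring: Gq.
  apply: (srM V) => //; apply: (sr_horner V) => // i; rewrite coef_map /= coefZ.
  have [lti|lei] := ltnP i (size q); first exact: (OD1q (Ordinal lti)).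
  by rewrite [q`_i]nth_default // mulr0 raddf0; apply: (sr0 V).
pose D2 := D1 * \det T.
have D20 : D2 != 0 by rewrite mulf_neq0 // gram_unit.
have main (p : {poly F}) : Lam (ev f h p) -> R (f D2 * th (ev f h p)).
  move=> Lp; have [b Ob be] := dominated_lattice Lp.
  have [x Rx [y Ry e]] := th_ev b Ob.
  move: e; rewrite -be thM => e.
  have -> : f D2 * th (ev f h p) = f D1 * x + y * (f D1 * th h)
      - f D1 * th (f (\det T)) * ev f h p.
    rewrite rmorphM -mulrA.
    have -> : f (\det T) * th (ev f h p) = x + y * th h - th (f (\det T)) * ev f h p.
      by rewrite -e addrC addKr.
    by ring.
  apply: (srB V); first by apply: (srD V); apply: (srM V).
  apply: (srM V); last exact: Lp.
  by apply: (srM V) => //; apply/thO/det_dominated.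
exists D2 => // p Rp.
have alg : algebraicOver f (ev f h p).
  exists (char_poly (horner_mx C p)); first exact/monic_neq0/char_poly_monic.
  exact/rootP/ev_char_poly.
have [a [b [La Lb b0 Rb e]]] := dominated_localization alg Rp.
rewrite -!ev_comp in La Lb b0 Rb e.
rewrite e (derivation_div thD thM) //.
have [Ra RA] := (La _ V (fun x Rx => Rx), main _ La).
have [Rb' RB] := (Lb _ V (fun x Rx => Rx), main _ Lb).
set u := ev f h (a \Po p) in Ra RA *; set v := ev f h (b \Po p) in b0 Rb Rb' RB *.
have -> : f D2 * ((th u * v - u * th v) / v ^+ 2) =
    f D2 * th u * v^-1 - u * v^-1 ^+ 2 * (f D2 * th v) by field.
apply: (srB V); first exact: (srM V).
by apply: (srM V) => //; apply: (srM V) => //; apply: (srX V).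
Qed.

End Lattice.
End Bounded.

(** * Logarithmic derivations *)

Section LogDerivation.
Variables (S F L : fieldType) (sg : {rmorphism S -> F}) (f : {rmorphism F -> L}).
Variables (R : set L) (V : valring R) (tau : F).
Local Notation t := (f tau).
Hypothesis char0 : forall n, n.+1%:R != 0 :> S.
Hypothesis tau0 : tau != 0.
Hypothesis mt : maxid R t.
Hypothesis RS : forall s, R (f (sg s)).
Hypothesis Fval : forall x : F, x != 0 -> exists (k : int) (e : F) (s : S),
  [/\ x = tau ^ k * e, s != 0 & maxid R (f e - f (sg s))].
Variables (th : L -> L) (c : L).
Hypothesis thD : forall x y, th (x + y) = th x + th y.
Hypothesis thM : forall x y, th (x * y) = th x * y + x * th y.
Hypothesis thO : forall x, R (f x) -> R (th (f x)).
Hypothesis tht : th t = c * t.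
Hypothesis Rc : R c.

Let O : set F := fun x => R (f x).
Let VO : valring O := valring_preim f V.

Let Rt : R t := maxid_in V mt.

Let t0 : t != 0. Proof. by rewrite fmorph_eq0. Qed.

Fact nRtV : ~ R t^-1.
Proof. by case: mt => [/eqP|//]; rewrite (negPf t0). Qed.

Fact unit_of_residue e s : s != 0 -> maxid R (f e - f (sg s)) -> R (f e) /\ R (f e)^-1.
Proof.
move=> s0 me; have Re : R (f e).
  by rewrite -[f e](subrK (f (sg s))); apply: (srD V) => //; apply: (maxid_in V).
split=> //; apply: contrapT => nR.
have mfe : maxid R (f e) by right.
have : maxid R (f (sg s)).
  by rewrite -[f (sg s)](subKr (f e)); apply: (maxidB V).
case=> [/eqP|]; first by rewrite !fmorph_eq0 (negPf s0).
by apply; rewrite -!fmorphV; apply: RS.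
Qed.

Fact residue_exists x : O x -> exists s, maxid R (f x - f (sg s)).
Proof.
move=> Ox; have [->|x0] := eqVneq x 0.
  by exists 0; rewrite !rmorph0 subrr; left.
have [k [e [s [xe s0 me]]]] := Fval x0.
have [Re ReV] := unit_of_residue s0 me.
case: k xe => [[|k]|k] xe.
- by exists s; move: me; rewrite xe expr0z mul1r.
- exists 0; rewrite rmorph0 rmorph0 subr0.
  have -> : f x = t ^+ k * f e * t by rewrite xe rmorphM -exprnP rmorphXn exprSr mulrAC.
  by apply: (maxidM V) => //; apply: (srM V) => //; apply: (srX V).
- case: nRtV; have -> : t^-1 = f x * t ^+ k * (f e)^-1.
    have fe0 : f e != 0.
      by apply/eqP => fe0; move: x0; rewrite xe -(fmorph_eq0 f) rmorphM fe0 mulr0 eqxx.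
    rewrite xe rmorphM fmorphXz -[t ^ _]/(t ^- k.+1) exprS.
    by field; rewrite fe0 t0 expf_neq0.
  by apply: (srM V) => //; apply: (srM V) => //; apply: (srX V).
Qed.

(** The value of [w] is a rational multiple of that of [t], because at least two terms of an
    algebraic relation share the largest absolute value. Since [e] is bounded by the degree, one
    factorial will serve all elements of a finite extension. *)
Lemma fraction_value (w : L) (p : {poly F}) : p != 0 -> ev f w p = 0 -> w != 0 ->
  exists e (k : int) u,
    [/\ (0 < e < size p)%N, w ^+ e = t ^ k * u, R u & R u^-1].
Proof.
move=> p0 hp w0; pose v (i : 'I_(size p)) := f p`_i * w ^+ i.
have sp : (0 < size p)%N by rewrite size_poly_gt0.
have [|i [vi hi]] := vr_max V (v := v).
  have lt : ((size p).-1 < size p)%N by rewrite prednK.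
  exists (Ordinal lt); rewrite /v /= mulf_neq0 ?expf_neq0 //.
  by rewrite fmorph_eq0 -/(lead_coef p) lead_coef_eq0.
have [j ji nj] : exists2 j, j != i & ~ maxid R (v j / v i).
  apply: contrapT => nex; apply: (maxid1 V).
  have -> : 1 = - \sum_(j < size p | j != i) v j / v i.
    have := hp; rewrite (ev_sum f w (leqnn _)) -/v (bigD1 i) //= -/(v i) => /eqP.
    rewrite addr_eq0 => /eqP e.
    by rewrite -mulr_suml -[X in - (X / _)]opprK -e mulNr opprK divff.
  apply: (maxidN V); apply: (maxid_sum V) => j ji.
  by apply: contrapT => nm; apply: nex; exists j.
have [ij0 Rij'] := maxidPn nj; have Rij := hi j.
have vj : v j != 0 by apply: contraNneq ij0 => ->; rewrite mul0r.
have pj : p`_j != 0 by apply: contraNneq vj; rewrite /v => ->; rewrite rmorph0 mul0r.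
have pi : p`_i != 0 by apply: contraNneq vi; rewrite /v => ->; rewrite rmorph0 mul0r.
(* Two terms c_i w^i and c_j w^j of the relation have the same value. *)
have main (a b : 'I_(size p)) (x : F) u : x != 0 -> (a < b)%N -> R u -> R u^-1 ->
    w ^+ b = f x * u * w ^+ a -> exists e (k : int) u,
    [/\ (0 < e < size p)%N, w ^+ e = t ^ k * u, R u & R u^-1].
  move=> x0 ab Ru Ru' e.
  have [k [y [s [xe s0 me]]]] := Fval x0.
  have [Ry RyV] := unit_of_residue s0 me.
  exists (b - a)%N, k, (f y * u); split.
  - by rewrite subn_gt0 ab /= (leq_ltn_trans (leq_subr _ _)).
  - apply: (mulIf (expf_neq0 a w0)); rewrite -exprD subnK ?(ltnW ab) // e xe.
    by rewrite rmorphM fmorphXz !mulrA.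
  - exact: (srM V).
  - by rewrite invfM; apply: (srM V).
have [lt|lt|eq] := ltngtP i j; last by case/eqP: ji; apply: val_inj.
- apply: (main i j (p`_i / p`_j) (v j / v i)) => //.
    by rewrite mulf_neq0 ?invr_eq0.
  rewrite /v fmorph_div; field; rewrite !fmorph_eq0 pi pj.
  by rewrite !expf_neq0.
- apply: (main j i (p`_j / p`_i) (v j / v i)^-1) => //.
  + by rewrite mulf_neq0 ?invr_eq0.
  + by rewrite invrK.
  rewrite /v fmorph_div; field; rewrite !fmorph_eq0 pi pj.
  by rewrite !expf_neq0.
Qed.

Let sgL : {rmorphism S -> L} := f \o sg.

(** Reducing the coefficients of a primitive relation shows that the residue of [w] is algebraic
    over [S]. A polynomial of least size vanishing at the residue has a nonvanishing derivative
    there, by characteristic zero. *)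
Lemma residue_root w : algebraicOver f w -> R w ->
  exists g : {poly S}, maxid R (ev sgL w g) /\ ~ maxid R (ev sgL w g^`()).
Proof.
move=> [r0 r00 /rootP hr0] Rw.
have [a [j [a0 Oa nj _]]] := primitive_scaling VO r00.
have [s hs] := choice (fun i => residue_exists (Oa i)).
pose P n := `[< exists g : {poly S}, [/\ g != 0, maxid R (ev sgL w g) & size g = n] >].
have exP : exists n, P n.
  pose g := \poly_(i < size r0) s i.
  exists (size g); apply/asboolP; exists g; split=> //.
    apply/eqP => /(congr1 (fun p : {poly S} => p`_j)); rewrite coef_poly coef0.
    case: ltnP => [_ sj|le]; last first.
      by move=> _; apply: nj; rewrite [r0`_j]nth_default // mulr0; left.
    by apply: nj; apply: (maxid_preim f R _).2; have := hs j; rewrite sj !rmorph0 subr0.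
  rewrite (ev_sum _ _ (size_poly _ _)).
  have -> : \sum_(i < size r0) sgL g`_i * w ^+ i =
      - \sum_(i < size r0) w ^+ i * (f (a * r0`_i) - f (sg (s i))).
    apply/eqP; rewrite -addr_eq0 -big_split /=.
    have e : \sum_(i < size r0) f (a * r0`_i) * w ^+ i = 0.
      under eq_bigr do rewrite rmorphM -mulrA.
      by rewrite -mulr_sumr -(ev_sum f w (leqnn _)) [ev _ _ _]hr0 mulr0.
    by apply/eqP; rewrite -[RHS]e; apply: eq_bigr => i _; rewrite coef_poly ltn_ord /=; ring.
  apply: (maxidN V); apply: (maxid_sum V) => i _.
  by apply: (maxidM V) => //; apply: (srX V).
have [n /asboolP[g [g0 mg sgn]] nmin] := ex_minnP exP.
exists g; split=> // mg'.
have sg1 : (1 < size g)%N.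
  rewrite ltnNge; apply/negP => /size1_polyC ge.
  move: mg; rewrite ge evC; case=> [/eqP|].
    rewrite fmorph_eq0 => /eqP gc; move: g0; rewrite ge gc.
    by rewrite polyC0 eqxx.
  by apply; rewrite -fmorphV; apply: RS.
have g'0 : g^`() != 0.
  apply/eqP => /(congr1 (fun p : {poly S} => p`_(size g).-2)).
  rewrite coef_deriv coef0 -mulr_natr => /eqP; rewrite mulf_eq0 (negPf (char0 _)) orbF.
  have := lead_coef_eq0 g; rewrite /lead_coef (negPf g0).
  by case: (size g) sg1 => [|[|k]] //= _ ->.
have /asboolP/nmin : exists g1 : {poly S},
    [/\ g1 != 0, maxid R (ev sgL w g1) & size g1 = size g^`()].
  by exists g^`().
by rewrite leqNgt -sgn lt_size_deriv.
Qed.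

(* w is an element of positive or zero value; the logarithmic derivative of w
   is read off from w ^ e = t ^ k u. *)
Lemma log_derivative (w u : L) e k : (0 < e)%N -> w != 0 -> u != 0 ->
  w ^+ e = t ^+ k * u -> e%:R != 0 :> L ->
  th w = w / e%:R * (k%:R * c + th u / u).
Proof.
case: e => // e _ w0 u0 E e0; have := congr1 th E.
rewrite (derivationX thM) thM.
have -> : th (t ^+ k) = k%:R * c * t ^+ k.
  case: k {E} => [|k]; first by rewrite expr0 (derivation1 thM) !mul0r.
  by rewrite (derivationX thM) tht exprS; ring.
move=> E2; have we0 : w ^+ e != 0 by rewrite expf_neq0.
apply: (mulfI (mulf_neq0 e0 we0)); rewrite E2.
transitivity (t ^+ k * u * (k%:R * c + th u / u)); first by field.
rewrite -E exprSr; by move: (e.+1%:R) e0 => N N0; field; rewrite N0 u0.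
Qed.

Lemma natL_neq0 e : (0 < e)%N -> e%:R != 0 :> L /\ R e%:R^-1.
Proof.
case: e => // e _; have <- : sgL e.+1%:R = e.+1%:R by rewrite rmorph_nat.
by rewrite fmorph_eq0 char0 -fmorphV; split=> //; apply: RS.
Qed.

(** * Removal of the pole bound *)

Section Descent.
Variables (h : L) (d : nat) (C : 'M[F]_d.+1).
Hypothesis kerC : forall p, horner_mx C p = 0 <-> ev f h p = 0.
Hypothesis bnd : exists2 D : F, D != 0 &
  forall p, R (ev f h p) -> R (f D * th (ev f h p)).

Let E := (d.+1)`!.

(* That is, th maps the valuation ring of F(h) to elements of value >= - n / E. *)
Definition pole_bound n := forall p, R (ev f h p) -> R (th (ev f h p) ^+ E * t ^+ n).

Let W n x := R (x ^+ E * t ^+ n).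

Fact E_gt0 : (0 < E)%N. Proof. exact: fact_gt0. Qed.

Fact W_mul n a x : R a -> W n x -> W n (a * x).
Proof.
by move=> Ra Wx; rewrite /W exprMn -mulrA; apply: (srM V) => //; apply: (srX V).
Qed.

Fact W_add n x y : W n x -> W n y -> W n (x + y).
Proof.
have main u v : W n u -> W n v -> R (u / v) -> W n (u + v).
  move=> Wu Wv Ruv; have [v0|v0] := eqVneq v 0; first by rewrite v0 addr0.
  have -> : u + v = (u / v + 1) * v by rewrite mulrDl mul1r divfK.
  by apply: W_mul => //; apply: (srD V) => //; apply: (sr1 V).
move=> Wx Wy; case: (vr_total V (x / y)) => hxy; first exact: main.
by rewrite addrC; apply: main => //; move: hxy; rewrite invf_div.
Qed.

Fact W_in n x : R x -> W n x.
Proof. by move=> Rx; apply: (srM V); apply: (srX V). Qed.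

Fact pole_bound_exists : exists n, pole_bound n.
Proof.
have [D D0 hD] := bnd; have [k [e [s [De s0 me]]]] := Fval D0.
have [Re ReV] := unit_of_residue s0 me.
exists (`|k| * E)%N => p Rp; have := hD p Rp; set x := th _ => Dx.
rewrite exprM -exprMn; apply: (srX V).
have fe0 : f e != 0 by apply: contraNneq D0; rewrite De => /eqP; rewrite fmorph_eq0 => /eqP ->; rewrite mulr0.
case: k De => k De.
  have -> : x * t ^+ `|k| = (f e)^-1 * (f D * x) by rewrite De rmorphM rmorphXn; field.
  exact: (srM V).
have -> : x * t ^+ `|Negz k| = (f e)^-1 * (f D * x) * (t ^+ k.+1 * t ^+ k.+1).
  rewrite De rmorphM fmorphXz -[t ^ Negz k]/(t ^- k.+1) NegzE abszN absz_nat.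
  by field; rewrite fe0 expf_neq0.
by apply: (srM V); [apply: (srM V) | apply: (srM V); apply: (srX V)].
Qed.

(** Write [z ^+ e = t ^+ k * u] with [k > 0] and a unit [u] of [F(h)]: the logarithmic derivative of
    [z] has no worse pole than that of [u]. As [e] divides [E], the value of [z] is at least that of
    [t] divided by [E]. *)
Fact pole_bound_unit n z : pole_bound n -> z != 0 -> maxid R z ->
  (exists p, z = ev f h p) -> exists y, [/\ W n y, th z = z * y & R (z ^+ E / t)].
Proof.
move=> Pn z0 mz [p zp].
have hchar : ev f z (char_poly (horner_mx C p)) = 0.
  rewrite zp -ev_comp; apply/kerC; rewrite horner_mx_comp; exact: Cayley_Hamilton.
have [e [k [u [/andP[e0 ed] ze Ru Ru']]]] :=
  fraction_value (monic_neq0 (char_poly_monic _)) hchar z0.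
rewrite size_char_poly ltnS in ed.
have u0 : u != 0.
  by apply: contraNneq z0 => u0; move/eqP: ze; rewrite u0 mulr0 expf_eq0 e0.
have mze : maxid R (z ^+ e).
  rewrite -(prednK e0) exprSr; apply: (maxidM V) => //; apply: (srX V).
  exact: (maxid_in V).
have [k' kE] : exists k' : nat, k = k'.+1.
  case: k ze => [[|k']|k'] ze; last 2 first.
  - by exists k'.
  - case: mze => [/eqP|]; first by rewrite expf_eq0 e0 (negPf z0).
    case; rewrite ze invfM -[t ^ _]/(t ^- k'.+1) invrK.
    by apply: (srM V) => //; apply: (srX V).
  case: mze => [/eqP|]; first by rewrite expf_eq0 e0 (negPf z0).
  by case; rewrite ze expr0z mul1r.
rewrite kE -exprnP in ze.
have [eL ReV] := natL_neq0 e0.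
exists (e%:R^-1 * (k'.+1%:R * c + th u / u)); split.
- apply: W_mul => //; apply: W_add.
    by apply: W_in; apply: (srM V) => //; apply: (sr_nat V).
  rewrite mulrC; apply: W_mul => //.
  have uE : u = ev f h (p ^+ e * (tau ^- k'.+1)%:P).
    rewrite evM evC evX_ -zp ze fmorphV rmorphXn; field.
    by rewrite expf_neq0.
  by rewrite uE; apply: Pn; rewrite -uE.
- by rewrite (log_derivative e0 z0 u0 ze eL) -mulrA.
have /dvdnP[e' EE] : (e %| E)%N by apply: dvdn_fact; rewrite e0.
have e'0 : (0 < e')%N by move: E_gt0; rewrite EE; case: e' {EE}.
rewrite EE mulnC exprM ze -(prednK e'0) exprSr.
have -> : (t ^+ k'.+1 * u) ^+ e'.-1 * (t ^+ k'.+1 * u) / t =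
  (t ^+ k'.+1 * u) ^+ e'.-1 * (t ^+ k' * u) by rewrite exprS; field.
by apply: (srM V); [apply: (srX V)|]; apply: (srM V) => //; apply: (srX V).
Qed.

(** With [z = g(w)] in the maximal ideal and [g'(w)] a unit, [th w] is [th z] up to a regular term
    and a unit factor. Since [th z] is [z] times an element with pole bound [n.+1], the positive
    value of [z] lowers the bound by one. *)
Fact pole_bound_pred n : pole_bound n.+1 -> pole_bound n.
Proof.
move=> Pn p Rw; set w := ev f h p in Rw *.
have algw : algebraicOver f w.
  exists (char_poly (horner_mx C p)); first exact/monic_neq0/char_poly_monic.
  apply/rootP; rewrite -/(ev f w _) /w -ev_comp; apply/kerC.
  by rewrite horner_mx_comp; apply: Cayley_Hamilton.
have [g [mg mg']] := residue_root algw Rw.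
have Rg (q : {poly S}) : R (ev sgL w q).
  by apply: (sr_horner V) => // i; rewrite coef_map; apply: RS.
have [g'0 Rg'] := maxidPn mg'.
have := derivation_horner thD thM (map_poly sgL g) w.
rewrite deriv_map -/(ev sgL w g) -/(ev sgL w g^`()); set x := (map_poly th _).[w] => e.
have -> : th w = (ev sgL w g^`())^-1 * (th (ev sgL w g) - x).
  by rewrite e addrC addKr mulKf.
apply: W_mul => //; apply: W_add.
  set z := ev sgL w g in mg *.
  have [z0|z0] := eqVneq z 0; first by rewrite z0 (derivation0 thD); apply/W_in/(sr0 V).
  have [|y [Wy -> Rz]] := pole_bound_unit Pn z0 mg.
    by exists (map_poly sg g \Po p); rewrite ev_comp /ev -map_poly_comp.
  rewrite /W exprMn; have -> : z ^+ E * y ^+ E * t ^+ n = z ^+ E / t * (y ^+ E * t ^+ n.+1).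
    by rewrite exprS; field.
  exact: (srM V).
apply/W_in/(srN V)/(sr_horner V) => // i.
by rewrite coef_map_id0 ?(derivation0 thD) // coef_map; apply/thO/RS.
Qed.

Lemma descent : pole_bound 0.
Proof.
by have [n] := pole_bound_exists; elim: n => // n IH /pole_bound_pred.
Qed.

End Descent.

Lemma dominated_scaling h : algebraicOver f h ->
  exists2 D : F, D != 0 & dominated_integral f R (f D * h).
Proof.
move=> /integral_algebraic[r rm /rootP hr].
have [D [D0 OD ODr]] := common_denominator VO (fun i : 'I_(size r) => r`_i).
exists D => // R' V' RR'.
have [n sr] : exists n, size r = n.+1.
  exists (size r).-1; rewrite prednK // size_poly_gt0 monic_neq0 //.
have rn : r`_n = 1 by move/monicP: rm; rewrite /lead_coef sr.
pose q := \poly_(i < n.+1) (r`_i * D ^+ (n - i)).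
have qn : q`_n = 1 by rewrite coef_poly ltnSn subnn expr0 mulr1.
have sq : size q = n.+1.
  apply/eqP; rewrite eqn_leq size_poly ltnNge; apply/negP => le.
  by move/eqP: qn; rewrite nth_default // eq_sym oner_eq0.
have qm : map_poly f q \is monic.
  by rewrite monicE lead_coef_map /lead_coef sq qn rmorph1.
apply: (vr_integral V' qm).
  move=> i; rewrite coef_map /=; apply: RR'.
  have [le|lt] := leqP n i.
    rewrite coef_poly; case: ifP => lti; last by rewrite rmorph0; apply: (sr0 V).
    have -> : i = n by apply/eqP; rewrite eqn_leq le -ltnS lti.
    by rewrite rn subnn mulr1 rmorph1; apply: (sr1 V).
  rewrite coef_poly ltnS (ltnW lt) -(subnSK lt) exprS mulrA [_ * D]mulrC rmorphM.
  apply: (srM V); last by rewrite rmorphXn; apply: (srX V).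
  by have lti : (i < size r)%N; [rewrite sr ltnS ltnW | apply: (ODr (Ordinal lti))].
apply/rootP; rewrite -/(ev f _ q) (ev_sum _ _ (size_poly _ _)).
have -> : \sum_(i < n.+1) f q`_i * (f D * h) ^+ i = f D ^+ n * ev f h r.
  rewrite (@ev_sum _ _ _ _ r n.+1) ?sr // mulr_sumr; apply: eq_bigr => i _.
  have le : (i <= n)%N by rewrite -ltnS.
  have -> : f D ^+ n = f D ^+ (n - i) * f D ^+ i by rewrite -exprD subnK.
  by rewrite coef_poly ltn_ord rmorphM rmorphXn exprMn; ring.
by rewrite [ev _ _ _]hr mulr0.
Qed.

Lemma derivation_valring w : algebraicOver f w ->
  (R w -> R (th w)) /\ (maxid R w -> maxid R (th w)).
Proof.
(* The bound on denominators needs an integral generator of the extension, hence the scaling by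
   [D]. *)
move=> algw; have [D D0 LD] := dominated_scaling algw.
have algD : algebraicOver f (f D * w).
  by apply: algebraic_mul => //; apply: algebraic_id.
have [d [C [kerC invC freeC]]] := algebraic_mx algD.
have charF n : n.+1%:R != 0 :> F by rewrite -(rmorph_nat sg) fmorph_eq0.
have bnd := derivation_bounded V charF kerC invC freeC LD thD thM thO.
have P0 := descent kerC bnd.
have wE : w = ev f (f D * w) (D^-1 *: 'X).
  by rewrite evZ evX fmorphV mulKf // fmorph_eq0.
have W0 x : R (x ^+ (d.+1)`! * t ^+ 0) -> R x.
  rewrite mulr1; have := fact_gt0 d.+1; case: (_`!) => // E _; exact: vr_root.
split=> [Rw|mw].
  by rewrite wE; apply/W0/P0; rewrite -wE.
have [->|w0] := eqVneq w 0; first by rewrite (derivation0 thD); left.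
have [|y [Wy -> _]] := pole_bound_unit kerC P0 w0 mw.
  by exists (D^-1 *: 'X).
by rewrite mulrC; apply: (maxidM V) => //; apply: W0.
Qed.

End LogDerivation.

Lemma ratfun_lift (k L : fieldType) (sg : {rmorphism k -> L}) (t : L) :
  (forall p : {poly k}, p != 0 -> ev sg t p != 0) ->
  exists f : {rmorphism ratfun k -> L}, forall p, f p%:F = ev sg t p.
Proof.
move=> inj; pose e (x : ratfun k) := ev sg t \n_(repr x) / ev sg t \d_(repr x).
have eE (n d : {poly k}) : d != 0 -> e (n%:F / d%:F) = ev sg t n / ev sg t d.
  move=> d0; rewrite /e; set x := (n%:F / d%:F).
  have := ratfun_repr x; have := denom_ratioP (repr x).
  move: (\n_(repr x)) (\d_(repr x)) => n' d' d'0 /eqP.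
  rewrite eq_ratfun // => /eqP E.
  by apply/eqP; rewrite eqr_div ?inj // -!evM E.
have repr_ x : exists (n d : {poly k}), d != 0 /\ x = n%:F / d%:F :> ratfun k.
  by exists \n_(repr x), \d_(repr x); split; [apply: denom_ratioP | apply: ratfun_repr].
have e1 (p : {poly k}) : e p%:F = ev sg t p.
  by have := eE p 1 (oner_neq0 _); rewrite tofrac1 !divr1 ev1 divr1.
have [f fe] : exists f : {rmorphism ratfun k -> L}, forall x, f x = e x.
  apply: rmorphism_of.
  - move=> x y; have [n [d [d0 ->]]] := repr_ x; have [n' [d' [d'0 ->]]] := repr_ y.
    have -> : n%:F / d%:F - n'%:F / d'%:F = (n * d' - n' * d)%:F / (d * d')%:F :> ratfun k.
      by rewrite -mulNr addf_div ?tofrac_eq0 // mulNr -!tofracM -tofracB.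
    rewrite !eE ?mulf_neq0 // evD evN !evM; field.
    by rewrite !inj.
  - by rewrite -tofrac1 e1 ev1.
  - move=> x y; have [n [d [d0 ->]]] := repr_ x; have [n' [d' [d'0 ->]]] := repr_ y.
    have -> : n%:F / d%:F * (n'%:F / d'%:F) = (n * n')%:F / (d * d')%:F :> ratfun k.
      by rewrite mulf_div -!tofracM.
    rewrite !eE ?mulf_neq0 // !evM; field.
    by rewrite !inj.
by exists f => p; rewrite fe e1.
Qed.

Section Value.
Variables (S F L : fieldType) (sg : {rmorphism S -> F}) (f : {rmorphism F -> L}).
Variables (R : set L) (V : valring R) (tau : F).
Local Notation t := (f tau).
Hypothesis tau0 : tau != 0.
Hypothesis mt : maxid R t.
Hypothesis RS : forall s, R (f (sg s)).
Variables (th : L -> L) (c : L).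
Hypothesis thD : forall x y, th (x + y) = th x + th y.
Hypothesis thM : forall x y, th (x * y) = th x * y + x * th y.
Hypothesis thS : forall s, R (th (f (sg s))).
Hypothesis tht : th t = c * t.
Hypothesis Rc : R c.

(** The bound on [th (f e)] accompanies the decomposition so that both pass to quotients
    together. *)
Definition has_value (x : F) := exists (k : int) (e : F) (s : S),
  [/\ x = tau ^ k * e, s != 0, maxid R (f e - f (sg s)) & R (th (f e))].

Lemma has_valueX k x : has_value x -> has_value (tau ^ k * x).
Proof.
move=> [k' [e [s [-> s0 me Re]]]]; exists (k + k'), e, s; split => //.
by rewrite mulrA expfzDr.
Qed.

Lemma has_value_div x y : has_value x -> has_value y -> has_value (x / y).
Proof.
move=> [k [e [s [-> s0 me the]]]] [k' [e' [s' [-> s'0 me' the']]]].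
have [Re Re'] := unit_of_residue V RS s0 me.
have [Re2 Re2'] := unit_of_residue V RS s'0 me'.
have e'0 : f e' != 0.
  apply/eqP => e'0; move: me'; rewrite e'0 sub0r => /(maxidN V); rewrite opprK.
  case=> [/eqP|]; first by rewrite !fmorph_eq0 (negPf s'0).
  by apply; rewrite -!fmorphV; apply: RS.
have e'0' : e' != 0 by rewrite -(fmorph_eq0 f).
have sgs0 : f (sg s') != 0 by rewrite !fmorph_eq0.
exists (k - k'), (e / e'), (s / s'); split.
- rewrite expfzDr // -invr_expz; field.
  by rewrite e'0' expfz_neq0.
- by rewrite mulf_neq0 // invr_eq0.
- rewrite !fmorph_div.
  have -> : f e / f e' - f (sg s) / f (sg s') =
     (f e')^-1 * (f e - f (sg s)) - (f e')^-1 * f (sg s) * f (sg s'^-1) * (f e' - f (sg s')).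
    by rewrite !fmorphV; field; rewrite e'0 sgs0.
  apply: (maxidB V); first exact: (maxidM V).
  by apply: (maxidM V) => //; do 2?apply: (srM V).
- rewrite fmorph_div (derivation_div thD thM) //.
  have -> : (th (f e) * f e' - f e * th (f e')) / f e' ^+ 2 =
     th (f e) * (f e')^-1 - f e * th (f e') * ((f e')^-1 * (f e')^-1) by field.
  by apply: (srB V); do 3?apply: (srM V).
Qed.

Lemma ev_in (q : {poly S}) : R (f (ev sg tau q)).
Proof.
rewrite (ev_sum _ _ (leqnn _)) rmorph_sum; apply: (sr_sum V) => i _.
by rewrite rmorphM rmorphXn; apply: (srM V) => //; apply/(srX V)/(maxid_in V).
Qed.

Lemma has_value_ev (q : {poly S}) : q != 0 -> has_value (ev sg tau q).
Proof.
move=> q0; have [m [r]] := multiplicity_XsubC q 0.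
rewrite q0 subr0 /= => r0 ->; rewrite evM evX_ evX mulrC exprnP.
apply: has_valueX; exists 0, (ev sg tau r), r.[0]; split=> //.
- by rewrite expr0z mul1r.
- have : root (r - r.[0]%:P) 0 by rewrite rootE !hornerE subrr.
  rewrite -rmorphB; have -> : ev sg tau r - sg r.[0] = ev sg tau (r - r.[0]%:P).
    by rewrite evD evN evC.
  move=> /factor_theorem[r' ->]; rewrite subr0 evM evX rmorphM.
  by apply: (maxidM V) => //; apply: ev_in.
rewrite (ev_sum _ _ (leqnn _)) rmorph_sum (derivation_sum thD); apply: (sr_sum V) => i _.
have Rt := maxid_in V mt.
rewrite rmorphM thM rmorphXn; apply: (srD V).
  by apply: (srM V) => //; apply: (srX V).
apply: (srM V) => //; case: (nat_of_ord i) => [|j].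
  by rewrite expr0 (derivation1 thM); apply: (sr0 V).
rewrite (derivationX thM) tht; do ?apply: (srM V) => //; first exact: (sr_nat V).
exact: (srX V).
Qed.

Lemma has_value_der x : has_value x -> R (f x) -> R (th (f x)).
Proof.
move=> [k [e [s [xe s0 me the]]]] Rx.
have [Re Re'] := unit_of_residue V RS s0 me.
have Rt := maxid_in V mt.
have fe0 : f e != 0.
  apply/eqP => e'0; move: me; rewrite e'0 sub0r => /(maxidN V); rewrite opprK.
  case=> [/eqP|]; first by rewrite !fmorph_eq0 (negPf s0).
  by apply; rewrite -!fmorphV; apply: RS.
have t0 : t != 0 by rewrite fmorph_eq0.
case: k xe => k xe; last first.
  case: (nRtV tau0 mt); have -> : t^-1 = f x * t ^+ k * (f e)^-1.
    rewrite xe rmorphM fmorphXz -[t ^ _]/(t ^- k.+1) exprS.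
    by field; rewrite fe0 t0 expf_neq0.
  by apply: (srM V) => //; apply: (srM V) => //; apply: (srX V).
rewrite xe rmorphM -exprnP rmorphXn thM; apply: (srD V); last first.
  by apply: (srM V) => //; apply: (srX V).
apply: (srM V) => //; case: k {xe} => [|j].
  by rewrite expr0 (derivation1 thM); apply: (sr0 V).
rewrite (derivationX thM) tht; do ?apply: (srM V) => //; first exact: (sr_nat V).
exact: (srX V).
Qed.

End Value.

Section AlgebraicDer.
Variables (F L : fieldType) (f : {rmorphism F -> L}).
Hypothesis char0 : forall n, n.+1%:R != 0 :> F.

Lemma separable_relation h : algebraicOver f h ->
  exists p : {poly F}, ev f h p = 0 /\ ev f h p^`() != 0.
Proof.
case=> p0 p00 /rootP hp0.
pose P n := `[< exists p : {poly F}, [/\ p != 0, ev f h p = 0 & size p = n] >].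
have exP : exists n, P n by exists (size p0); apply/asboolP; exists p0.
have [n /asboolP[p [pn0 hp sp]] minn] := ex_minnP exP.
exists p; split=> //; apply/eqP => hp'.
have sp1 : (1 < size p)%N.
  rewrite ltnNge; apply/negP => /size1_polyC e.
  move: hp; rewrite e evC => /eqP; rewrite fmorph_eq0 => /eqP c0.
  by move: pn0; rewrite e c0 eqxx.
have p'0 : p^`() != 0.
  apply/eqP => /(congr1 (fun q : {poly F} => q`_(size p).-2)).
  rewrite coef_deriv coef0 -mulr_natr => /eqP; rewrite mulf_eq0 (negPf (char0 _)) orbF.
  have := lead_coef_eq0 p; rewrite /lead_coef (negPf pn0).
  by case: (size p) sp1 => [|[|k]] //= _ ->.
have /asboolP/minn : exists q : {poly F}, [/\ q != 0, ev f h q = 0 & size q = size p^`()].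
  by exists p^`().
by rewrite leqNgt -sp lt_size_deriv.
Qed.

Variable th : L -> L.
Hypothesis thD : forall x y, th (x + y) = th x + th y.
Hypothesis thM : forall x y, th (x * y) = th x * y + x * th y.
Hypothesis thF : forall x, exists y, th (f x) = f y.

Lemma algebraic_der h : algebraicOver f h -> algebraicOver f (th h).
Proof.
move=> algh; have [p [hp hp']] := separable_relation algh.
have ev_alg q : algebraicOver f (ev f h q).
  rewrite (ev_sum _ _ (leqnn _)); apply: (big_ind (algebraicOver f)).
  - exact: algebraic0.
  - exact: algebraic_add.
  - move=> i _; apply: algebraic_mul; first exact: algebraic_id.
    elim: (nat_of_ord i) => [|j IH]; first exact: algebraic1.
    by rewrite exprS; apply: algebraic_mul.
have [|q _ qe] := @poly_lift _ _ f (fun=> True) (map_poly th (map_poly f p)) I.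
  move=> i; rewrite coef_map_id0 ?(derivation0 thD) // coef_map.
  by have [y ye] := thF p`_i; exists y.
have := derivation_horner thD thM (map_poly f p) h.
rewrite -qe -/(ev f h p) hp (derivation0 thD) deriv_map => /esym/eqP.
rewrite addrC addr_eq0 => /eqP e.
have -> : th h = - ev f h q / ev f h p^`().
  by apply: (mulfI hp'); rewrite e mulrC divfK.
by apply: algebraic_div => //; apply: algebraic_opp.
Qed.

End AlgebraicDer.

Lemma algebraic_trans (E F L : fieldType) (s : {rmorphism E -> L}) (f : {rmorphism F -> L}) w :
  (forall y, algebraicOver s (f y)) -> algebraicOver f w -> algebraicOver s w.
Proof.
move=> h [p p0 hp]; apply/integral_algebraic.
apply: (integral_root (p := map_poly f p)) => //; first by rewrite map_poly_eq0.
apply/integral_poly => i; apply/integral_algebraic; rewrite coef_map; exact: h.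
Qed.

Section LogPlace.
Variables (S F L : fieldType) (sg : {rmorphism S -> F}) (f : {rmorphism F -> L}).
Variables (R : set L) (tau : F) (th : L -> L).

(* The valuation ring R restricts to the place tau = 0 of F = S(tau), and the
   derivation th is logarithmic at this place. *)
Record log_place : Prop := LogPlace {
  lp_valring :> valring R;
  lp_char0 : forall n, n.+1%:R != 0 :> S;
  lp_tau0 : tau != 0;
  lp_maxid : maxid R (f tau);
  lp_const : forall s, R (f (sg s));
  lp_D : forall x y, th (x + y) = th x + th y;
  lp_M : forall x y, th (x * y) = th x * y + x * th y;
  lp_dlog : exists2 c, R c & th (f tau) = c * f tau;
  lp_value : forall x, x != 0 -> has_value sg f R tau th x
}.

Section Theory.
Variable P : log_place.

Fact lp_Fval (x : F) : x != 0 -> exists (k : int) (e : F) (s : S),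
  [/\ x = tau ^ k * e, s != 0 & maxid R (f e - f (sg s))].
Proof. by move=> /(lp_value P)[k [e [s [? ? ? _]]]]; exists k, e, s. Qed.

Lemma lp_der w : algebraicOver f w ->
  (R w -> R (th w)) /\ (maxid R w -> maxid R (th w)).
Proof.
have [c Rc tht] := lp_dlog P.
have thO x : R (f x) -> R (th (f x)).
  have [->|x0] := eqVneq x 0.
    by rewrite rmorph0 (derivation0 (lp_D P)).
  by apply: (has_value_der P (lp_tau0 P) (lp_maxid P) (lp_const P) (lp_M P) tht Rc);
    apply: (lp_value P).
exact: (derivation_valring P (lp_char0 P) (lp_tau0 P) (lp_maxid P) (lp_const P)
  lp_Fval (lp_D P) (lp_M P) thO tht Rc).
Qed.

Lemma lp_residue_root w : algebraicOver f w -> R w ->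
  exists g : {poly S}, maxid R (ev (f \o sg) w g) /\ ~ maxid R (ev (f \o sg) w g^`()).
Proof.
exact: (residue_root P (lp_char0 P) (lp_tau0 P) (lp_maxid P) (lp_const P) lp_Fval).
Qed.

Lemma lp_fraction_value w : algebraicOver f w -> w != 0 ->
  exists e (k : int) u, [/\ (0 < e)%N, w ^+ e = f tau ^ k * u, R u & R u^-1].
Proof.
case=> p p0 /rootP hp w0.
have [e [k [u [/andP[e0 _] ? ? ?]]]] := fraction_value P (lp_const P) lp_Fval p0 hp w0.
by exists e, k, u.
Qed.

End Theory.

Lemma log_place_intro (c : L) : valring R -> (forall n, n.+1%:R != 0 :> S) ->
  tau != 0 -> maxid R (f tau) -> (forall s, R (f (sg s))) ->
  (forall x y, th (x + y) = th x + th y) ->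
  (forall x y, th (x * y) = th x * y + x * th y) ->
  (forall s, R (th (f (sg s)))) -> R c -> th (f tau) = c * f tau ->
  (forall x, x != 0 -> exists (k : int) (p q : {poly S}),
    [/\ x = tau ^ k * (ev sg tau p / ev sg tau q), p != 0 & q != 0]) ->
  log_place.
Proof.
move=> V ch tau0 mt RS thD thM thS Rc tht h; split=> //; first by exists c.
move=> x /h[k [p [q [-> p0 q0]]]]; apply: (has_valueX tau0).
by apply: (has_value_div V tau0 RS thD thM);
  apply: (has_value_ev V tau0 mt RS thD thM thS tht Rc).
Qed.

End LogPlace.

(** * Algebraic invariant lines of Liouvillian systems *)

(* The line spanned by v is invariant under the connection d/dz - A: in
   projective coordinates, v is an algebraic solution of a Riccati system. *)
Definition invariant_line (E : diffFieldType) p (A : 'M[E]_p) (L : diffFieldType)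
    (phi : {rmorphism E -> L}) (v : 'I_p -> L) (u : L) : Prop :=
  [/\ exists r, v r = 1, forall i, algebraicOver phi (v i)
    & forall i, der (v i) = \sum_j phi (A i j) * v j - u * v i].

Definition algebraic_line (E : diffFieldType) p (A : 'M[E]_p) : Prop :=
  exists (L : diffFieldType) (phi : {rmorphism E -> L}) v u,
    diff_morphism phi /\ invariant_line A phi v u.

Lemma der_subfield (K L : diffFieldType) (phi : {rmorphism K -> L}) (U : set L) :
  diff_morphism phi -> diff_subfield U -> diff_subfield (fun y => U (phi y)).
Proof.
move=> dphi dU; split.
- by rewrite rmorph1; apply: (dsf1 dU).
- by move=> x y; rewrite rmorphB; apply: (dsfB dU).
- by move=> x y; rewrite fmorph_div; apply: (dsf_div dU).
- by move=> x; rewrite dphi; apply: (dsf_der dU).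
Qed.

(** Dividing by the coordinate [rho] eliminates [u]; the equation of that coordinate supplies the
    new multiplier. *)
Lemma projective_riccati (L : diffFieldType) p (a : 'I_p -> 'I_p -> L) (v : 'I_p -> L)
    (u : L) (rho : 'I_p) : v rho != 0 ->
  (forall i, der (v i) = \sum_j a i j * v j - u * v i) ->
  forall i, der (v i / v rho) =
    \sum_j a i j * (v j / v rho) - (\sum_j a rho j * (v j / v rho)) * (v i / v rho).
Proof.
move=> vrho0 eqv i; set b := \sum_j a rho j * _.
have eqv' k : der (v k) = (\sum_j a k j * (v j / v rho)) * v rho - u * v k.
  rewrite eqv mulr_suml; congr (_ - _); apply: eq_bigr => j _.
  by rewrite -mulrA divfK.
rewrite (derivation_div (@derD _) (@derM _)) // !eqv' -/b; set c := \sum_j _.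
by field.
Qed.

Section Step.
Variables (E1 E2 : diffFieldType) (g : {rmorphism E1 -> E2}) (dg : diff_morphism g).
Variable (x : E2).
Hypothesis char0 : forall n, n.+1%:R != 0 :> E1.
Hypothesis gen : forall U : set E2, diff_subfield U -> (range g `<=` U)%classic ->
  U x -> forall y, U y.
Variables (L : diffFieldType) (phi : {rmorphism E2 -> L}) (dphi : diff_morphism phi).
Let s : {rmorphism E1 -> L} := phi \o g.

Let ds : diff_morphism s.
Proof. by move=> y; rewrite /s /= dg dphi. Qed.

Lemma algebraic_step : algebraicOver s (phi x) -> forall y, algebraicOver s (phi y).
Proof.
move=> algx; apply: (gen (U := fun y => algebraicOver s (phi y))) => //; last first.
  by move=> _ [y _ <-]; apply: (algebraic_id s).
apply: (der_subfield (U := algebraicOver s)) => //; split.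
- exact: algebraic1.
- exact: algebraic_sub.
- exact: algebraic_div.
- apply: algebraic_der => //; [exact: derD | exact: derM |].
  by move=> y; exists (der y); rewrite ds.
Qed.

Variables (p : nat) (A : 'M[E1]_p).

(* The line over E1(x) specializes at the place x = oo. *)
Lemma transcendental_step v u (a : E1) : ~ algebraicOver s (phi x) ->
  x != 0 -> der x = g a * x \/ der x = g a ->
  invariant_line (map_mx g A) phi v u -> algebraic_line A.
Proof.
move=> nalg x0 dx [[r vr] valg eqv].
pose xi := phi x; pose t := xi^-1.
have xi0 : xi != 0 by rewrite fmorph_eq0.
have inj (q : {poly E1}) : q != 0 -> ev s t q != 0.
  move=> q0; apply/eqP => hq; apply: nalg; rewrite -[phi x]invrK.
  by apply: algebraic_inv; exists q => //; apply/rootP.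
have [f fE] := ratfun_lift inj.
pose sg : {rmorphism E1 -> ratfun E1} := (@tofrac _) \o polyC.
have fsg y : f (sg y) = s y by rewrite /sg /= fE evC.
pose tau : ratfun E1 := 'X%:F.
have ft : f tau = t by rewrite fE evX.
have sA : subring (range s).
  split; first by exists 1; rewrite ?rmorph1.
    by move=> _ _ [y _ <-] [z _ <-]; exists (y - z); rewrite ?rmorphB.
  by move=> _ _ [y _ <-] [z _ <-]; exists (y * z); rewrite ?rmorphM.
have nA : ~ sr_adjoin (range s) t xi.
  move=> [q0 hq0]; have [|q _ <-] := @poly_lift _ _ s (fun=> True) q0 I.
    by move=> i; have [y _ ye] := hq0 i; exists y.
  rewrite -/(ev s t q) => e.
  have : ev s t ('X * q - 1) = 0.
    by rewrite evD evN evM evX ev1 -e mulVf // subrr.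
  move/eqP; apply/negP/inj/eqP => /(congr1 (fun q : {poly E1} => q`_0)).
  by rewrite coefB coefXM coefC coef0 sub0r => /eqP; rewrite oppr_eq0 oner_eq0.
have [R [V AR nR]] := chevalley (sr_adjoin_subring sA t) (sr_adjoin_gen sA t) nA.
have RS y : R (s y) by apply/AR/sub_sr_adjoin => //; exists y.
have mt : maxid R (f tau) by rewrite ft; right; rewrite invrK.
have Rt := maxid_in V mt.
have tau0 : tau != 0 by rewrite tofrac_eq0 polyX_eq0.
(* [t'/t] is [- a] for an exponential and [- a * t] for an integral, so the derivation is
   logarithmic in both cases. *)
have [gam [Rgam dt]] : exists gam, R (f gam) /\ der (f tau) = f gam * f tau.
  have : der t = - (der xi / xi ^+ 2) by rewrite (derivationV (@derD _) (@derM _)).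
  have -> : der xi = phi (der x) by rewrite dphi.
  case: dx => ->; rewrite ft => ->.
    exists (- sg a); rewrite rmorphN fsg; split; first exact: (srN V).
    by rewrite rmorphM -/(s a) -/xi /t; field.
  exists (- sg a * tau); rewrite rmorphM rmorphN fsg ft; split.
    by rewrite -ft; apply: (srM V) => //; apply: (srN V).
  by rewrite -/(s a) /t; field.
have RS' y : R (f (sg y)) by rewrite fsg.
have dS y : R (der (f (sg y))) by rewrite fsg -ds.
have P : log_place sg f R tau der.
  apply: (@log_place_intro _ _ _ sg f R tau der (f gam)) => //.
  - exact: derD.
  - exact: derM.
  move=> y; rewrite (ratfun_repr y).
  move: (\n_(repr y)) (\d_(repr y)) (denom_ratioP (repr y)) => n d d0 nd0.
  have evF (q : {poly E1}) : q%:F = ev sg tau q.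
    apply: (fmorph_inj f); rewrite fE /ev -horner_map /= -map_poly_comp -ft.
    by congr (_.[_]); apply: eq_map_poly => z /=; rewrite fsg.
  exists 0, n, d; rewrite expr0z mul1r -!evF; split=> //.
  by apply: contraNneq nd0 => ->; rewrite rmorph0 mul0r.
have charF n : n.+1%:R != 0 :> ratfun E1 by rewrite -(rmorph_nat sg) fmorph_eq0.
have derF (y : ratfun E1) : exists z, der (f y) = f z.
  have derp (q : {poly E1}) : exists z, der (f q%:F) = f z.
    exists ((map_poly der q)%:F + q^`()%:F * (gam * tau)).
    have dt' : der t = f (gam * tau) by rewrite rmorphM -dt ft.
    rewrite fE {1}/ev (derivation_horner (@derD _) (@derM _)) dt'.
    rewrite rmorphD; congr (_ + _); last by rewrite [in RHS]rmorphM fE deriv_map.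
    rewrite fE /ev; congr (_.[_]); apply/polyP => i.
    rewrite coef_map_id0 ?(derivation0 (@derD _)) // !coef_map.
    by rewrite coef_map_id0 ?(derivation0 (@derD _)) // -ds.
  rewrite (ratfun_repr y); move: (\n_(repr y)) (\d_(repr y)) (denom_ratioP (repr y)) => n d d0.
  have [zn en] := derp n; have [zd ed] := derp d.
  exists ((zn * d%:F - n%:F * zd) / d%:F ^+ 2).
  rewrite !fmorph_div (derivation_div (@derD _) (@derM _)) ?fmorph_eq0 ?tofrac_eq0 //.
  by rewrite en ed rmorphXn rmorphB !rmorphM.
have derM_ := algebraic_der charF (@derD _) (@derM _) derF.
have phiF y : range f (phi y).
  apply: (gen (U := fun y => range f (phi y))).
  - apply: (der_subfield (U := range f)) => //; split.
    + by exists 1; rewrite ?rmorph1.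
    + by move=> _ _ [y1 _ <-] [z _ <-]; exists (y1 - z); rewrite ?rmorphB.
    + by move=> _ _ [y1 _ <-] [z _ <-]; exists (y1 / z); rewrite ?fmorph_div.
    + by move=> _ [y1 _ <-]; have [z e] := derF y1; exists z.
  - by move=> _ [y1 _ <-]; exists (sg y1) => //; rewrite fsg.
  - by exists tau^-1 => //; rewrite fmorphV ft /t invrK.
have valgf i : algebraicOver f (v i).
  have [q q0 hq] := valg i.
  have [|q' _ qe] := @poly_lift _ _ f (fun=> True) (map_poly phi q) I.
    by move=> j; rewrite coef_map; have [z _ ze] := phiF q`_j; exists z.
  by exists q'; rewrite ?qe // -(map_poly_eq0 f) qe map_poly_eq0.
(* Dividing by the largest coordinate puts all coordinates in [R] and keeps one equal to 1, so the
   specialised vector is nonzero. *)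
have [|rho [vrho0 Rw]] := vr_max V (v := v); first by exists r; rewrite vr oner_neq0.
pose w i := v i / v rho.
have walg i : algebraicOver f (w i) by apply: algebraic_div.
pose u' := \sum_j s (A rho j) * w j.
have eqw i : der (w i) = \sum_j s (A i j) * w j - u' * w i.
  apply: (@projective_riccati L p (fun i j => s (A i j)) v u rho vrho0) => k.
  by rewrite eqv; congr (_ - _); apply: eq_bigr => j _; rewrite mxE.
(* The derivation is known to preserve [R] only on elements algebraic over [f]; the local ring to be
   reduced is the intersection of [R] with these. *)
pose M y := algebraicOver f y.
have salg y : M (s y) by rewrite -fsg; apply: algebraic_id.
have [] := @residue_diff_field L (fun y => M y /\ R y) (fun y => M y /\ maxid R y).
- by split; [apply: algebraic1 | apply: (sr1 V)].
- by move=> y z [My Ry] [Mz Rz]; split; [apply: algebraic_sub | apply: (srB V)].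
- by move=> y z [My Ry] [Mz Rz]; split; [apply: algebraic_mul | apply: (srM V)].
- by move=> y [My Ry]; split; [apply: derM_ | apply: (lp_der P My).1].
- by split; [apply: algebraic0 | left].
- by move=> h; have [_] := h; apply: (maxid1 V).
- by move=> y z [My Ry] [Mz Rz]; split; [apply: algebraic_add | apply: (maxidD V)].
- by move=> y z [My Ry] [Mz Rz]; split; [apply: algebraic_mul | apply: (maxidM V)].
- by move=> y [My my]; split; [apply: derM_ | apply: (lp_der P My).2].
- move=> y [My Ry] nm; have /maxidPn[y0 RyV] : ~ maxid R y by move=> my; apply: nm.
  by split; [apply: algebraic_inv|].
set A0 := fun y => M y /\ R y => kap [res [res1 resB resM resd res0]].
have A0s y : A0 (s y) by [].
have A00 : A0 0 by split; [apply: algebraic0 | apply: (sr0 V)].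
have A0M y z : A0 y -> A0 z -> A0 (y * z).
  by move=> [My Ry] [Mz Rz]; split; [apply: algebraic_mul | apply: (srM V)].
have A0D y z : A0 y -> A0 z -> A0 (y + z).
  by move=> [My Ry] [Mz Rz]; split; [apply: algebraic_add | apply: (srD V)].
have res00 : res 0 = 0 by apply/res0 => //; split; [apply: algebraic0 | left].
have resD y z : A0 y -> A0 z -> res (y + z) = res y + res z.
  by move=> Ay Az; have := resB _ _ (A0D _ _ Ay Az) Az; rewrite addrK => ->; rewrite subrK.
have resS (G : 'I_p -> L) : (forall j, A0 (G j)) ->
    A0 (\sum_j G j) /\ res (\sum_j G j) = \sum_j res (G j).
  move=> AG; apply: (big_rec2 (fun y z => A0 y /\ res y = z)) => // j y z _ [Az <-].
  by split; [apply: A0D | rewrite resD].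
have [phi' phi'E] : exists phi' : {rmorphism E1 -> kap}, forall y, phi' y = res (s y).
  apply: rmorphism_of.
  - by move=> y z; rewrite -[LHS]/(res (s (y - z))) rmorphB; apply: resB.
  - by rewrite -[LHS]/(res (s 1)) rmorph1 res1.
  - by move=> y z; rewrite -[LHS]/(res (s (y * z))) rmorphM; apply: resM.
have A0w i : A0 (w i) by split; [apply: walg | apply: Rw].
have A0sw i j : A0 (s (A i j) * w j) by apply: A0M.
have [A0u res_u] := resS _ (A0sw rho).
exists kap, phi', (fun i => res (w i)), (res u'); split.
  by move=> y; rewrite !phi'E ds resd.
split.
- by exists rho; rewrite /w divff.
- move=> i; have [g0 [mg ng]] := lp_residue_root P (walg i) (Rw i).
  have res_ev (q : {poly E1}) :
      A0 (ev (f \o sg) (w i) q) /\ res (ev (f \o sg) (w i) q) = ev phi' (res (w i)) q.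
    elim/poly_ind: q => [|q z [Aq IH]]; first by rewrite !ev0.
    have Az : A0 ((f \o sg) z) by rewrite /= fsg.
    have Aqw := A0M _ _ Aq (A0w i).
    rewrite !evD !evM !evX !evC; split; first exact: A0D.
    by rewrite (resD _ _ Aqw Az) (resM _ _ Aq (A0w i)) IH phi'E /= fsg.
  exists g0.
    by apply/eqP => g00; apply: ng; rewrite g00 deriv0 ev0; left.
  have [[Mg Rg] e] := res_ev g0.
  by apply/rootP; rewrite -/(ev phi' _ _) -e; apply/res0.
move=> i; rewrite -[LHS]/(der (res (w i))) -(resd _ (A0w i)) eqw.
have [A0i e] := resS _ (A0sw i).
rewrite (resB _ _ A0i (A0M _ _ A0u (A0w i))) e (resM _ _ A0u (A0w i)).
congr (_ - _); apply: eq_bigr => j _.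
by rewrite (resM _ _ (A0s _) (A0w j)) phi'E.
Qed.

End Step.

(** Algebraicity of [x] is tested inside [L]: an exponential or integral that happens to be
    algebraic is handled by transitivity, and the place x = oo is used for a transcendental [x]
    only. *)
Lemma liouvillian_step (E1 E2 : diffFieldType) (g : {rmorphism E1 -> E2})
    (x : E2) p (A : 'M[E1]_p) :
  diff_morphism g -> (forall n, n.+1%:R != 0 :> E1) ->
  (forall U : set E2, diff_subfield U -> (range g `<=` U)%classic ->
     U x -> forall y, U y) ->
  [\/ algebraicOver g x, exists2 a, True & der x = g a * x
    | exists2 a, True & der x = g a] ->
  algebraic_line (map_mx g A) -> algebraic_line A.
Proof.
move=> dg ch gen dx [L [phi [v [u [dphi inv]]]]].
pose s : {rmorphism E1 -> L} := phi \o g.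
have [algx|nalg] := pselect (algebraicOver s (phi x)).
  have algE := algebraic_step dg ch gen dphi algx.
  have [vr valg eqv] := inv; exists L, s, v, u; split.
    by move=> y; rewrite /s /= dg dphi.
  split=> //; first by move=> i; apply: algebraic_trans (valg i).
  by move=> i; rewrite eqv; congr (_ - _); apply: eq_bigr => k _; rewrite mxE.
have x0 : x != 0.
  by apply/eqP => x0; apply: nalg; rewrite x0 rmorph0; apply: algebraic0.
case: dx => [[q q0 hq]|[a _ dx]|[a _ dx]].
- case: nalg; exists q => //.
  by rewrite map_poly_comp rmorph_root.
- by apply: (transcendental_step dg ch gen dphi (a := a) nalg x0 _ inv); left.
- by apply: (transcendental_step dg ch gen dphi (a := a) nalg x0 _ inv); right.
Qed.

Lemma diff_adjoin_subfield (K : diffFieldType) (S A : set K) :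
  diff_subfield (diff_adjoin S A).
Proof.
split.
- by move=> U [dU _]; apply: (dsf1 dU).
- by move=> x y hx hy U hU; apply: (dsfB hU.1); [apply: hx | apply: hy].
- by move=> x y hx hy U hU; apply: (dsf_div hU.1); [apply: hx | apply: hy].
- by move=> x hx U hU; apply: (dsf_der hU.1); apply: hx.
Qed.

Lemma sub_diff_adjoin (K : diffFieldType) (S A : set K) x :
  (S `|` A)%classic x -> diff_adjoin S A x.
Proof. by move=> h U [_]; apply. Qed.

Lemma range_lift (A B C : fieldType) (f : {rmorphism A -> C}) (g : {rmorphism B -> C}) :
  (range f `<=` range g)%classic ->
  exists h : {rmorphism A -> B}, forall x, g (h x) = f x.
Proof.
move=> fg.
have [h he] := choice (fun x => let: ex_intro2 y _ e := fg (f x) (imageT f x) in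
  ex_intro (fun y => g y = f x) y e).
have [h' h'E] : exists h' : {rmorphism A -> B}, forall x, h' x = h x.
  apply: rmorphism_of.
  - by move=> x y; apply: (fmorph_inj g); rewrite rmorphB !he rmorphB.
  - by apply: (fmorph_inj g); rewrite he !rmorph1.
  - by move=> x y; apply: (fmorph_inj g); rewrite rmorphM !he rmorphM.
by exists h' => x; rewrite h'E he.
Qed.

Lemma liouvillian_algebraic_line (K : diffFieldType) (m : nat) (E : nat -> set K)
    (T : diffFieldType) (f : {rmorphism T -> K}) p (A : 'M[T]_p) (v : 'I_p -> K) :
  diff_morphism f -> range f = E 0%N -> (forall n, n.+1%:R != 0 :> T) ->
  (forall i, (i < m)%N -> quadrature_step (E i) (E i.+1)) ->
  (forall i, E m (v i)) -> (exists i, v i != 0) ->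
  (forall i, der (v i) = \sum_j f (A i j) * v j) ->
  algebraic_line A.
Proof.
move=> df rf ch step Ev [r vr] eqv.
(* Induction down the chain: the member reached is an abstract field [T'] embedded with image
   [E (m - k)], and [A'] is the same matrix read in it. *)
suff main k : (k <= m)%N -> forall (T' : diffFieldType) (f' : {rmorphism T' -> K}) (A' : 'M[T']_p),
    diff_morphism f' -> range f' = E (m - k)%N -> map_mx f' A' = map_mx f A ->
    algebraic_line A'.
  by apply: (main m (leqnn _) T f A df) => //; rewrite subnn.
elim: k => [|k IH] lek T' f' A' df' rf' AA'.
  exists K, f', (fun i => v i / v r), (der (v r) / v r); split=> //; split.
  - by exists r; rewrite divff.
  - move=> i; apply: algebraic_div.
      by have := Ev i; rewrite -{1}(subn0 m) -rf' => -[y _ <-]; apply: algebraic_id.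
    by have := Ev r; rewrite -{1}(subn0 m) -rf' => -[y _ <-]; apply: algebraic_id.
  - move=> i; rewrite (derivation_div (@derD _) (@derM _)) // eqv.
    under [in RHS]eq_bigr do rewrite mulrA.
    rewrite -mulr_suml.
    have -> : \sum_j f' (A' i j) * v j = \sum_j f (A i j) * v j.
      by apply: eq_bigr => j _; move/matrixP/(_ i j): AA'; rewrite !mxE => ->.
    by field.
have ltm : (m - k.+1 < m)%N by lia.
have mk : (m - k.+1).+1 = (m - k)%N by lia.
have [x [dx Ex]] := step _ ltm; rewrite mk in Ex.
have [T2 [f2 [df2 rf2]]] := diff_subfield_type (diff_adjoin_subfield (E (m - k.+1)%N) [set x]%classic).
have [g gE] : exists g : {rmorphism T' -> T2}, forall y, f2 (g y) = f' y.
  apply: range_lift; rewrite rf' rf2 => y Ey.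
  by apply: sub_diff_adjoin; left.
have [x2 _ x2E] : range f2 x by rewrite rf2; apply: sub_diff_adjoin; right.
have lift a : E (m - k.+1)%N a -> exists b, a = f2 (g b).
  by rewrite -rf' => -[b _ <-]; exists b; rewrite gE.
have dg : diff_morphism g.
  by move=> y; apply: (fmorph_inj f2); rewrite gE df' df2 gE.
have chk : forall n, n.+1%:R != 0 :> T'.
  by move=> n; rewrite -(fmorph_eq0 f') rmorph_nat -(rmorph_nat f) fmorph_eq0.
apply: (@liouvillian_step _ _ g x2) => //.
- move=> U dU gU Ux y.
  have dV : diff_subfield (fun z => exists2 y, U y & f2 y = z).
    split.
    - by exists 1; rewrite ?rmorph1 //; apply: (dsf1 dU).
    - by move=> _ _ [y1 U1 <-] [y2 U2 <-]; exists (y1 - y2); rewrite ?rmorphB //; apply: (dsfB dU).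
    - by move=> _ _ [y1 U1 <-] [y2 U2 <-]; exists (y1 / y2); rewrite ?fmorph_div //; apply: (dsf_div dU).
    - by move=> _ [y1 U1 <-]; exists (der y1); rewrite ?df2 //; apply: (dsf_der dU).
  have : range f2 (f2 y) by exists y.
  rewrite rf2 => /(_ _ (conj dV _)) [|y' Uy' /fmorph_inj <- //].
  move=> z [/lift[b ->]|->]; first by exists (g b) => //; apply: gU; exists b.
  by exists x2.
- case: dx => [[q [q0 Eq hq]]|[_ [a Ea dx]]|[a Ea dx]].
  + apply: Or31.
    have [|q' _ q'E] := @poly_lift _ _ f' (fun=> True) q I.
      by move=> i; have := Eq i; rewrite -rf' => -[b _ e]; exists b.
    exists q'; first by rewrite -(map_poly_eq0 f') q'E.
    rewrite -(fmorph_root f2) -map_poly_comp x2E.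
    by rewrite (eq_map_poly (g := f')) ?q'E // => y; rewrite /= gE.
  + apply: Or32; have [b ab] := lift _ Ea; exists (der b) => //.
    by apply: (fmorph_inj f2); rewrite rmorphM df2 x2E dx ab dg df2.
  + apply: Or33; have [b ab] := lift _ Ea; exists b => //.
    by apply: (fmorph_inj f2); rewrite df2 x2E dx ab.
- apply: (IH (ltnW lek) T2 f2) => //; first by rewrite rf2 -Ex.
  by rewrite -AA'; apply/matrixP => i j; rewrite !mxE gE.
Qed.

(** * Local structure at an unramified place *)

Section LocalAnalysis.
Variables (S : numClosedFieldType) (F L : fieldType).
Variables (sg : {rmorphism S -> F}) (f : {rmorphism F -> L}).
Variables (R : set L) (tau : F) (th : L -> L).
Local Notation t := (f tau).
Hypothesis P : log_place sg f R tau th.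
Hypothesis thS : forall s, th (f (sg s)) = 0.
Hypothesis tht : th t = t.

Let V : valring R := lp_valring P.
Let thD := lp_D P.
Let thM := lp_M P.

Definition residue (x : L) (s : S) := maxid R (x - f (sg s)).

Let RS s : R (f (sg s)) := lp_const P s.

Lemma residue_in x s : residue x s -> R x.
Proof.
by move=> h; rewrite -[x](subrK (f (sg s))); apply: (srD V) => //; apply: (maxid_in V).
Qed.

Lemma residue_const s : residue (f (sg s)) s.
Proof. by rewrite /residue subrr; left. Qed.

Lemma residue0 x : residue x 0 <-> maxid R x.
Proof. by rewrite /residue !rmorph0 subr0. Qed.

Lemma residueD x y s s' : residue x s -> residue y s' -> residue (x + y) (s + s').
Proof.
move=> hx hy; rewrite /residue !rmorphD.
have -> : x + y - (f (sg s) + f (sg s')) = (x - f (sg s)) + (y - f (sg s')) by ring.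
exact: (maxidD V).
Qed.

Lemma residueN x s : residue x s -> residue (- x) (- s).
Proof.
move=> hx; rewrite /residue !rmorphN -opprD; exact: (maxidN V).
Qed.

Lemma residueB x y s s' : residue x s -> residue y s' -> residue (x - y) (s - s').
Proof. by move=> hx /residueN; apply: residueD. Qed.

Lemma residueM x y s s' : residue x s -> residue y s' -> residue (x * y) (s * s').
Proof.
move=> hx hy; rewrite /residue !rmorphM.
have -> : x * y - f (sg s) * f (sg s') =
  y * (x - f (sg s)) + f (sg s) * (y - f (sg s')) by ring.
by apply: (maxidD V); apply: (maxidM V) => //; apply: residue_in hy.
Qed.

Lemma residue_sum n (x : 'I_n -> L) (s : 'I_n -> S) :
  (forall i, residue (x i) (s i)) -> residue (\sum_i x i) (\sum_i s i).
Proof.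
move=> h; apply: (big_rec2 residue) => [|i y z _ hy]; last exact: residueD.
by apply/residue0; left.
Qed.

Lemma residue_uniq x s s' : residue x s -> residue x s' -> s = s'.
Proof.
move=> hx hx'; apply/eqP; rewrite -subr_eq0; apply: contraT => ss0.
have : maxid R (f (sg (s - s'))).
  have -> : f (sg (s - s')) = (x - f (sg s')) - (x - f (sg s)).
    by rewrite !rmorphB; ring.
  exact: (maxidB V).
case=> [/eqP|]; first by rewrite !fmorph_eq0 (negPf ss0).
by case; rewrite -!fmorphV; apply: RS.
Qed.

Lemma residueV x s : s != 0 -> residue x s -> residue x^-1 s^-1.
Proof.
move=> s0 h; have [x0 Rx'] : x != 0 /\ R x^-1.
  by apply: maxidPn => /residue0 h0; move: s0; rewrite (residue_uniq h h0) eqxx.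
have fs0 : f (sg s) != 0 by rewrite !fmorph_eq0.
rewrite /residue; have -> : x^-1 - f (sg s^-1) = - (f (sg s^-1) * x^-1) * (x - f (sg s)).
  by rewrite !fmorphV; field; rewrite x0 fs0.
by apply: (maxidM V) => //; apply/(srN V)/(srM V).
Qed.

(** [S] is algebraically closed: if every linear factor of the residue polynomial were a unit at
    [w], so would be their product. *)
Lemma residue_exists_alg w : algebraicOver f w -> R w -> exists s, residue w s.
Proof.
move=> aw Rw; have [g [mg ng]] := lp_residue_root P aw Rw.
have g0 : g != 0 by apply/eqP => g0; apply: ng; rewrite g0 deriv0 ev0; left.
have [rs gE] := closed_field_poly_normal g.
apply: contrapT => nex.
suff : ~ maxid R (ev (f \o sg) w g) by [].
rewrite gE evZ; apply: (maxid_mul_unit V) => //=.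
- apply: (sr_horner V) => // i; rewrite coef_map; exact: RS.
- case=> [/eqP|]; first by rewrite !fmorph_eq0 lead_coef_eq0 (negPf g0).
  by rewrite -!fmorphV; apply; apply: RS.
elim: rs {gE} => [|r rs IH]; first by rewrite big_nil ev1; apply: (maxid1 V).
rewrite big_cons evM; apply: (maxid_mul_unit V) => //.
- by rewrite evD evN evX evC; apply: (srB V) => //; apply: RS.
- by apply: (sr_horner V) => // i; rewrite coef_map; apply: RS.
- by rewrite evD evN evX evC => h; apply: nex; exists r.
Qed.

(** [th] kills constants, so the residue may be subtracted first; the difference lies in the maximal
    ideal, which [th] preserves. *)
Lemma residue_th w s : algebraicOver f w -> residue w s -> maxid R (th w).
Proof.
move=> aw h.
have -> : th w = th (w - f (sg s)) by rewrite (derivationB thD) thS subr0.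
apply: (lp_der P _).2 => //.
by apply: algebraic_sub => //; apply: algebraic_id.
Qed.

Let mt : maxid R t := lp_maxid P.
Let Rt : R t := maxid_in V mt.
Let t0 : t != 0. Proof. by rewrite fmorph_eq0 (lp_tau0 P). Qed.

Lemma nRt_neg n : ~ R (t ^- n.+1).
Proof.
move=> h; apply: (nRtV (lp_tau0 P) mt).
have -> : t^-1 = t ^- n.+1 * t ^+ n by rewrite exprS; field; rewrite t0 expf_neq0.
by apply: (srM V) => //; apply: (srX V).
Qed.

(** The residue of the logarithmic derivative is the value k/e of [w] (that of [t] being 1), because
    the unit [u] contributes residue zero. *)
Lemma th_log w : algebraicOver f w -> w != 0 -> exists e (k : int) (u : L),
  [/\ (0 < e)%N, w ^+ e = t ^ k * u, R u, R u^-1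
    & residue (th w / w) (k%:~R / e%:R)].
Proof.
move=> aw w0; have [e [k [u [e0 we Ru Ru']]]] := lp_fraction_value P aw w0.
exists e, k, u; split=> //.
have au : algebraicOver f u.
  have -> : u = f (tau ^ (- k)) * w ^+ e.
    by rewrite we fmorphXz mulrA -expfzDr // addNr expr0z mul1r.
  apply: algebraic_mul; first exact: algebraic_id.
  elim: e {e0 we} => [|e IH]; first exact: algebraic1.
  by rewrite exprS; apply: algebraic_mul.
have u0 : u != 0.
  by apply: contraNneq w0 => u0; move/eqP: we; rewrite u0 mulr0 expf_eq0 e0.
have [s us] := residue_exists_alg au Ru.
have mthu := residue_th au us.
have eS n : (0 < n)%N -> n%:R != 0 :> L.
  case: n => // n _; rewrite -(rmorph_nat f) -(rmorph_nat sg) !fmorph_eq0.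
  exact: (lp_char0 P).
have tht1 : th t = 1 * t by rewrite mul1r.
have kE : th w / w = (k%:~R + th u / u) / e%:R.
  case: k we => k we.
    rewrite (log_derivative thM tht1 e0 w0 u0 we (eS _ e0)) mulr1.
    rewrite -pmulrn; move: (e%:R) (eS _ e0) => N N0.
    by field; rewrite N0 u0 w0 ?oner_neq0.
  (* [log_derivative] takes a natural exponent, so a negative value is treated through [w^-1]. *)
  have we' : w ^- e = t ^+ k.+1 * u^-1.
    by rewrite we -[t ^ _]/(t ^- k.+1) invfM invrK.
  rewrite -exprVn in we'.
  have := log_derivative thM tht1 e0 (invr_neq0 w0) (invr_neq0 u0) we' (eS _ e0).
  rewrite !(derivationV thD thM) mulr1 => E.
  have -> : th w = - (- (th w / w ^+ 2)) * w ^+ 2 by field.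
  rewrite E NegzE rmorphN /= -pmulrn.
  move: (e%:R) (eS _ e0) => N N0; move: (k.+1%:R) => K.
  by field; rewrite N0 u0 w0 ?oner_neq0.
rewrite kE; apply: residueM.
  rewrite -[X in residue _ X]addr0; apply: residueD.
    by have := residue_const k%:~R; rewrite !rmorph_int.
  by apply/residue0; rewrite mulrC; apply: (maxidM V).
by have := residue_const e%:R^-1; rewrite !fmorphV !rmorph_nat.
Qed.

Section Approximation.
Variables (p : nat) (BB : 'M[F]_p) (B0 : 'M[S]_p) (v : 'I_p -> L) (u : L) (rho : 'I_p).
Hypothesis BB0 : forall i j, residue (f (BB i j)) (B0 i j).
Hypothesis valg : forall i, algebraicOver f (v i).
Hypothesis Rv : forall i, R (v i).
Hypothesis vrho : v rho = 1.
Hypothesis eqv : forall i, th (v i) = \sum_j f (BB i j) * v j - u * v i.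
Hypothesis thF : forall x, exists y, th (f x) = f y.
Hypothesis nonres : forall (x y : 'cV[S]_p) (l m : S) (k : int) (e : nat),
  x != 0 -> y != 0 -> B0 *m x = l *: x -> B0 *m y = m *: y -> (0 < e)%N ->
  l - m = k%:~R / e%:R -> exists n : int, l - m = n%:~R.

Local Notation evt q := (ev (f \o sg) t q).

Let uE : u = \sum_j f (BB rho j) * v j.
Proof.
have := eqv rho; rewrite vrho (derivation1 thM) mulr1 => /esym/eqP.
by rewrite subr_eq0 => /eqP.
Qed.

Let evtF q : evt q = f (ev sg tau q).
Proof. by rewrite /ev -horner_map /= -map_poly_comp. Qed.

(* The terms of the expansion of v in powers of t: a term of fractional
   exponent would produce two eigenvalues of B0 differing by a fraction. *)
Lemma approximation N : exists q : 'I_p -> {poly S},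
  forall i, R ((v i - evt (q i)) / t ^+ N).
Proof.
elim: N => [|N [q Rq]].
  by exists (fun=> 0) => i; rewrite ev0 subr0 expr0 divr1.
have tN0 : t ^+ N != 0 by rewrite expf_neq0.
pose w i := (v i - evt (q i)) / t ^+ N.
have alg_evt q' : algebraicOver f (evt q') by rewrite evtF; apply: algebraic_id.
have alg_t n : algebraicOver f (t ^+ n) by rewrite -rmorphXn; apply: algebraic_id.
have walg i : algebraicOver f (w i).
  by apply: algebraic_div => //; apply: algebraic_sub.
have [wb wbE] := choice (fun i => residue_exists_alg (walg i) (Rq i)).
pose q' i := q i + (wb i)%:P * 'X^N.
pose h i := w i - f (sg (wb i)).
have hE i : v i = evt (q' i) + t ^+ N * h i.
  by rewrite /q' evD evM evC evXn /h /w /=; field.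
(* If every remainder is divisible by [t], the order [N.+1] is reached; otherwise the largest
   remainder [eta] has value strictly between 0 and 1. *)
have [Rht|] := pselect (forall i, R (h i / t)).
  exists q' => i; rewrite hE addrAC subrr add0r exprSr invfM mulrA [_ * h i]mulrC.
  by rewrite mulfK.
move=> /existsNP[i0 ni0].
have mh i : maxid R (h i) by apply: wbE.
have [|s [eta0 hs]] := vr_max V (v := h).
  by exists i0; apply/eqP => e; apply: ni0; rewrite e mul0r; apply: (sr0 V).
set eta := h s in eta0 hs.
have nst : ~ R (eta / t).
  move=> hst; apply: ni0.
  have -> : h i0 / t = (h i0 / eta) * (eta / t) by field; rewrite t0.
  exact: (srM V).
have mte : maxid R (t / eta) by have := maxidV nst; rewrite invf_div.
have meta : maxid R eta by apply: mh.
have halg i : algebraicOver f (h i).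
  by apply: algebraic_sub => //; apply: algebraic_id.
pose T := t ^+ N * eta.
have T0 : T != 0 by rewrite mulf_neq0.
have RT : R T by apply: (srM V); [apply: (srX V) | apply: (maxid_in V)].
have mT : maxid R T by apply: (maxidM V) => //; apply: (srX V).
pose y i := h i / eta.
have Ry i : R (y i) by apply: hs.
have yalg i : algebraicOver f (y i) by apply: algebraic_div; apply: halg.
have vE i : v i = evt (q' i) + T * y i.
  by rewrite hE /T /y -mulrA [eta * _]mulrC (divfK eta0).
(* An element of F has integral value, unlike T. *)
have fracT x : R (f x / T) -> maxid R (f x / T).
  move=> Rx; have [x0|x0] := eqVneq x 0; first by left; rewrite x0 rmorph0 mul0r.
  apply: contrapT => nm; have [xT0 RxT] := maxidPn nm.
  have [j [ep [s0 [xE s00 mep]]]] := lp_Fval P x0.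
  have [Rep RepV] := unit_of_residue V RS s00 mep.
  pose U := f x / T.
  have fep0 : f ep != 0.
    by apply: contraNneq x0; rewrite xE => /eqP; rewrite fmorph_eq0 => /eqP ->; rewrite mulr0.
  have fxE : f x = t ^ j * f ep by rewrite xE rmorphM fmorphXz.
  have eE : eta = t ^ (j - N%:Z) * (f ep / U).
    rewrite expfzDr // -exprnN /U fxE /T; move: (expfz_neq0 j t0) => tj.
    by field; rewrite tj fep0 tN0 eta0.
  have RU : R (f ep / U) by apply: (srM V).
  have RU' : R (f ep / U)^-1 by rewrite invf_div; apply: (srM V).
  case: (intP (j - N%:Z)) eE => [|n|n] eE.
  - by case: meta => [/eqP|]; rewrite ?(negPf eta0) // eE expr0z mul1r.
  - case: mte => [/eqP|]; first by rewrite mulf_eq0 invr_eq0 (negPf t0) (negPf eta0).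
    case; rewrite invf_div eE -exprnP exprS -mulrA mulrAC mulfV // mul1r.
    by apply: (srM V) => //; apply: (srX V).
  - case: meta => [/eqP|]; rewrite ?(negPf eta0) // eE -exprnN => -[].
    by rewrite invfM invrK; apply: (srM V) => //; apply: (srX V).
have [e [k [u0 [e0 etae Ru0 Ru0' thetaE]]]] := th_log (halg s) eta0.
rewrite -/eta in etae thetaE.
have [k' kE ltke] : exists2 k' : nat, k = k'.+1 & (k'.+1 < e)%N.
  have nRe : ~ R (eta ^- e).
    have : maxid R (eta ^+ e).
      by rewrite -(prednK e0) exprSr; apply: (maxidM V) => //; apply/(srX V)/(maxid_in V).
    by case=> [/eqP|//]; rewrite expf_eq0 e0 (negPf eta0).
  case: k etae thetaE => [[|k]|k] etae thetaE.
  - by case: nRe; rewrite etae expr0z mul1r.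
  - exists k => //; rewrite ltnNge; apply/negP => le.
    have : maxid R ((t / eta) ^+ e).
      by rewrite -(prednK e0) exprSr; apply: (maxidM V) => //; apply/(srX V)/(maxid_in V).
    case=> [/eqP|].
      by rewrite expf_eq0 e0 mulf_eq0 invr_eq0 (negPf eta0) (negPf t0).
    case; rewrite -exprVn invf_div expr_div_n etae -exprnP -(subnK le) exprD.
    rewrite mulrAC mulfK ?expf_neq0 //.
    by apply: (srM V) => //; apply: (srX V).
  - case: nRe; rewrite etae -[t ^ _]/(t ^- k.+1) invfM invrK.
    by apply: (srM V) => //; apply: (srX V).
(* The value of [T]; it is not an integer because 0 < k < e. *)
pose gam : S := N%:R + k%:~R / e%:R.
have gam0 : gam != 0.
  rewrite /gam kE -pmulrn gt_eqF // ltr_wpDl ?ler0n // divr_gt0 ?ltr0n //.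
have ngam : ~ exists n : int, gam = n%:~R.
  case=> n; rewrite /gam kE -pmulrn => hn.
  have eS : e%:R != 0 :> S by rewrite pnatr_eq0 -lt0n.
  have : (k'.+1%:R : S) = ((n - N%:Z) * e%:Z)%:~R.
    rewrite intrM intrB -!pmulrn -hn addrAC subrr add0r divfK //.
  rewrite pmulrn => /eqP; rewrite eqr_int => /eqP hn'.
  have : (e %| k'.+1)%N.
    have : (e%:Z %| k'.+1%:Z)%Z by rewrite hn' dvdz_mull.
    by [].
  by move=> /dvdn_leq -/(_ isT); rewrite leqNgt ltke.
pose g := th T / T.
have gE : residue g gam.
  have -> : g = N%:R + th eta / eta.
    rewrite /g /T thM; have -> : th (t ^+ N) = N%:R * t ^+ N.
      case: (N) => [|n]; first by rewrite expr0 (derivation1 thM) mul0r.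
      by rewrite (derivationX thM) tht exprSr mulrA.
    by field; rewrite tN0 eta0.
  apply: residueD => //.
  by have := residue_const N%:R; rewrite !rmorph_nat.
have [av avE] := choice (fun i => residue_exists_alg (valg i) (Rv i)).
have [bv bvE] := choice (fun i => residue_exists_alg (yalg i) (Ry i)).
pose Q i := evt (q' i).
have QE i : residue (Q i) (av i).
  have -> : Q i = v i - T * y i by rewrite vE addrK.
  rewrite -[av i]subr0; apply: residueB => //; apply/residue0.
  by rewrite mulrC; apply: (maxidM V).
pose ua := \sum_j B0 rho j * av j; pose ub := \sum_j B0 rho j * bv j.
have ua_E : residue u ua by rewrite uE; apply: residue_sum => j; apply: residueM.
have eigA i : \sum_j B0 i j * av j = ua * av i.
  have h1 : residue (th (v i)) (\sum_j B0 i j * av j - ua * av i).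
    rewrite eqv; apply: residueB; last exact: residueM.
    by apply: residue_sum => j; apply: residueM.
  have /residue0 h2 := residue_th (valg i) (avE i).
  by apply/eqP; rewrite -subr_eq0 (residue_uniq h1 h2).
pose qF i := ev sg tau (q' i).
have QF i : Q i = f (qF i) by rewrite /Q evtF.
pose uQ := \sum_j f (BB rho j) * Q j; pose uy := \sum_j f (BB rho j) * y j.
have uQE : residue uQ ua by apply: residue_sum => j; apply: residueM.
have uyE : residue uy ub by apply: residue_sum => j; apply: residueM.
pose Sy i := \sum_j f (BB i j) * y j.
(* The terms of the Riccati equation for [v = Q + T * y] that carry the factor [T], divided by
   [T]. *)
pose Z i := th (y i) + g * y i - Sy i + uQ * y i + uy * Q i + T * (uy * y i).
have ZE i : residue (Z i) (gam * bv i - \sum_j B0 i j * bv j + ua * bv i + ub * av i).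
  have -> : gam * bv i - \sum_j B0 i j * bv j + ua * bv i + ub * av i =
     0 + gam * bv i - \sum_j B0 i j * bv j + ua * bv i + ub * av i + 0 by ring.
  apply: residueD; last first.
    apply/residue0; rewrite mulrC; apply: (maxidM V) => //.
    by apply: (srM V) => //; apply: residue_in uyE.
  apply: residueD; last exact: residueM.
  apply: residueD; last exact: residueM.
  apply: residueB; last by apply: residue_sum => j; apply: residueM.
  apply: residueD; last exact: residueM.
  by apply/residue0; apply: residue_th (yalg i) (bvE i).
(* [T * Z i] is the defect of the truncated vector [Q] in the Riccati equation, hence an element of
   [F]. Its value, if it is nonzero, is an integer while that of [T] is not, so [Z i] is not a
   unit. *)
have mZ i : maxid R (Z i).
  have [thq thqE] := thF (qF i).
  pose x := \sum_j BB i j * qF j - (\sum_j BB rho j * qF j) * qF i - thq.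
  suff xE : f x / T = Z i by rewrite -xE; apply: fracT; rewrite xE; apply: residue_in (ZE i).
  have fsum k1 : f (\sum_j BB k1 j * qF j) = \sum_j f (BB k1 j) * Q j.
    by rewrite rmorph_sum; apply: eq_bigr => j _; rewrite rmorphM QF.
  have fxE : f x = \sum_j f (BB i j) * Q j - uQ * Q i - th (Q i).
    by rewrite !rmorphB rmorphM !fsum -QF -thqE -QF.
  have splitv k1 : \sum_j f (BB k1 j) * v j = \sum_j f (BB k1 j) * Q j + T * \sum_j f (BB k1 j) * y j.
    rewrite mulr_sumr -big_split /=; apply: eq_bigr => j _; rewrite vE /Q; ring.
  have thT : th T = g * T by rewrite /g divfK.
  have := eqv i; rewrite uE !splitv -/uQ -/uy -/(Sy i) {1 2}vE -/(Q i) thD thM thT => E.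
  have -> : f x = T * Z i.
    rewrite fxE; have -> : \sum_j f (BB i j) * Q j =
       th (Q i) + (g * T * y i + T * th (y i)) - T * Sy i + (uQ + T * uy) * (Q i + T * y i).
      by rewrite E; ring.
    by rewrite /Z; ring.
  by rewrite mulrAC divff ?mul1r.
have eigB i : \sum_j B0 i j * bv j = gam * bv i + ua * bv i + ub * av i.
  have /residue0 h2 := mZ i; have := residue_uniq (ZE i) h2.
  by move=> hz; apply/eqP; rewrite -subr_eq0 -oppr_eq0; apply/eqP; rewrite -[RHS]hz; ring.
have arho : av rho = 1.
  apply: (residue_uniq (avE rho)); rewrite vrho.
  by have := residue_const 1; rewrite !rmorph1.
have brho : bv rho = 0.
  apply: (residue_uniq (bvE rho)); apply/residue0.
  have yr : y rho = f (1 - qF rho) / T.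
    have := vE rho; rewrite vrho -/(Q rho) => e1.
    by rewrite rmorphB rmorph1 -QF e1 addrAC subrr add0r mulrAC divff ?mul1r.
  by rewrite yr; apply: fracT; rewrite -yr.
have bs : bv s = 1.
  apply: (residue_uniq (bvE s)); rewrite /y -/eta divff //.
  by have := residue_const 1; rewrite !rmorph1.
pose xa : 'cV[S]_p := \col_i av i.
(* Modulo [xa], the vector [bv] is an eigenvector for [gam + ua]; the added multiple of [av] absorbs
   the remaining term [ub * av]. *)
pose xb : 'cV[S]_p := \col_i (bv i + ub / gam * av i).
case: ngam; have [||||||n ne] := @nonres xb xa (gam + ua) ua (N%:Z * e%:Z + k) e.
- apply/eqP => /matrixP xb0; have := xb0 rho 0; rewrite !mxE arho brho add0r mulr1 => ub0.
  have := xb0 s 0; rewrite !mxE ub0 mul0r addr0 bs => /eqP; exact/negP/oner_neq0.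
- apply/eqP => /matrixP /(_ rho 0); rewrite !mxE arho => /eqP; exact/negP/oner_neq0.
- apply/matrixP => i j; rewrite !mxE.
  under eq_bigr do rewrite mxE mulrDr mulrCA.
  by rewrite big_split /= -mulr_sumr eigA eigB; field.
- by apply/matrixP => i j; rewrite !mxE; under eq_bigr do rewrite mxE.
- exact: e0.
- rewrite addrK /gam intrD intrM -!pmulrn; field.
  by rewrite pnatr_eq0 -lt0n.
by exists n; rewrite -ne addrK.
Qed.

End Approximation.
End LocalAnalysis.

(** * Power series expansions at an unramified place *)

Section Approximable.
Variables (S : numClosedFieldType) (F L : fieldType).
Variables (sg : {rmorphism S -> F}) (f : {rmorphism F -> L}).
Variables (R : set L) (tau : F) (th : L -> L).
Local Notation t := (f tau).
Hypothesis P : log_place sg f R tau th.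
Hypothesis thS : forall s, th (f (sg s)) = 0.
Hypothesis tht : th t = t.

Let V : valring R := lp_valring P.
Let RS s : R (f (sg s)) := lp_const P s.
Let mt : maxid R t := lp_maxid P.
Let Rt : R t := maxid_in V mt.
Let t0 : t != 0. Proof. by rewrite fmorph_eq0 (lp_tau0 P). Qed.
Local Notation evt q := (ev (f \o sg) t q).

(* g belongs to the completion of S[tau] at tau = 0. *)
Definition approximable (g : L) : Prop :=
  algebraicOver f g /\ forall N, exists q : {poly S}, R ((g - evt q) / t ^+ N).

Lemma evtF q : evt q = f (ev sg tau q).
Proof. by rewrite /ev -horner_map /= -map_poly_comp. Qed.

Lemma Revt q : R (evt q).
Proof. by apply: (sr_horner V) => // i; rewrite coef_map; apply: RS. Qed.

Lemma approximable_in g : approximable g -> R g.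
Proof.
move=> [_ /(_ 0%N)[q]]; rewrite expr0 divr1 => h.
by rewrite -[g](subrK (evt q)); apply: (srD V) => //; apply: Revt.
Qed.

Lemma approximable_ev q : approximable (evt q).
Proof.
split; first by rewrite evtF; apply: algebraic_id.
by move=> N; exists q; rewrite subrr mul0r; apply: (sr0 V).
Qed.

Lemma approximableM g h : approximable g -> approximable h -> approximable (g * h).
Proof.
move=> Ug Uh; have Rh := approximable_in Uh.
case: Ug Uh => ag Ug [ah Uh]; split; first exact: algebraic_mul.
move=> N; have [q Rq] := Ug N; have [r Rr] := Uh N; exists (q * r).
have -> : (g * h - evt (q * r)) / t ^+ N =
    (g - evt q) / t ^+ N * h + evt q * ((h - evt r) / t ^+ N).
  by rewrite evM; ring.
by apply: (srD V); apply: (srM V) => //; apply: Revt.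
Qed.

Lemma residue_evt q : residue sg f R (evt q) q.[0].
Proof.
have : root (q - q.[0]%:P) 0 by rewrite rootE !hornerE subrr.
rewrite /residue -[f (sg _)]/((f \o sg) q.[0]) -(evC (f \o sg) t q.[0]).
rewrite -evN -evD => /factor_theorem[r ->]; rewrite subr0 evM evX.
by apply: (maxidM V) => //; apply: Revt.
Qed.

Lemma evt_unit q : q.[0] != 0 -> ~ maxid R (evt q).
Proof.
move=> q0 /(residue0 sg f R (evt q)).2 h0.
by move: q0; rewrite (residue_uniq P (residue_evt q) h0) eqxx.
Qed.

Lemma evt_val q : q != 0 -> exists (j : nat) (r : {poly S}),
  q = r * 'X^j /\ ~ maxid R (evt r).
Proof.
move=> q0; have [j [r]] := multiplicity_XsubC q 0.
rewrite q0 subr0 /= => r0 ->; exists j, r; split=> //.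
exact: evt_unit.
Qed.

Lemma evt_divX q j : R (evt q / t ^+ j) -> exists q', q = q' * 'X^j.
Proof.
move=> h; have [->|q0] := eqVneq q 0; first by exists 0; rewrite mul0r.
have [m [r [qE nr]]] := evt_val q0; have [er0 Rr'] := maxidPn nr.
have [le|lt] := leqP j m.
  by exists (r * 'X^(m - j)); rewrite qE -mulrA -exprD subnK.
case: (nRt_neg P (n := (j - m).-1)).
have -> : t ^- (j - m).-1.+1 = (evt q / t ^+ j) * (evt r)^-1.
  rewrite prednK ?subn_gt0 // qE evM evXn -{2}(subnK (ltnW lt)) exprD.
  by field; rewrite er0 !expf_neq0.
exact: (srM V).
Qed.

Lemma approximable_divt g j : approximable g -> R (g / t ^+ j) ->
  approximable (g / t ^+ j).
Proof.
move=> [ag Ug] Rg; split.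
  by apply: algebraic_div => //; rewrite -rmorphXn; apply: algebraic_id.
move=> N; have [q Rq] := Ug (j + N)%N.
have [q' qE] : exists q', q = q' * 'X^j.
  apply: evt_divX; have -> : evt q / t ^+ j = g / t ^+ j - (g - evt q) / t ^+ (j + N) * t ^+ N.
    by rewrite exprD; field; rewrite !expf_neq0.
  by apply: (srB V) => //; apply: (srM V) => //; apply: (srX V).
exists q'; have -> : (g / t ^+ j - evt q') / t ^+ N = (g - evt q) / t ^+ (j + N).
  by rewrite qE evM evXn exprD; field; rewrite !expf_neq0.
by [].
Qed.

(** An approximation [q] of the unit [g] is prime to ['X^N]; its Bezout inverse modulo ['X^N]
    approximates [g^-1]. *)
Lemma approximable_inv g : approximable g -> g != 0 -> R g^-1 -> approximable g^-1.
Proof.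
move=> Ug g0 Rg'; have Rg := approximable_in Ug; case: Ug => ag Ug.
split; first exact: algebraic_inv.
move=> N; have [q Rq] := Ug N.+1.
have q0 : coprimep q 'X^N.
  apply: coprimep_expr; rewrite coprimepX -[root _ _]negbK; apply/negP => /negbNE qr.
  have [q' qE] : exists q', q = q' * 'X.
    by have /factor_theorem[q' ->] := qr; exists q'; rewrite subr0.
  have : maxid R g.
    have -> : g = t * (evt q' + (g - evt q) / t ^+ N.+1 * t ^+ N).
      by rewrite qE evM evX exprS; field; rewrite t0 expf_neq0.
    rewrite mulrC; apply: (maxidM V) => //; apply: (srD V); first exact: Revt.
    by apply: (srM V) => //; apply: (srX V).
  by case=> [/eqP|//]; rewrite (negPf g0).
have /Bezout_eq1_coprimepP[[a b] /= ab] := q0.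
exists a; have -> : (g^-1 - evt a) / t ^+ N =
    g^-1 * (evt b - evt a * ((g - evt q) / t ^+ N.+1 * t)).
  have -> : evt b = (1 - evt a * evt q) / t ^+ N.
    by rewrite -(ev1 (f \o sg) t) -ab evD !evM evXn addrC addKr mulfK ?expf_neq0.
  by rewrite exprSr; field; rewrite g0 t0 expf_neq0.
apply: (srM V) => //; apply: (srB V); first exact: Revt.
by apply: (srM V); [apply: Revt | apply: (srM V)].
Qed.

(** The nonzero [h] has a finite value, so a good approximation of it is nonzero and shows that [h]
    is a power [t ^+ j] times a unit, which can be inverted. *)
Lemma approximable_div g h : approximable g -> approximable h -> h != 0 ->
  R (g / h) -> approximable (g / h).
Proof.
move=> Ug Uh h0 Rgh; have Rh := approximable_in Uh.
have [e [k [u [e0 he Ru Ru']]]] := lp_fraction_value P Uh.1 h0.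
have [N nN] : exists N, ~ R (h / t ^+ N).
  exists `|k|%N.+1 => hN.
  have u0 : u != 0.
    by apply: contraNneq h0 => u0; move/eqP: he; rewrite u0 mulr0 expf_eq0 e0.
  have : R (t ^ k * t ^- (`|k|%N.+1 * e)).
    have -> : t ^ k * t ^- (`|k|%N.+1 * e) = (h / t ^+ `|k|%N.+1) ^+ e * u^-1.
      by rewrite expr_div_n he exprM; field; rewrite u0 !expf_neq0.
    by apply: (srM V) => //; apply: (srX V).
  rewrite exprnN -expfzDr //.
  have [n ->] : exists n : nat, k + - (`|k|%N.+1 * e)%N%:Z = - (n.+1)%:Z.
    have : (`|k|%N.+1 <= `|k|%N.+1 * e)%N by rewrite leq_pmulr.
    move: (`|k|%N.+1 * e)%N => M le.
    by exists (`|M%:Z - k|%N.-1); lia.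
  by rewrite -exprnN; apply: (nRt_neg P).
have [q Rq] := Uh.2 N.
have q0 : q != 0.
  by apply/eqP => q0; apply: nN; move: Rq; rewrite q0 ev0 subr0.
have [j [r [qE nr]]] := evt_val q0; have Rr := Revt r.
have ltj : (j < N)%N.
  rewrite ltnNge; apply/negP => le; apply: nN.
  have -> : h / t ^+ N = (h - evt q) / t ^+ N + evt r * t ^+ (j - N).
    have tj : t ^+ j = t ^+ (j - N) * t ^+ N by rewrite -exprD subnK.
    by rewrite qE evM evXn tj; field; rewrite expf_neq0.
  by apply: (srD V) => //; apply: (srM V) => //; apply: (srX V).
pose h1 := h / t ^+ j.
have mh : maxid R (h1 - evt r).
  have -> : h1 - evt r = (h - evt q) / t ^+ N * t ^+ (N - j).-1 * t.
    rewrite -mulrA -exprSr prednK ?subn_gt0 // /h1 qE evM evXn.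
    have tN : t ^+ N = t ^+ (N - j) * t ^+ j by rewrite -exprD subnK // ltnW.
    by rewrite tN; field; rewrite !expf_neq0.
  by apply: (maxidM V) => //; apply: (srM V) => //; apply: (srX V).
have Rh1 : R h1.
  by rewrite -[h1](subrK (evt r)); apply: (srD V) => //; apply: (maxid_in V).
have h10 : h1 != 0 by rewrite mulf_neq0 // invr_eq0 expf_neq0.
have Rh1' : R h1^-1.
  apply: contrapT => nR; have mh1 : maxid R h1 by right.
  by apply: nr; rewrite -[evt r](subKr h1); apply: (maxidB V).
have Uh1 : approximable h1 by apply: approximable_divt.
have Rg1 : R (g / t ^+ j).
  have -> : g / t ^+ j = g / h * h1 by rewrite /h1; field; rewrite h0 expf_neq0.
  exact: (srM V).
have -> : g / h = g / t ^+ j * h1^-1 by rewrite /h1; field; rewrite h0 expf_neq0.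
by apply: approximableM; [apply: approximable_divt | apply: approximable_inv].
Qed.

End Approximable.

(** * Places over the projective line *)

Lemma chevalley_transcendental (E L : fieldType) (s : {rmorphism E -> L}) (x : L) :
  ~ algebraicOver s x ->
  exists R : set L, [/\ valring R, forall c, R (s c) & ~ R x].
Proof.
move=> nalg.
have x0 : x != 0 by apply/eqP => x0; apply: nalg; rewrite x0; apply: algebraic0.
have sA : subring (range s).
  split; first by exists 1; rewrite ?rmorph1.
    by move=> _ _ [y _ <-] [z _ <-]; exists (y - z); rewrite ?rmorphB.
  by move=> _ _ [y _ <-] [z _ <-]; exists (y * z); rewrite ?rmorphM.
have nA : ~ sr_adjoin (range s) x^-1 x.
  move=> [q0 hq0]; have [|q _ <-] := @poly_lift _ _ s (fun=> True) q0 I.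
    by move=> i; have [y _ ye] := hq0 i; exists y.
  rewrite -/(ev s x^-1 q) => e; apply: nalg; rewrite -[x]invrK.
  apply: algebraic_inv; exists ('X * q - 1); last first.
    by apply/rootP; rewrite -/(ev s x^-1 _) evD evN evM evX ev1 -e mulVf // subrr.
  apply/eqP => /(congr1 (fun q : {poly E} => q`_0)).
  by rewrite coefB coefXM coefC coef0 sub0r => /eqP; rewrite oppr_eq0 oner_eq0.
have [R [V AR nR]] := chevalley (sr_adjoin_subring sA _) (sr_adjoin_gen sA _) nA.
by exists R; split=> // c; apply/AR/sub_sr_adjoin => //; exists c.
Qed.

Lemma closed_algebraic (k : closedFieldType) (L : fieldType) (s : {rmorphism k -> L}) x :
  algebraicOver s x -> exists c, x = s c.
Proof.
move=> [q q0 /rootP]; have [rs ->] := closed_field_poly_normal q.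
rewrite -/(ev s x _) evZ => /eqP; rewrite mulf_eq0 fmorph_eq0 lead_coef_eq0 (negPf q0) /=.
elim: rs => [|r rs IH]; first by rewrite big_nil ev1 oner_eq0.
rewrite big_cons evM mulf_eq0 => /orP[|//].
by rewrite evD evN evX evC subr_eq0 => /eqP ->; exists r.
Qed.

Lemma scale_denominator (F : fieldType) (x y c n : F) (q : {poly F}) : c * y = n ->
  (x * y) *: (q * 'X + c%:P) = (x *: q) * y%:P * 'X + (x * n)%:P.
Proof.
move=> <-; rewrite -!mul_polyC !polyCM; ring.
Qed.

Lemma clear_denominators (k : fieldType) (q : {poly ratfun k}) :
  exists (D : {poly k}) (C : {poly {poly k}}),
    D != 0 /\ D%:F *: q = map_poly (@tofrac _) C.
Proof.
elim/poly_ind: q => [|q c [D [C [D0 e]]]].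
  by exists 1, 0; rewrite oner_neq0 scaler0 rmorph0.
have := denom_ratioP (repr c); have := ratfun_repr c.
move: (\n_(repr c)) (\d_(repr c)) => n d cE d0.
have d0F : d%:F != 0 :> ratfun k by rewrite tofrac_eq0.
exists (D * d), (C * d%:P * 'X + (D * n)%:P).
split; first by rewrite mulf_neq0.
have cd : c * d%:F = n%:F by rewrite cE divfK.
rewrite tofracM (scale_denominator _ _ cd).
by rewrite e rmorphD !(rmorphM (map_poly _)) /= !map_polyC map_polyX /= tofracM.
Qed.

Section Places.
Variables (k : numClosedFieldType) (L : diffFieldType) (iota : {rmorphism ratfun k -> L}).
Hypothesis di : diff_morphism iota.

Definition ratfunC : {rmorphism k -> ratfun k} := (@tofrac _) \o polyC.
Local Notation sg := ratfunC.
Local Notation z := ('X%:F : ratfun k).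

Lemma der_const c : der (iota (sg c)) = 0.
Proof. by rewrite -di /= der_poly derivC tofrac0 rmorph0. Qed.

Lemma der_z : der (iota z) = 1.
Proof. by rewrite -di der_poly derivX tofrac1 rmorph1. Qed.

Lemma z_neq0 : z != 0. Proof. by rewrite tofrac_eq0 polyX_eq0. Qed.

Lemma poly_ev (q : {poly k}) : q%:F = ev sg z q.
Proof.
rewrite (ev_sum _ _ (leqnn _)) -{1}(coefK q) poly_def rmorph_sum; apply: eq_bigr => i _.
by rewrite -mul_polyC rmorphM rmorphXn.
Qed.

Let charS n : n.+1%:R != 0 :> k. Proof. by rewrite pnatr_eq0. Qed.

Definition finite_center (c : k) : ratfun k := z - sg c.
(** The derivation [t * d/dt] for the local parameter [t = z - c]; the next definition is the same
    for [t = 1/z]. *)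
Definition finite_der (c : k) (x : L) : L := iota (finite_center c) * der x.
Definition infinite_der (x : L) : L := - iota z * der x.

Lemma finite_derD c x y : finite_der c (x + y) = finite_der c x + finite_der c y.
Proof. by rewrite /finite_der derD mulrDr. Qed.

Lemma finite_derM c x y :
  finite_der c (x * y) = finite_der c x * y + x * finite_der c y.
Proof. by rewrite /finite_der derM; ring. Qed.

Lemma infinite_derD x y : infinite_der (x + y) = infinite_der x + infinite_der y.
Proof. by rewrite /infinite_der derD mulrDr. Qed.

Lemma infinite_derM x y :
  infinite_der (x * y) = infinite_der x * y + x * infinite_der y.
Proof. by rewrite /infinite_der derM; ring. Qed.

Lemma finite_der_const c s : finite_der c (iota (sg s)) = 0.
Proof. by rewrite /finite_der der_const mulr0. Qed.

Lemma infinite_der_const s : infinite_der (iota (sg s)) = 0.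
Proof. by rewrite /infinite_der der_const mulr0. Qed.

Lemma finite_der_center c : finite_der c (iota (finite_center c)) = iota (finite_center c).
Proof.
by rewrite /finite_der {2}/finite_center rmorphB (derivationB (@derD L)) der_z der_const subr0 mulr1.
Qed.

Lemma infinite_der_center : infinite_der (iota z^-1) = iota z^-1.
Proof.
rewrite /infinite_der fmorphV (derivationV (@derD L) (@derM L)) der_z.
by field; rewrite fmorph_eq0 z_neq0.
Qed.

Section Place.
Variables (R : set L) (V : valring R).
Hypothesis Rk : forall c, R (iota (sg c)).

Lemma finite_center_neq0 c : finite_center c != 0.
Proof. by rewrite /finite_center /= -tofracB tofrac_eq0 polyXsubC_eq0. Qed.

Lemma poly_ev_finite c (q : {poly k}) :
  q%:F = ev sg (finite_center c) (q \Po ('X + c%:P)).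
Proof. by rewrite ev_comp evD evX evC /finite_center subrK [LHS]poly_ev. Qed.

Lemma finite_log_place c : maxid R (iota (finite_center c)) ->
  log_place sg iota R (finite_center c) (finite_der c).
Proof.
move=> mc; apply: (@log_place_intro _ _ _ sg iota R _ _ 1) => //.
- exact: finite_center_neq0.
- exact: finite_derD.
- exact: finite_derM.
- by move=> s; rewrite finite_der_const; apply: (sr0 V).
- exact: (sr1 V).
- by rewrite mul1r finite_der_center.
move=> x x0; exists 0, (\n_(repr x) \Po ('X + c%:P)), (\d_(repr x) \Po ('X + c%:P)).
have nz (q : {poly k}) : q != 0 -> q \Po ('X + c%:P) != 0.
  by apply: contraNneq => e; rewrite -tofrac_eq0 (poly_ev_finite c) e ev0.
have n0 : \n_(repr x) != 0.
  by apply: contraNneq x0 => n0; rewrite (ratfun_repr x) n0 rmorph0 mul0r.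
rewrite -!poly_ev_finite expr0z mul1r -ratfun_repr; split=> //; apply: nz => //.
exact: denom_ratioP.
Qed.

Lemma poly_ev_infinity (q : {poly k}) : q != 0 ->
  exists (d : nat) (r : {poly k}),
    [/\ (d < size q)%N, r.[0] != 0 & q%:F = z ^+ d * ev sg z^-1 r].
Proof.
move=> q0; have [d sq] : exists d, size q = d.+1.
  by exists (size q).-1; rewrite prednK // size_poly_gt0.
exists d, (\poly_(i < d.+1) q`_(d - i)); split; first by rewrite sq.
  by rewrite horner_coef0 coef_poly subn0; have := q0; rewrite -lead_coef_eq0 /lead_coef sq.
rewrite (ev_sum _ _ (size_poly _ _)) mulr_sumr poly_ev (@ev_sum _ _ _ _ q d.+1) ?sq //.
rewrite (reindex_inj rev_ord_inj) /=; apply: eq_bigr => i _.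
have le : (i <= d)%N by rewrite -ltnS.
rewrite coef_poly ltn_ord subSS mulrCA; congr (_ * _).
have -> : z ^+ d = z ^+ (d - i) * z ^+ i by rewrite -exprD subnK.
by rewrite exprVn mulfK // expf_neq0 // z_neq0.
Qed.

Lemma infinite_log_place : maxid R (iota z^-1) ->
  log_place sg iota R z^-1 infinite_der.
Proof.
move=> mc; apply: (@log_place_intro _ _ _ sg iota R _ _ 1) => //.
- by rewrite invr_eq0 z_neq0.
- exact: infinite_derD.
- exact: infinite_derM.
- by move=> s; rewrite infinite_der_const; apply: (sr0 V).
- exact: (sr1 V).
- by rewrite mul1r infinite_der_center.
move=> x x0.
have n0 : \n_(repr x) != 0.
  by apply: contraNneq x0 => n0; rewrite (ratfun_repr x) n0 rmorph0 mul0r.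
have [d [r [_ r0 e]]] := poly_ev_infinity n0.
have [d' [r' [_ r'0 e']]] := poly_ev_infinity (denom_ratioP (repr x)).
have zi0 : z^-1 != 0 by rewrite invr_eq0 z_neq0.
have nz (q : {poly k}) : q.[0] != 0 -> q != 0.
  by apply: contraNneq => ->; rewrite horner0.
exists (d'%:Z - d%:Z), r, r'; split; [|exact: nz|exact: nz].
rewrite (ratfun_repr x) e e' expfzDr // -exprnN -exprnP !exprVn invrK.
rewrite invfM; move: (ev _ _ r) (ev _ _ r')^-1 (z ^+ d) (z ^- d') => y1 y2 y3 y4.
by rewrite mulrACA [y3 * y4]mulrC.
Qed.

Lemma place_poly (q : {poly k}) : R (iota z) -> R (iota q%:F).
Proof.
move=> Rz; rewrite poly_ev (ev_sum _ _ (leqnn _)) rmorph_sum; apply: (sr_sum V) => i _.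
by rewrite rmorphM rmorphXn; apply: (srM V) => //; apply: (srX V).
Qed.

(** If neither [1/z] nor any [z - c] were in the maximal ideal, every nonzero polynomial would be a
    unit of [R]; then [R] would contain C(z) and, being integrally closed, [x]. *)
Lemma place_center x : algebraicOver iota x -> ~ R x ->
  (R (iota z) /\ exists c, maxid R (iota (finite_center c))) \/ maxid R (iota z^-1).
Proof.
move=> ax nx; have [Rz|nRz] := pselect (R (iota z)); last first.
  by right; rewrite fmorphV; apply: maxidV.
left; split=> //; apply: contrapT => nex; apply: nx.
have Rp q := place_poly q Rz.
have Rp' (q : {poly k}) : R (iota q%:F)^-1.
  have [->|q0] := eqVneq q 0; first by rewrite !rmorph0 invr0; apply: (sr0 V).
  have [rs ->] := closed_field_poly_normal q.
  rewrite -mul_polyC !rmorphM invfM; apply: (srM V).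
    by rewrite -fmorphV -[(_%:F)^-1]/((sg _)^-1) -fmorphV; apply: Rk.
  elim: rs => [|r rs IH]; first by rewrite big_nil !rmorph1 invr1; apply: (sr1 V).
  rewrite big_cons !rmorphM invfM; apply: (srM V) => //.
  have /maxidPn[] // : ~ maxid R (iota (finite_center r)).
    by move=> h; apply: nex; exists r.
  by rewrite /finite_center /= -tofracB.
have Rf y : R (iota y).
  by rewrite (ratfun_repr y) rmorphM fmorphV; apply: (srM V).
have /integral_algebraic[q qm hq] := ax.
apply: (vr_integral V (p := map_poly iota q)) => //; first by rewrite map_monic.
by move=> i; rewrite coef_map; apply: Rf.
Qed.

End Place.
End Places.

(** * Constants, Liouville's theorem and polynomial functions *)

Section Global.
Variables (k : numClosedFieldType) (L : diffFieldType) (iota : {rmorphism ratfun k -> L}).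
Hypothesis di : diff_morphism iota.
Local Notation sg := (@ratfunC k).
Local Notation z := ('X%:F : ratfun k).
Local Notation finite_at R c := (maxid R (iota (finite_center c))).
Local Notation infinite_at R := (maxid R (iota z^-1)).

Definition place (R : set L) : Prop := valring R /\ forall c, R (iota (sg c)).

Lemma algebraic_der_iota x : algebraicOver iota x -> algebraicOver iota (der x).
Proof.
apply: algebraic_der; [|exact: derD|exact: derM|by move=> y; exists (der y); rewrite di].
by move=> n; rewrite -(rmorph_nat sg) fmorph_eq0 pnatr_eq0.
Qed.

(** An element outside [k] is transcendental over [k] and has a pole at some place; there its
    logarithmic derivative has its nonzero value as residue, so its derivative does not vanish. *)
Lemma constant_in_base x : algebraicOver iota x -> der x = 0 -> exists c, x = iota (sg c).
Proof.
move=> ax dx; apply: contrapT => nex.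
have nalg : ~ algebraicOver (iota \o sg) x.
  by move=> /closed_algebraic[c xc]; apply: nex; exists c.
have [R [V Rk nR]] := chevalley_transcendental nalg.
have x0 : x != 0 by apply/eqP => x0; apply: nR; rewrite x0; apply: (sr0 V).
suff key (tau : ratfun k) th : log_place sg iota R tau th ->
    (forall s, th (iota (sg s)) = 0) -> th (iota tau) = iota tau -> th x = 0 -> False.
  have [[_ [c mc]]|mi] := place_center V Rk ax nR.
    apply: (key _ _ (finite_log_place di V Rk mc)).
    - exact: finite_der_const.
    - exact: finite_der_center.
    - by rewrite /finite_der dx mulr0.
  apply: (key _ _ (infinite_log_place di V Rk mi)).
  - exact: infinite_der_const.
  - exact: infinite_der_center.
  - by rewrite /infinite_der dx mulr0.
move=> P thS tht thx.
have [e [l [u [e0 xe Ru _ rE]]]] := th_log P thS tht ax x0.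
move: rE; rewrite thx mul0r => rE.
have /(residue_uniq P rE) : residue sg iota R 0 0 by apply/residue0; left.
move/eqP; rewrite mulf_eq0 invr_eq0 intr_eq0 pnatr_eq0 -[e == _]negbK -lt0n e0 orbF.
move=> /eqP l0; apply: nR; move: xe; rewrite l0 expr0z mul1r => xe.
by apply: (vr_root V (n := e.-1)); rewrite prednK // xe.
Qed.

(** Liouville's theorem: a nonconstant function has a pole at some place. A constant is tested at a
    place over infinity, which exists because [z] is transcendental. *)
Lemma regular_vanishing x : algebraicOver iota x ->
  (forall R, place R -> forall c, R (iota z) -> finite_at R c -> R x) ->
  (forall R, place R -> infinite_at R -> maxid R x) -> x = 0.
Proof.
move=> ax fin inf; apply/eqP; apply: contraT => x0.
have [ak|nalg] := pselect (algebraicOver (iota \o sg) x); last first.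
  have [R [V Rk nR]] := chevalley_transcendental nalg.
  have [[Rz [c mc]]|mi] := place_center V Rk ax nR.
    by case: nR; apply: (fin R _ c).
  by case: nR; apply: (maxid_in V); apply: inf.
have [c xc] := closed_algebraic ak.
have nz : ~ algebraicOver (iota \o sg) (iota z).
  move=> /closed_algebraic[d /= /fmorph_inj /eqP].
  rewrite tofrac_eq => /eqP /(congr1 (fun p : {poly k} => p`_1)).
  by rewrite coefX coefC /= => /eqP; rewrite oner_eq0.
have [R [V Rk nR]] := chevalley_transcendental nz.
have : maxid R x by apply: inf => //; rewrite fmorphV; apply: maxidV.
case=> [/eqP|]; first by rewrite (negPf x0).
by rewrite xc -fmorphV => -[]; apply: Rk.
Qed.

Lemma antiderivative x n : algebraicOver iota x -> iter n der x = 0 ->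
  exists q : {poly k}, x = iota q%:F.
Proof.
elim: n x => [|n IH] x ax.
  by rewrite /= => ->; exists 0; rewrite !rmorph0.
rewrite iterSr => /(IH _ (algebraic_der_iota ax))[q qE].
pose Q : {poly k} := \poly_(i < (size q).+1) (q`_i.-1 / i%:R).
have dQ : Q^`() = q.
  apply/polyP => i; rewrite coef_deriv coef_poly ltnS.
  case: ltnP => [lt|le]; last by rewrite mul0rn nth_default.
  by rewrite /= -(mulr_natr (_ / _)) divfK // pnatr_eq0.
have [||c xc] := @constant_in_base (x - iota Q%:F).
- by apply: algebraic_sub => //; apply: algebraic_id.
- by rewrite (derivationB (@derD _)) -di der_poly dQ qE subrr.
by exists (Q + c%:P); rewrite tofracD rmorphD -[iota (c%:P)%:F]/(iota (sg c)) -xc addrC subrK.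
Qed.

(** In [g = q(t) + t ^+ N.+1 * w] the derivative of the remainder is [t ^+ N] times an element of
    [R], because [t * w'] is the logarithmic derivation applied to [w]; one order is lost. *)
Lemma approximable_der_finite R c g : place R -> finite_at R c ->
  approximable sg iota R (finite_center c) g ->
  approximable sg iota R (finite_center c) (der g).
Proof.
move=> [V Rk] mc [ag Ug]; have P := finite_log_place di V Rk mc.
split; first exact: algebraic_der_iota.
move=> N; have [q Rq] := Ug N.+1; exists q^`().
set t := iota _ in Rq *; set w := _ / _ in Rq.
have t0 : t != 0 by rewrite fmorph_eq0 finite_center_neq0.
have aw : algebraicOver iota w.
  apply: algebraic_div; last by rewrite -rmorphXn; apply: algebraic_id.
  apply: algebraic_sub => //; rewrite evtF; exact: algebraic_id.
have gE : g = ev (iota \o sg) t q + t ^+ N.+1 * w.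
  by rewrite /w mulrC divfK ?expf_neq0 // addrC subrK.
have dt : der t = 1 by rewrite /t /finite_center rmorphB (derivationB (@derD _)) der_z // der_const // subr0.
have -> : (der g - ev (iota \o sg) t q^`()) / t ^+ N = N.+1%:R * w + finite_der iota c w.
  rewrite {1}gE derD derM (derivationX (@derM _)) dt {1}/ev.
  rewrite (derivation_horner (@derD _) (@derM _)) dt mulr1 deriv_map.
  have -> : (map_poly der (map_poly (iota \o sg) q)) = 0.
    apply/polyP => i; rewrite coef_map_id0 ?(derivation0 (@derD _)) // coef_map coef0 /=.
    exact: der_const.
  rewrite horner0 add0r -/(ev _ _ _) /finite_der -/t exprS.
  by field; rewrite expf_neq0.
apply: (srD V); last exact: (lp_der P aw).1.
by apply: (srM V) => //; apply: (sr_nat V).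
Qed.

Lemma iter_der_finite R c g n : place R -> finite_at R c ->
  approximable sg iota R (finite_center c) g -> R (iter n der g).
Proof.
move=> PR mc Ug; have [V Rk] := PR; have P := finite_log_place di V Rk mc.
apply: (approximable_in P (tau := finite_center c)).
by elim: n => [//|n IH]; rewrite iterS; apply: approximable_der_finite.
Qed.

(** At infinity [g] is a polynomial in [z] of degree at most [n] plus an algebraic element of
    [t * R], where [t = 1/z]. The polynomial is killed by [n.+1] derivations, and d/dz preserves the
    algebraic elements of [t * R]. *)
Lemma iter_der_infinite R g n : place R -> infinite_at R ->
  approximable sg iota R z^-1 (g / iota z ^+ n) -> maxid R (iter n.+1 der g).
Proof.
move=> [V Rk] mi [ag Ug]; have P := infinite_log_place di V Rk mi.
have z0 : iota z != 0 by rewrite fmorph_eq0 z_neq0.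
set t := iota z^-1 in mi Ug *; have tz : t = (iota z)^-1 by rewrite /t fmorphV.
have Rt := maxid_in V mi.
have [q Rq] := Ug n.+1; set w := (_ - _) / _ in Rq.
have aw : algebraicOver iota w.
  apply: algebraic_div; last by rewrite -rmorphXn; apply: algebraic_id.
  by apply: algebraic_sub => //; rewrite evtF; apply: algebraic_id.
pose q1 := take_poly n.+1 q; pose q2 := drop_poly n.+1 q.
pose w' := w + ev (iota \o sg) t q2.
have aw' : algebraicOver iota w'.
  by apply: algebraic_add => //; rewrite evtF; apply: algebraic_id.
have Rw' : R w' by apply: (srD V) => //; apply: (Revt P).
pose Pz : {poly k} := \poly_(i < n.+1) q1`_(n - i).
have gE : g = iota Pz%:F + t * w'.
  have -> : g = iota z ^+ n * (ev (iota \o sg) t q + t ^+ n.+1 * w).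
    by rewrite /w tz; field; rewrite !expf_neq0 ?invr_eq0.
  have -> : ev (iota \o sg) t q = ev (iota \o sg) t q1 + ev (iota \o sg) t q2 * t ^+ n.+1.
    by rewrite -[in LHS](poly_take_drop n.+1 q) evD evM evXn.
  have -> : iota Pz%:F = iota z ^+ n * ev (iota \o sg) t q1.
    rewrite poly_ev (ev_sum _ _ (size_poly _ _)) rmorph_sum.
    rewrite (@ev_sum _ _ _ _ q1 n.+1) ?size_take_poly // mulr_sumr.
    rewrite (reindex_inj rev_ord_inj) /=; apply: eq_bigr => i _.
    have le : (i <= n)%N by rewrite -ltnS.
    rewrite coef_poly subSS ltnS leq_subr subKn // rmorphM rmorphXn mulrCA.
    congr (_ * _); have -> : iota z ^+ n = iota z ^+ (n - i) * iota z ^+ i.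
      by rewrite -exprD subnK.
    by rewrite tz exprVn mulfK // expf_neq0.
  have zt : iota z ^+ n * t ^+ n.+1 = t.
    by rewrite exprSr mulrA tz exprVn divff ?mul1r // expf_neq0.
  rewrite /w' -[X in _ = _ + X * _]zt; ring.
have step y : algebraicOver iota y -> R y -> exists y',
    [/\ algebraicOver iota y', R y' & der (t * y) = t * y'].
  move=> ay Ry; exists (- (t * y) - t * infinite_der iota y); split.
  - apply: algebraic_sub; first by apply: algebraic_opp; apply: algebraic_mul => //; apply: algebraic_id.
    apply: algebraic_mul; first exact: algebraic_id.
    by apply: algebraic_mul; [apply: algebraic_opp; apply: algebraic_id | apply: algebraic_der_iota].
  - apply: (srB V); first by apply/(srN V)/(srM V).
    by apply: (srM V) => //; apply: (lp_der P ay).1.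
  - rewrite derM /infinite_der tz (derivationV (@derD _) (@derM _)) der_z //.
    by field.
have main m y : algebraicOver iota y -> R y -> maxid R (iter m der (t * y)).
  suff : forall y, algebraicOver iota y -> R y -> exists y',
      [/\ algebraicOver iota y', R y' & iter m der (t * y) = t * y'].
    by move=> h ay Ry; have [y' [_ Ry' ->]] := h y ay Ry; rewrite mulrC; apply: (maxidM V).
  elim: m => [|m IH] y1 ay Ry; first by exists y1.
  by have [y2 [a2 R2 e2]] := IH _ ay Ry; have [y3 [a3 R3 e3]] := step _ a2 R2;
    exists y3; rewrite iterS e2.
have iterD m x y : iter m der (x + y) = iter m der x + iter m der y :> L.
  by elim: m => [//|m IH]; rewrite !iterS IH derD.
have iterP m (r : {poly k}) : iter m der (iota r%:F) = iota (r^`(m))%:F.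
  by elim: m => [|m IH]; rewrite ?derivn0 // iterS IH -di der_poly derivnS.
rewrite gE iterD iterP derivn_poly0 ?size_poly // tofrac0 rmorph0 add0r.
exact: main.
Qed.

End Global.

Definition nonresonant (k : numClosedFieldType) p (B : 'M[k]_p) : Prop :=
  forall (x y : 'cV[k]_p) (l m : k) (j : int) (e : nat), x != 0 -> y != 0 ->
  B *m x = l *: x -> B *m y = m *: y -> (0 < e)%N ->
  l - m = j%:~R / e%:R -> exists n : int, l - m = n%:~R.

Lemma nonresonant0 (k : numClosedFieldType) p : nonresonant (0 : 'M[k]_p).
Proof.
have eig0 (x : 'cV[k]_p) l : x != 0 -> 0 *m x = l *: x -> l = 0.
  move=> x0; rewrite mul0mx => /esym/eqP.
  by rewrite scaler_eq0 (negPf x0) orbF => /eqP.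
move=> x y l m j e x0 y0 /(eig0 _ _ x0) -> /(eig0 _ _ y0) -> _ _.
by exists 0; rewrite subrr.
Qed.

(** * Rationality of the invariant line *)

Section RationalLine.
Variables (k : numClosedFieldType) (L : diffFieldType) (iota : {rmorphism ratfun k -> L}).
Hypothesis di : diff_morphism iota.
Local Notation sg := (@ratfunC k).
Local Notation z := ('X%:F : ratfun k).
Local Notation finite_at R c := (maxid R (iota (finite_center c))).
Local Notation infinite_at R := (maxid R (iota z^-1)).
Variables (p : nat) (A : 'M[ratfun k]_p) (v : 'I_p -> L) (u : L).
Hypothesis line : invariant_line A iota v u.
Hypothesis finite_residue : forall R c, place iota R -> finite_at R c ->
  exists B0 : 'M[k]_p, nonresonant B0 /\
    forall i j, residue sg iota R (iota (finite_center c * A i j)) (B0 i j).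
Hypothesis infinite_residue : forall R, place iota R -> infinite_at R ->
  exists B0 : 'M[k]_p, nonresonant B0 /\
    forall i j, residue sg iota R (iota (- z * A i j)) (B0 i j).

(** With [delta] equal to [z - c] or [- z], finite points and infinity are treated alike. The
    normalising coordinate [rho] is the largest at the place and so depends on [R]. *)
Lemma line_approximable R tau th delta (B0 : 'M[k]_p) : place iota R ->
  log_place sg iota R tau th -> (forall s, th (iota (sg s)) = 0) ->
  th (iota tau) = iota tau -> (forall x, th x = iota delta * der x) ->
  nonresonant B0 ->
  (forall i j, residue sg iota R (iota (delta * A i j)) (B0 i j)) ->
  exists2 rho, v rho != 0 & forall s, approximable sg iota R tau (v s / v rho).
Proof.
move=> [V Rk] P thS tht thE nr res; have [[r vr] valg eqv] := line.
have [|rho [vrho0 Rw]] := vr_max V (v := v); first by exists r; rewrite vr oner_neq0.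
exists rho => // s; split; first by apply: algebraic_div; apply: valg.
pose BB := \matrix_(i, j) (delta * A i j).
pose w i := v i / v rho.
pose u' := \sum_j iota (delta * A rho j) * w j.
have eqw i : th (w i) = \sum_j iota (BB i j) * w j - u' * w i.
  rewrite thE (projective_riccati vrho0 eqv) mulrBr mulr_sumr; congr (_ - _).
    by apply: eq_bigr => j _; rewrite mxE rmorphM -!mulrA.
  have -> : u' = iota delta * \sum_j iota (A rho j) * (v j / v rho).
    by rewrite mulr_sumr; apply: eq_bigr => j _; rewrite rmorphM -mulrA.
  by rewrite -mulrA.
have res' i j : residue sg iota R (iota (BB i j)) (B0 i j).
  by rewrite mxE.
have walg i : algebraicOver iota (w i) by apply: algebraic_div; apply: valg.
have wrho : w rho = 1 by rewrite /w divff.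
have thF x : exists y, th (iota x) = iota y.
  by exists (delta * der x); rewrite thE rmorphM di.
move=> N; have [q hq] := approximation P thS tht res' walg Rw wrho eqw thF nr N.
by exists (q s); apply: hq.
Qed.

Lemma line_rational s : exists x, v s = iota x.
Proof.
have [[r vr] valg eqv] := line; have [f f0 /rootP hf] := valg s.
have [D [C [D0 DC]]] := clear_denominators f.
have Cev : ev iota (v s) (map_poly (@tofrac _) C) = 0.
  by rewrite -DC evZ [ev _ _ _]hf mulr0.
have C0 : C != 0.
  apply/eqP => C0; move: DC; rewrite C0 rmorph0 => /eqP.
  by rewrite scaler_eq0 tofrac_eq0 (negPf D0) (negPf f0).
have [d sC] : exists d, size C = d.+1.
  by exists (size C).-1; rewrite prednK // size_poly_gt0.
pose cd := C`_d; have cd0 : cd != 0 by move: C0; rewrite -lead_coef_eq0 /lead_coef sC.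
have smap : size (map_poly (@tofrac _) C) = d.+1.
  by rewrite size_map_poly_id0 // tofrac_eq0 lead_coef_eq0.
have Csum : iota cd%:F * v s ^+ d + \sum_(i < d) iota (C`_i)%:F * v s ^+ i = 0.
  move: Cev; rewrite (@ev_sum _ _ _ _ _ d.+1) ?smap // big_ord_recr /= addrC => e.
  by rewrite -[RHS]e coef_map; congr (_ + _); apply: eq_bigr => i _; rewrite coef_map.
have icd0 : iota cd%:F != 0 by rewrite fmorph_eq0 tofrac_eq0.
(* Multiplied by the leading coefficient of its equation over C[z], an algebraic function becomes
   integral over C[z], hence finite at all finite places. *)
pose G := iota cd%:F * v s.
have Galg : algebraicOver iota G.
  by apply: algebraic_mul; [apply: algebraic_id | apply: valg].
(* At infinity both [v s / z ^+ N] and [cd / z ^+ N] are finite, whence the exponent [N + N] for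
   [G]. *)
pose N := \max_(i < d.+1) size (C`_i)%R.
have leN i : (i < d.+1)%N -> (size (C`_i)%R <= N)%N.
  by move=> lt; apply: (leq_bigmax (Ordinal lt)).
have finG R c : place iota R -> R (iota z) -> finite_at R c ->
    approximable sg iota R (finite_center c) G.
  move=> PR Rz mc; have [V Rk] := PR; have P := finite_log_place di V Rk mc.
  have [B0 [nr res]] := finite_residue PR mc.
  have [rho vrho0 U] := line_approximable PR P (finite_der_const di c)
    (finite_der_center di c) (fun x => erefl) nr res.
  have RG : R G.
    have [Rv|nRv] := pselect (R (v s)).
      by apply: (srM V) => //; apply: place_poly.
    have v0 : v s != 0 by apply/eqP => e; apply: nRv; rewrite e; apply: (sr0 V).
    have Rv' : R (v s)^-1 by case: (vr_total V (v s)).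
    case: d cd sC cd0 smap Csum icd0 @G Galg @N leN => [|d] cd sC cd0 smap Csum icd0 G Galg N leN.
      by move: Csum; rewrite big_ord0 addr0 expr0 mulr1 => /eqP; rewrite (negPf icd0).
    have -> : G = - \sum_(i < d.+1) iota (C`_i)%:F * (v s)^-1 ^+ (d - i).
      apply: (mulIf (expf_neq0 d v0)); rewrite /G -mulrA -exprS.
      move/eqP: Csum; rewrite addr_eq0 => /eqP ->; rewrite mulNr mulr_suml.
      congr (- _); apply: eq_bigr => i _; rewrite -mulrA; congr (_ * _).
      have le : (i <= d)%N by rewrite -ltnS.
      have -> : v s ^+ d = v s ^+ (d - i) * v s ^+ i by rewrite -exprD subnK.
      by rewrite mulrA exprVn mulVf ?mul1r // expf_neq0.
    apply: (srN V); apply: (sr_sum V) => i _; apply: (srM V); first exact: place_poly.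
    exact: (srX V).
  (* Approximability is known for coordinates relative to [rho]; returning to the coordinate [r],
     where [v r = 1], requires a quotient. *)
  have GE : G = (iota cd%:F * (v s / v rho)) / (v r / v rho).
    by rewrite vr div1r invrK -mulrA divfK.
  rewrite GE; apply: (approximable_div P); rewrite -?GE //.
  - apply: (approximableM P) => //; rewrite (poly_ev_finite c) -evtF.
    exact: (approximable_ev P).
  - by rewrite mulf_neq0 ?invr_eq0 // vr oner_neq0.
have infG R : place iota R -> infinite_at R ->
    approximable sg iota R z^-1 (G / iota z ^+ (N + N)).
  move=> PR mi; have [V Rk] := PR; have P := infinite_log_place di V Rk mi.
  have [B0 [nr res]] := infinite_residue PR mi.
  have thE x : infinite_der iota x = iota (- z) * der x by rewrite /infinite_der rmorphN.
  have [rho vrho0 U] := line_approximable PR P (infinite_der_const di)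
    (infinite_der_center di) thE nr res.
  have z0 : iota z != 0 by rewrite fmorph_eq0 z_neq0.
  pose t := iota z^-1; have tz : t = (iota z)^-1 by rewrite /t fmorphV.
  have Rt : R t := maxid_in V mi.
  have Cinf (q : {poly k}) : (size q <= N)%N ->
      exists r : {poly k}, iota q%:F / iota z ^+ N = ev (iota \o sg) t r.
    move=> sq; have [->|q0] := eqVneq q 0; first by exists 0; rewrite ev0 tofrac0 rmorph0 mul0r.
    have [e [r' [lt _ ->]]] := poly_ev_infinity q0.
    have le : (e <= N)%N by apply: leq_trans sq; apply: ltnW.
    exists (r' * 'X^(N - e)); rewrite evM evXn evtF rmorphM rmorphXn -/t.
    have -> : iota z ^+ N = iota z ^+ (N - e) * iota z ^+ e by rewrite -exprD subnK.
    by rewrite tz exprVn; field; rewrite !expf_neq0.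
  have CR (q : {poly k}) : (size q <= N)%N -> R (iota q%:F / iota z ^+ N).
    by move=> /Cinf[r' ->]; apply: (Revt P).
  pose h := v s / iota z ^+ N.
  (* Were [h] infinite, the relation divided by [v s ^+ d] would put the leading coefficient [cd] in
     the maximal ideal, but a nonzero polynomial has no zero at infinity. *)
  have Rh : R h.
    apply: contrapT => nRh; have mh := maxidV nRh.
    have h0 : h != 0 by apply/eqP => e; apply: nRh; rewrite e; apply: (sr0 V).
    have vh : v s = h * iota z ^+ N by rewrite /h divfK // expf_neq0.
    have mcd : maxid R (iota cd%:F).
      have -> : iota cd%:F = - \sum_(i < d) (iota (C`_i)%:F / iota z ^+ N) *
          (t ^+ (N * (d - i).-1)) * (h^-1 ^+ (d - i).-1) * h^-1.
        apply: (mulIf (expf_neq0 d (_ : v s != 0))); first by rewrite vh mulf_neq0 ?expf_neq0.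
        move/eqP: Csum; rewrite addr_eq0 => /eqP ->; rewrite mulNr mulr_suml.
        congr (- _); apply: eq_bigr => i _.
        have e1 : (d - i)%N = (d - i).-1.+1 by rewrite prednK // subn_gt0.
        have -> : v s ^+ d = v s ^+ (d - i).-1 * v s * v s ^+ i.
          by rewrite -exprSr -e1 -exprD subnK // ltnW.
        rewrite {2 3}vh exprMn -exprM tz !exprVn.
        move: (expf_neq0 (N * (d - i).-1) z0) (expf_neq0 N z0) (expf_neq0 (d - i).-1 h0).
        move: (_ ^+ (N * _)) (_ ^+ N) (h ^+ _) (v s ^+ i) => x1 x2 x3 x4 n1 n2 n3.
        by field; rewrite n1 n2 n3 h0.
      apply: (maxidN V); apply: (maxid_sum V) => i _; apply: (maxidM V) => //.
      apply: (srM V); last by apply/(srX V)/(maxid_in V).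
      by apply: (srM V); [apply/CR/leN; rewrite ltnW ?ltnS | apply: (srX V)].
    have [e [r' [_ r'0 E]]] := poly_ev_infinity cd0.
    have nev : ~ maxid R (iota (ev sg z^-1 r')) by rewrite -evtF; apply: (evt_unit P).
    case: mcd => [/eqP|]; first by rewrite (negPf icd0).
    case; rewrite E rmorphM invfM rmorphXn -exprVn -tz.
    by apply: (srM V); [apply: (srX V) | have [] := maxidPn nev].
  have GE : G / iota z ^+ (N + N) =
      (iota cd%:F / iota z ^+ N) * ((v s / v rho * t ^+ N) / (v r / v rho)).
    rewrite vr div1r invrK /G exprD tz exprVn; field; rewrite vrho0 expf_neq0 //.
  rewrite GE; apply: (approximableM P).
    have [|r' ->] := Cinf cd; first exact: leN.
    exact: (approximable_ev P).
  apply: (approximable_div P).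
  - apply: (approximableM P) => //; rewrite -(evXn (iota \o sg)).
    exact: (approximable_ev P).
  - exact: U.
  - by rewrite mulf_neq0 ?invr_eq0 // vr oner_neq0.
  - have -> : v s / v rho * t ^+ N / (v r / v rho) = h.
      by rewrite vr div1r invrK mulrAC divfK // tz exprVn.
    exact: Rh.
pose H := iter (N + N).+1 der G.
have Halg : algebraicOver iota H.
  rewrite /H; elim: (N + N).+1 => [//|m IH].
  by rewrite iterS; apply: algebraic_der_iota.
have H0 : H = 0.
  apply: (regular_vanishing Halg) => [R PR c Rz mc|R PR mi].
    by rewrite /H; apply: (iter_der_finite di _ PR mc); apply: finG.
  by rewrite /H; apply: (iter_der_infinite di PR mi); apply: infG.
have [q qE] := antiderivative di Galg H0.
exists (q%:F / cd%:F); rewrite fmorph_div -qE /G mulrC mulKf //.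
Qed.

End RationalLine.

(** * Fuchsian systems *)

Lemma coefM_top (A : nzRingType) (p q : {poly A}) a b :
  (size p <= a.+1)%N -> (size q <= b.+1)%N -> (p * q)`_(a + b) = p`_a * q`_b.
Proof.
move=> sp sq; have lt : (a < (a + b).+1)%N by rewrite ltnS leq_addr.
rewrite coefM (bigD1 (Ordinal lt)) //= addKn big1 ?addr0 // => i ne.
have [lti|] := ltnP i a; last first.
  rewrite leq_eqVlt => /predU1P[e|lta].
    by case/eqP: ne; apply: val_inj.
  by rewrite nth_default ?mul0r // (leq_trans sp).
by rewrite [q`_ _]nth_default ?mulr0 // (leq_trans sq) //; lia.
Qed.

Lemma size_mul_bound (A : nzRingType) (p q : {poly A}) a b :
  (size p <= a)%N -> (size q <= b.+1)%N -> (size (p * q)%R <= a + b)%N.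
Proof.
move=> sp sq; apply: leq_trans (size_polyMleq p q) _.
by rewrite -subn1 leq_subLR add1n -addnS leq_add.
Qed.

(* Stated over an abstract field because [field] is impracticable over k(z). *)
Lemma mul_denominator (F : fieldType) (d r x : F) : d != 0 -> x * r = d * r * (x / d).
Proof. by move=> d0; field. Qed.

Lemma gauge_identity (F : fieldType) (q q' s u x : F) : q != 0 ->
  q' * x + q * (s - u * x) = q * s - (u - q' / q) * (q * x).
Proof. by move=> q0; field. Qed.

Lemma mul_center (F : fieldType) (c r b : F) : c != 0 -> b * r = c * r * (c^-1 * b).
Proof. by move=> c0; field. Qed.

Section Fuchsian.
Variables (k : numClosedFieldType) (n p : nat) (a : 'I_n -> k) (a_inj : injective a).
Variable B : 'I_n -> 'M[k]_p.
Local Notation sg := (@ratfunC k).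
Local Notation z := ('X%:F : ratfun k).

Lemma fuchsianE i j :
  fuchsian_mx a B i j = \sum_l (finite_center (a l))^-1 * sg (B l i j).
Proof.
rewrite /fuchsian_mx summxE; apply: eq_bigr => l _; rewrite !mxE.
by rewrite /finite_center /= -tofracB.
Qed.

Section Residues.
Variables (L : diffFieldType) (iota : {rmorphism ratfun k -> L}).
Hypothesis di : diff_morphism iota.
Hypothesis nonres : forall l, nonresonant (B l).

Lemma fuchsian_finite_residue R c : place iota R -> maxid R (iota (finite_center c)) ->
  exists B0 : 'M[k]_p, nonresonant B0 /\ forall i j,
    residue sg iota R (iota (finite_center c * fuchsian_mx a B i j)) (B0 i j).
Proof.
move=> [V Rk] mc; have P := finite_log_place di V Rk mc.
(* The residue is [B l] at [c = a l] and zero elsewhere; as [a] is injective, at most one term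
   survives. *)
exists (\sum_l (if a l == c then B l else 0)); split.
  have [[l0 al0]|nex] := pselect (exists l, a l = c).
    rewrite (bigD1 l0) //= al0 eqxx big1 ?addr0 // => l ne.
    by case: eqP => // al; case/eqP: ne; apply: a_inj; rewrite al al0.
  rewrite big1; first exact: nonresonant0.
  by move=> l _; case: eqP => // al; case: nex; exists l.
move=> i j; rewrite fuchsianE mulr_sumr rmorph_sum summxE; apply: (residue_sum P) => l.
rewrite mulrA rmorphM; case: eqP => [->|ne].
  rewrite divff ?finite_center_neq0 // rmorph1 mul1r; exact: (residue_const sg iota R _).
rewrite mxE -(mul0r (B l i j)); apply: (residueM P); last exact: (residue_const sg iota R _).
rewrite rmorphM fmorphV -(mul0r (c - a l)^-1); apply: (residueM P).
  exact/residue0.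
apply: (residueV P); first by rewrite subr_eq0 eq_sym; apply/eqP.
have -> : finite_center (a l) = finite_center c + sg (c - a l).
  by rewrite /finite_center rmorphB addrA subrK.
rewrite rmorphD -[X in residue _ _ _ _ X]add0r; apply: (residueD P).
  exact/residue0.
exact: (residue_const sg iota R _).
Qed.

Lemma fuchsian_infinite_residue R : \sum_l B l = 0 ->
  place iota R -> maxid R (iota z^-1) ->
  exists B0 : 'M[k]_p, nonresonant B0 /\ forall i j,
    residue sg iota R (iota (- z * fuchsian_mx a B i j)) (B0 i j).
Proof.
move=> sumB [V Rk] mi; have P := infinite_log_place di V Rk mi.
(* The residue at infinity is minus the sum of the [B l]. *)
exists 0; split; first exact: nonresonant0.
move=> i j; have -> : (0 : 'M[k]_p) i j = - \sum_l 1 * B l i j.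
  under eq_bigr do rewrite mul1r.
  by rewrite -summxE sumB !mxE oppr0.
rewrite mulNr rmorphN; apply: (residueN P).
rewrite fuchsianE mulr_sumr rmorph_sum; apply: (residue_sum P) => l.
rewrite mulrA rmorphM; apply: (residueM P); last exact: (residue_const sg iota R _).
have c0 := finite_center_neq0 (a l).
have -> : z / finite_center (a l) = (1 - sg (a l) * z^-1)^-1.
  have e : 1 - sg (a l) * z^-1 = finite_center (a l) / z.
    by rewrite /finite_center mulrBl divff ?z_neq0.
  by rewrite e invf_div.
rewrite fmorphV -[X in residue _ _ _ _ X]invr1; apply: (residueV P); first exact: oner_neq0.
rewrite rmorphB rmorph1 -[X in residue _ _ _ _ X]subr0; apply: (residueB P).
  by have := residue_const sg iota R 1; rewrite !rmorph1.
rewrite rmorphM -(mulr0 (a l)); apply: (residueM P); first exact: (residue_const sg iota R _).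
exact/residue0.
Qed.

End Residues.

Definition has_eigenvalue q (M : 'M[k]_q) (l : k) : Prop :=
  exists2 x : 'cV[k]_q, x != 0 & M *m x = l *: x.

(** Clear denominators and divide by a greatest common divisor, found as a nonzero combination of
    least size: the remainders of the entries modulo it are shorter combinations, hence zero. *)
Lemma primitive_vector (x : 'I_p -> ratfun k) : (exists i, x i != 0) ->
  exists (w b : 'I_p -> {poly k}) (Q : ratfun k),
    [/\ Q != 0, forall i, (w i)%:F = Q * x i & \sum_i b i * w i = 1].
Proof.
case=> r xr.
pose D := \prod_i \d_(repr (x i)).
have D0 : D != 0 by apply/prodf_neq0 => i _; apply: denom_ratioP.
pose W i := \n_(repr (x i)) * \prod_(j | j != i) \d_(repr (x j)).
have WE i : (W i)%:F = D%:F * x i.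
  rewrite /W /D [in RHS](bigD1 i) //= {3}(ratfun_repr (x i)) !tofracM.
  have d0 : (\d_(repr (x i)))%:F != 0 :> ratfun k by rewrite tofrac_eq0 denom_ratioP.
  exact: mul_denominator.
pose Pr m := `[< exists b : 'I_p -> {poly k},
  \sum_i b i * W i != 0 /\ size (\sum_i b i * W i) = m >].
have W0 : W r != 0.
  rewrite -tofrac_eq0 WE; apply: mulf_neq0; last exact: xr.
  by rewrite tofrac_eq0.
have exP : exists m, Pr m.
  exists (size (W r)); apply/asboolP; exists (fun i => (i == r)%:R).
  suff -> : \sum_i (i == r)%:R * W i = W r by [].
  rewrite (bigD1 r) //= eqxx mul1r big1 ?addr0 // => i /negPf ->.
  by rewrite mul0r.
have [m /asboolP[b [g0 sgm]] mmin] := ex_minnP exP.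
set g := \sum_i b i * W i in g0 sgm.
have dvd i : g %| W i.
  apply: contraT => ndvd; have lt : (size (W i %% g)%R < size g)%N by rewrite ltn_modp.
  suff : (m <= size (W i %% g)%R)%N by rewrite leqNgt -sgm lt.
  apply: mmin; apply/asboolP; exists (fun j => (j == i)%:R - W i %/ g * b j).
  have -> : \sum_j ((j == i)%:R - W i %/ g * b j) * W j = W i %% g.
    under eq_bigr do rewrite mulrBl -mulrA.
    rewrite sumrB -mulr_sumr -/g (bigD1 i) //= eqxx mul1r big1 ?addr0.
      by rewrite {1}(divp_eq (W i) g) addrC addKr.
    by move=> j /negPf ->; rewrite mul0r.
  by split=> //; move: ndvd; rewrite /dvdp.
have wE i : W i %/ g * g = W i by rewrite divpK.
exists (fun i => W i %/ g), b, (D%:F / g%:F); split.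
- by rewrite mulf_neq0 ?invr_eq0 ?tofrac_eq0.
- move=> i; have gF : g%:F != 0 :> ratfun k by rewrite tofrac_eq0.
  by apply: (mulIf gF); rewrite -tofracM wE WE mulrAC divfK // mulrC.
apply: (mulIf g0); rewrite mul1r mulr_suml; apply: eq_bigr => i _.
by rewrite -mulrA wE.
Qed.

End Fuchsian.

Section RationalEigenvector.
Variables (k : numClosedFieldType) (n p : nat) (a : 'I_n -> k) (a_inj : injective a).
Variable B : 'I_n -> 'M[k]_p.
Hypothesis sumB : \sum_l B l = 0.
Hypothesis degree : forall lam : 'I_n -> k, (forall l, has_eigenvalue (B l) (lam l)) ->
  forall m : nat, \sum_l lam l = - m%:R -> m = 0%N.
Variables (x : 'I_p -> ratfun k) (u : ratfun k).
Hypothesis x_neq0 : exists i, x i != 0.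
Hypothesis eqx : forall i, der (x i) = \sum_j fuchsian_mx a B i j * x j - u * x i.

(* The residues lam_l of the connection on the line are eigenvalues of the B_l,
   and their sum is minus the degree of a primitive polynomial generator. *)
Lemma fuchsian_common_eigenvector : exists2 y : 'cV[k]_p, y != 0 &
  forall l, exists c : k, B l *m y = c *: y.
Proof.
case: n a a_inj B sumB degree eqx => [|n'] a' ainj B' sB deg eqx'.
  have [i _] := x_neq0; exists (delta_mx i 0); last by case.
  by apply/eqP => /matrixP /(_ i 0); rewrite !mxE !eqxx => /eqP; rewrite oner_eq0.
have [w [b [Q [Q0 wE bw]]]] := primitive_vector x_neq0.
pose om := \prod_l ('X - (a' l)%:P).
pose oml l := \prod_(l' | l' != l) ('X - (a' l')%:P).
have omE l : om = ('X - (a' l)%:P) * oml l by rewrite /om (bigD1 l).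
have om_root l : om.[a' l] = 0 by rewrite (omE l) hornerM hornerXsubC subrr mul0r.
have oml_root l l' : l' != l -> (oml l).[a' l'] = 0.
  by move=> ne; rewrite /oml (bigD1 l') //= hornerM hornerXsubC subrr mul0r.
have oml_neq0 l : (oml l).[a' l] != 0.
  rewrite /oml horner_prod; apply/prodf_neq0 => l' ne.
  by rewrite hornerXsubC subr_eq0; apply: contra ne => /eqP /ainj ->.
have om_size : size om = n'.+2.
  rewrite size_prod => [|l _]; last by rewrite polyXsubC_eq0.
  under eq_bigr do rewrite size_XsubC.
  by rewrite sum_nat_const card_ord; lia.
have om_lead : om`_n'.+1 = 1.
  have : om \is monic by apply: monic_prod => l _; apply: monicXsubC.
  by rewrite monicE /lead_coef om_size => /eqP.
have oml_size l : size (oml l) = n'.+1.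
  have o0 : oml l != 0 by apply: contraNneq (oml_neq0 l) => ->; rewrite horner0.
  by have := om_size; rewrite (omE l) size_mul ?polyXsubC_eq0 // size_XsubC => -[].
have oml_lead l : (oml l)`_n' = 1.
  have : oml l \is monic by apply: monic_prod => l' _; apply: monicXsubC.
  by rewrite monicE /lead_coef oml_size => /eqP.
pose AA i j := \sum_l B' l i j *: oml l.
have AAE i j : (AA i j)%:F = om%:F * fuchsian_mx a' B' i j.
  rewrite fuchsianE mulr_sumr /AA rmorph_sum; apply: eq_bigr => l _.
  rewrite (omE l) tofracM /= tofracB -/(finite_center (a' l)).
  rewrite -mul_polyC tofracM; apply: mul_center.
  exact: finite_center_neq0.
(* The multiplier of the connection after passing to the polynomial generator [w = Q * x]. *)
pose y0 := u - der Q / Q.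
have dw i : (w i)^`()%:F = \sum_j fuchsian_mx a' B' i j * (w j)%:F - y0 * (w i)%:F.
  rewrite -der_poly wE derM eqx' (gauge_identity _ _ _ _ Q0) mulr_sumr.
  by congr (_ - _); apply: eq_bigr => j _; rewrite wE mulrCA.
pose Z i := \sum_j AA i j * w j - om * (w i)^`().
have ZE i : (Z i)%:F = om%:F * y0 * (w i)%:F.
  rewrite /Z tofracB rmorph_sum tofracM dw mulrBr mulr_sumr -mulrA.
  rewrite -[RHS](subKr (\sum_j om%:F * (fuchsian_mx a' B' i j * (w j)%:F))).
  by congr (_ - _); apply: eq_bigr => j _; rewrite /= tofracM AAE mulrA.
(* [om * y0] is a polynomial: by [bw] it is a combination of the polynomials
   [Z i = om * y0 * w i]. *)
pose Y := \sum_i b i * Z i.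
have YE : Y%:F = om%:F * y0.
  rewrite -[RHS]mulr1 -tofrac1 -bw !rmorph_sum mulr_sumr; apply: eq_bigr => i _.
  by rewrite /= !tofracM ZE mulrCA.
have star i : Y * w i = Z i.
  by apply/eqP; rewrite -tofrac_eq tofracM YE ZE.
clearbody Y.
have w_neq0 c : exists i, (w i).[c] != 0.
  apply: contrapT => nex; have := congr1 (fun q : {poly k} => q.[c]) bw.
  rewrite horner_sum hornerC big1 => [/eqP|i _]; first by rewrite eq_sym oner_eq0.
  rewrite hornerM; have [->|wi] := eqVneq (w i).[c] 0; first by rewrite mulr0.
  by case: nex; exists i.
(* The residue of [y0] at [a' l]. *)
pose lam l := Y.[a' l] / (oml l).[a' l].
have eig l i : \sum_j B' l i j * (w j).[a' l] = lam l * (w i).[a' l].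
  have := congr1 (fun q : {poly k} => q.[a' l]) (star i).
  rewrite /Z hornerM hornerD hornerN hornerM om_root mul0r subr0 horner_sum => e.
  apply: (mulfI (oml_neq0 l)); rewrite /lam.
  have -> : (oml l).[a' l] * (Y.[a' l] / (oml l).[a' l] * (w i).[a' l]) =
      Y.[a' l] * (w i).[a' l] by field; apply: oml_neq0.
  rewrite e mulr_sumr; apply: eq_bigr => j _.
  rewrite hornerM /AA horner_sum (bigD1 l) //= hornerZ big1 ?addr0 => [|l' ne].
    by ring.
  by rewrite hornerZ oml_root ?mulr0 // eq_sym.
have ev_lam l : has_eigenvalue (B' l) (lam l).
  exists (\col_i (w i).[a' l]).
    apply/eqP => /matrixP h; have [i wi] := w_neq0 (a' l).
    by move: wi (h i 0); rewrite !mxE => wi e; rewrite e eqxx in wi.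
  by apply/matrixP => i j; rewrite !mxE -eig; apply: eq_bigr => j' _; rewrite mxE.
pose m := (\max_i size (w i)).-1.
have wsize i : (size (w i) <= m.+1)%N.
  by apply: leq_trans (leqSpred _); apply: (leq_bigmax i).
have [i0 wi0] : exists i, (w i)`_m != 0.
  have [i1 wi1] := w_neq0 0.
  have [|i2 i2E] := @bigop.eq_bigmax _ (fun i => size (w i)).
    by apply/card_gt0P; exists i1.
  have w1 : (0 < size (w i1))%N.
    by rewrite size_poly_gt0; apply: contraNneq wi1 => ->; rewrite horner0.
  exists i2; rewrite /m i2E -/(lead_coef _) lead_coef_eq0 -size_poly_gt0 -i2E.
  by apply: leq_trans w1 _; apply: (leq_bigmax i1).
have dsize i : (size (w i)^`() <= m)%N.
  apply/leq_sizeP => d le; rewrite coef_deriv nth_default ?mul0rn //.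
  exact: leq_trans (wsize i) _.
clearbody m.
(* The residue matrices sum to zero, so the coefficient of degree [n'] cancels. *)
have AAsize i j : (size (AA i j) <= n')%N.
  apply/leq_sizeP => d; rewrite leq_eqVlt => /predU1P[<-|lt].
    rewrite /AA coef_sum -[RHS](_ : (\sum_l B' l) i j = 0); last by rewrite sB mxE.
    by rewrite summxE; apply: eq_bigr => l _; rewrite coefZ oml_lead mulr1.
  rewrite /AA coef_sum big1 // => l _; rewrite coefZ nth_default ?mulr0 //.
  by rewrite oml_size.
(* In degree [n' + m] only the term [om * w'] contributes to [Z]. *)
have coef_star i : (Y * w i)`_(n' + m) = - m%:R * (w i)`_m.
  rewrite star /Z coefB coef_sum big1 ?sub0r => [|j _]; last first.
    by rewrite nth_default // size_mul_bound.
  rewrite mulNr; congr (- _); case: (m) (wsize i) (dsize i) => [|m'] ws ds.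
    by rewrite mul0r; move: ds; rewrite leqn0 size_poly_eq0 => /eqP ->; rewrite mulr0 coef0.
  by rewrite addnS -addSn coefM_top ?om_size // om_lead mul1r coef_deriv mulr_natl.
have Ysize : (size Y <= n'.+1)%N.
  have [->|Y0] := eqVneq Y 0; first by rewrite size_poly0.
  have w00 : w i0 != 0 by apply: contraNneq wi0 => ->; rewrite coef0.
  have sw : size (w i0) = m.+1.
    apply/eqP; rewrite eqn_leq wsize ltnNge; apply/negP => le.
    by move: wi0; rewrite nth_default ?eqxx.
  have : (size (Y * w i0)%R <= (n' + m).+1)%N.
    rewrite star; apply/leq_sizeP => d le; rewrite coefB coef_sum big1 => [|j _].
      rewrite mulrC nth_default ?subr0 // (leq_trans _ le) // -addSn addnC.
      by apply: size_mul_bound; rewrite ?om_size.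
    rewrite nth_default // (leq_trans _ (ltnW le)) //.
    by rewrite size_mul_bound.
  by rewrite size_mul // sw addnS /= -addSn leq_add2r.
have Ylead : Y`_n' = - m%:R.
  have := coef_star i0; rewrite coefM_top // => /(mulIf wi0); exact.
(* Lagrange interpolation: both sides have degree at most [n'] and agree at [n'.+1] points. *)
have YL : Y = \sum_l lam l *: oml l.
  apply/eqP; rewrite -subr_eq0; apply: contraT => D0.
  have := max_poly_roots D0 (rs := [seq a' l | l <- enum 'I_n'.+1]).
  rewrite size_map size_enum_ord map_inj_uniq ?enum_uniq // => /(_ _ isT) h.
  suff : (n'.+1 < n'.+1)%N by rewrite ltnn.
  apply: leq_trans (h _) _.
    apply/allP => _ /mapP[l _ ->]; rewrite rootE hornerD hornerN horner_sum (bigD1 l) //=.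
    rewrite big1 ?addr0 => [|l' ne]; last by rewrite hornerZ oml_root ?mulr0 // eq_sym.
    by rewrite hornerZ /lam divfK // subrr.
  apply/leq_sizeP => d le; rewrite coefB coef_sum big1 ?subr0 => [|l _].
    by rewrite nth_default // (leq_trans Ysize).
  by rewrite coefZ nth_default ?mulr0 // oml_size.
have sumlam : \sum_l lam l = - m%:R.
  rewrite -Ylead YL coef_sum; apply: eq_bigr => l _.
  by rewrite coefZ oml_lead mulr1.
have m0 := deg _ ev_lam _ sumlam.
exists (\col_i (w i)`_0).
  apply/eqP => /matrixP /(_ i0 0); rewrite !mxE -m0 => e.
  by move: wi0; rewrite e eqxx.
move=> l; exists (lam l); apply/matrixP => i j; rewrite !mxE.
have wC i' : (w i').[a' l] = (w i')`_0.
  by have := wsize i'; rewrite m0 => /size1_polyC {1}->; rewrite hornerC.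
by rewrite -wC -eig; apply: eq_bigr => j' _; rewrite mxE wC.
Qed.

End RationalEigenvector.

Lemma map_der_mul (K : diffFieldType) m n p (A : 'M[K]_(m, n)) (B : 'M[K]_(n, p)) :
  map_mx der (A *m B) = map_mx der A *m B + A *m map_mx der B.
Proof.
apply/matrixP => i j; rewrite !mxE (derivation_sum (@derD K)) -big_split /=.
by apply: eq_bigr => l _; rewrite derM !mxE.
Qed.

Lemma fuchsian_gauge (k : numClosedFieldType) n (a : 'I_n -> k) p q (B M : 'I_n -> 'M[k]_p)
    (C : 'M[k]_p) (K : diffFieldType) (f : {rmorphism ratfun k -> K}) (Y : 'M[K]_(p, q)) :
  diff_morphism f -> (forall i, C *m B i = M i *m C) ->
  map_mx der Y = map_mx f (fuchsian_mx a B) *m Y ->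
  map_mx der (map_mx (f \o @ratfunC k) C *m Y) =
  map_mx f (fuchsian_mx a M) *m (map_mx (f \o @ratfunC k) C *m Y).
Proof.
move=> df CB dY; set sg := @ratfunC k.
have -> : map_mx (f \o sg) C = map_mx f (map_mx sg C).
  by apply/matrixP => i j; rewrite !mxE.
rewrite map_der_mul dY; have -> : map_mx der (map_mx f (map_mx sg C)) = 0.
  apply/matrixP => i j; rewrite !mxE -df /sg /ratfunC /= der_poly derivC.
  by rewrite !rmorph0.
rewrite mul0mx add0r !mulmxA -!map_mxM; congr (map_mx f _ *m Y).
rewrite /fuchsian_mx mulmx_sumr mulmx_suml; apply: eq_bigr => i _.
rewrite -scalemxAr -scalemxAl; congr (_ *: _).
by rewrite -[LHS](map_mxM sg) CB [LHS](map_mxM sg).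
Qed.

Lemma quadrature_chain_subfield (T K : diffFieldType) (f : {rmorphism T -> K}) (m : nat)
    (E : nat -> set K) :
  diff_morphism f -> range f = E 0%N ->
  (forall i, (i < m)%N -> quadrature_step (E i) (E i.+1)) ->
  diff_subfield (E m) /\ (range f `<=` E m)%classic.
Proof.
move=> df rf; elim: m => [|m IH] step.
  rewrite -rf; split=> //; split.
  - by exists 1; rewrite ?rmorph1.
  - by move=> _ _ [x _ <-] [y _ <-]; exists (x - y); rewrite ?rmorphB.
  - by move=> _ _ [x _ <-] [y _ <-]; exists (x / y); rewrite ?fmorph_div.
  - by move=> _ [x _ <-]; exists (der x); rewrite ?df.
have [_ sub] := IH (fun i h => step i (ltnW h)).
have [x [_ ->]] := step m (ltnSn m); split; first exact: diff_adjoin_subfield.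
by move=> y /sub Ey; apply: sub_diff_adjoin; left.
Qed.

Lemma invmx_uniq (F : fieldType) n (A B : 'M[F]_n) : A *m B = 1%:M -> invmx A = B.
Proof. by move=> e; have [Au _] := mulmx1_unit e; rewrite -[RHS](mulKmx Au) e mulmx1. Qed.

Lemma dsubmx_mul (F : fieldType) m1 m2 n1 n2 q (A : 'M[F]_(m1 + m2, n1 + n2)) (Z : 'M[F]_(n1 + n2, q)) :
  dlsubmx A = 0 -> dsubmx (A *m Z) = drsubmx A *m dsubmx Z.
Proof.
move=> A0; rewrite -{1}[A]submxK -{1}[Z]vsubmxK mul_block_col A0 col_mxKd.
by rewrite mul0mx add0r.
Qed.

(** * Splitting off a common eigenvector *)

Section Descent.
Variables (k : numClosedFieldType) (n : nat) (a : 'I_n -> k) (a_inj : injective a).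
Local Notation sg := (@ratfunC k).

Lemma rational_invariant_line p (B : 'I_n -> 'M[k]_p) :
  \sum_l B l = 0 -> (forall l, nonresonant (B l)) ->
  algebraic_line (fuchsian_mx a B) ->
  exists (x : 'I_p -> ratfun k) u, (exists i, x i != 0) /\
    forall i, der (x i) = \sum_j fuchsian_mx a B i j * x j - u * x i.
Proof.
move=> sumB nr [L [iota [v [u [di inv]]]]].
have rat := line_rational di inv
  (fun R c => fuchsian_finite_residue a_inj di nr (R := R) (c := c))
  (fun R => fuchsian_infinite_residue a di (R := R) sumB).
have [x xE] := choice rat; have [[r vr] _ eqv] := inv.
exists x, (\sum_j fuchsian_mx a B r j * x j); split.
  by exists r; rewrite -(fmorph_eq0 iota) -xE vr oner_neq0.
have uE : u = iota (\sum_j fuchsian_mx a B r j * x j).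
  have := eqv r; rewrite vr (derivation1 (@derM _)) mulr1 => /esym/eqP.
  rewrite subr_eq0 => /eqP <-; rewrite rmorph_sum; apply: eq_bigr => j _.
  by rewrite rmorphM xE.
move=> i; apply: (fmorph_inj iota); rewrite di -xE eqv uE rmorphB rmorphM -xE !rmorph_sum.
by congr (_ - _); apply: eq_bigr => j _; rewrite rmorphM xE.
Qed.

Lemma split_eigenvector p (B : 'I_n -> 'M[k]_(1 + p)) (y : 'cV[k]_(1 + p)) : y != 0 ->
  (forall l, exists c : k, B l *m y = c *: y) ->
  exists2 C : 'M[k]_(1 + p), C \in unitmx & forall l,
    dlsubmx (C *m B l *m invmx C) = 0.
Proof.
move=> y0 By; have [c Bc] := choice By.
(* In the rank factorisation of the nonzero column [y], the inverse of the left factor sends [y] to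
   a multiple of the first basis vector. *)
pose C := invmx (col_ebase y); have Cu : C \in unitmx by rewrite unitmx_inv col_ebase_unit.
exists C => // l.
pose e := C *m y.
have ry : \rank y = 1%N.
  by apply/eqP; rewrite eqn_leq rank_leq_col lt0n mxrank_eq0.
have eE : e = pid_mx 1 *m row_ebase y.
  by rewrite /e -[y in C *m y]mulmx_ebase /C -!mulmxA mulKmx ?col_ebase_unit // ry.
have d0 : row_ebase y 0 0 != 0.
  have := row_ebase_unit y; rewrite unitmxE unitfE; set D := row_ebase y.
  by rewrite [D]mx11_scalar det_scalar1 mxE eqxx mulr1n.
have de0 : dsubmx e = 0.
  apply/matrixP => i j; rewrite eE !mxE big_ord1 !mxE /=.
  by rewrite mul0r.
have ue : usubmx e = (row_ebase y 0 0)%:M.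
  apply/matrixP => i j; rewrite !ord1 eE !mxE big_ord1 !mxE /=.
  by rewrite mul1r mulr1n.
have Be : (C *m B l *m invmx C) *m e = c l *: e.
  by rewrite /e -!mulmxA mulKmx // Bc -scalemxAr.
move: Be; set M := _ *m invmx C => Be.
have := congr1 dsubmx Be; rewrite -[e]vsubmxK -{1}[M]submxK mul_block_col.
rewrite linearZ /= col_mxKd col_mxKd de0 mulmx0 addr0 scaler0 ue.
rewrite mul_mx_scalar => /eqP; rewrite scaler_eq0 (negPf d0) => /eqP; exact.
Qed.

Lemma eigenvalue_conj q (M C : 'M[k]_q) l : C \in unitmx ->
  has_eigenvalue (C *m M *m invmx C) l -> has_eigenvalue M l.
Proof.
move=> Cu [x x0 xE]; exists (invmx C *m x).
  by apply: contra_neq x0 => e; rewrite -[x](mulKVmx Cu) e mulmx0.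
have := congr1 (mulmx (invmx C)) xE; rewrite -!mulmxA mulKmx // -scalemxAr.
by [].
Qed.

(** If [l] is the corner entry [mu], the first basis vector serves; otherwise [l - mu] is invertible
    and an eigenvector of the block lifts. *)
Lemma eigenvalue_drsubmx p (M : 'M[k]_(1 + p)) l : dlsubmx M = 0 ->
  has_eigenvalue (drsubmx M) l -> has_eigenvalue M l.
Proof.
move=> M0 [x x0 xE].
pose mu := ulsubmx M 0 0; have muE : ulsubmx M = mu%:M by rewrite [LHS]mx11_scalar.
have [e|ne] := eqVneq l mu.
  exists (col_mx 1 0).
    by apply/eqP => /(congr1 usubmx); rewrite col_mxKu linear0 => /eqP; rewrite oner_eq0.
  rewrite -{1}[M]submxK mul_block_col M0 !mulmx0 !addr0 mul0mx muE.
  by rewrite scale_col_mx scaler0 mulmx1 e scalemx1.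
pose al := (l - mu)^-1 *: (ursubmx M *m x).
exists (col_mx al x).
  by apply: contra_neq x0 => /(congr1 dsubmx); rewrite col_mxKd linear0.
rewrite -{1}[M]submxK mul_block_col M0 mul0mx add0r xE scale_col_mx muE.
congr col_mx; rewrite mul_scalar_mx /al scalerA -[X in _ + X]scale1r -scalerDl.
rewrite scalerA; congr (_ *: _); field.
by rewrite subr_eq0.
Qed.

Lemma sum_drsubmx p (M : 'I_n -> 'M[k]_(1 + p)) :
  \sum_l M l = 0 -> \sum_l drsubmx (M l) = 0.
Proof. by rewrite /drsubmx -!linear_sum => ->; rewrite !linear0. Qed.

Lemma nonresonantE q (M : 'M[k]_q) :
  (forall l m (j : int) (e : nat), has_eigenvalue M l -> has_eigenvalue M m -> (0 < e)%N ->
    l - m = j%:~R / e%:R -> exists i : int, l - m = i%:~R) -> nonresonant M.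
Proof.
by move=> h x y l m j e x0 y0 xE yE; apply: h; [exists x | exists y].
Qed.

(** [Y] is rectangular because the induction removes a row at each step and keeps the columns.
    Independence of the rows takes the place of invertibility: it passes to the quotient and
    provides a nonzero column. Eigenvalues of the quotient blocks are eigenvalues of the [B i], so
    the spectral conditions are inherited. *)
Lemma liouvillian_triangular p (B : 'I_n -> 'M[k]_p) :
  \sum_l B l = 0 ->
  (forall i l m (j : int) (e : nat), has_eigenvalue (B i) l -> has_eigenvalue (B i) m ->
    (0 < e)%N -> l - m = j%:~R / e%:R -> exists d : int, l - m = d%:~R) ->
  (forall lam : 'I_n -> k, (forall i, has_eigenvalue (B i) (lam i)) ->
    forall m : nat, \sum_i lam i = - m%:R -> m = 0%N) ->
  forall (K : diffFieldType) (m : nat) (E : nat -> set K) (f : {rmorphism ratfun k -> K})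
    q (Y : 'M[K]_(p, q)),
  diff_morphism f -> range f = E 0%N ->
  (forall i, (i < m)%N -> quadrature_step (E i) (E i.+1)) ->
  (forall i j, E m (Y i j)) -> (forall x : 'rV_p, x *m Y = 0 -> x = 0) ->
  map_mx der Y = map_mx f (fuchsian_mx a B) *m Y ->
  simultaneously_triangular B.
Proof.
move=> sumB nr deg K m E f q Y df rf step EY injY dY.
elim: p B sumB nr deg Y EY injY dY => [|p IH] B sumB nr deg Y EY injY dY.
  by exists 1%:M; rewrite ?unitmx1 // => i [].
have charR N : N.+1%:R != 0 :> ratfun k by rewrite -(rmorph_nat sg) fmorph_eq0 pnatr_eq0.
have [j [i0 Yij]] : exists j i, Y i j != 0.
  apply: contrapT => nex.
  have : (delta_mx 0 0 : 'rV[K]_p.+1) = 0.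
    apply: injY; rewrite -rowE; apply/matrixP => i j; rewrite !mxE.
    by apply/eqP; apply: contraT => h; case: nex; exists j, 0.
  by move=> /matrixP/(_ 0 0); rewrite !mxE !eqxx => /eqP; rewrite oner_eq0.
have line : algebraic_line (fuchsian_mx a B).
  apply: (@liouvillian_algebraic_line K m E _ f _ _ (fun i => Y i j)) => //.
    by exists i0.
  move=> i; have /matrixP/(_ i j) := dY; rewrite !mxE => ->.
  by apply: eq_bigr => l _; rewrite mxE.
have nr' l : nonresonant (B l) by apply: nonresonantE; apply: nr.
have [x [u [x0 xE]]] := rational_invariant_line sumB nr' line.
have [y y0 yE] := fuchsian_common_eigenvector a_inj sumB deg x0 xE.
have [C Cu C0] := @split_eigenvector p B y y0 yE.
pose M i := C *m B i *m invmx C; pose B' i := drsubmx (M i : 'M_(1 + p)).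
have ME i : C *m B i = M i *m C by rewrite /M mulmxKV.
have eigB' i l : has_eigenvalue (B' i) l -> has_eigenvalue (B i) l.
  by move=> h; apply: (eigenvalue_conj Cu); apply: eigenvalue_drsubmx (C0 i) h.
have sumB' : \sum_l B' l = 0.
  apply: sum_drsubmx; apply: etrans (_ : C *m (\sum_l B l) *m invmx C = 0).
    by rewrite mulmx_sumr mulmx_suml.
  by rewrite sumB mulmx0 mul0mx.
pose fC : 'M[K]_(1 + p) := map_mx (f \o sg) C.
have fCu : fC \in unitmx by rewrite map_unitmx.
pose Y' := dsubmx (fC *m Y : 'M_(1 + p, q)).
have EmK c : E m (f c).
  by have [_ sub] := quadrature_chain_subfield df rf step; apply: sub; exists c.
have Em : subring (E m).
  by apply: diff_subfield_subring; have [] := quadrature_chain_subfield df rf step.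
have [] := IH B' sumB' _ _ Y'.
- by move=> i l l' j' e h1 h2; apply: nr (eigB' _ _ h1) (eigB' _ _ h2).
- by move=> lam hlam; apply: deg => i; apply: eigB'.
- move=> i j'; rewrite !mxE.
  apply: (sr_sum Em) => s _; rewrite mxE; apply: (srM Em); first exact: EmK.
  exact: EY.
- move=> x' x'0; have : row_mx 0 x' *m fC = 0.
    apply: injY; rewrite -mulmxA -[fC *m Y]vsubmxK mul_row_col mul0mx add0r.
    exact: x'0.
  move=> /(congr1 (mulmxr (invmx fC))) /=; rewrite mulmxK // mul0mx.
  by move=> /(congr1 rsubmx); rewrite row_mxKr linear0.
- have := fuchsian_gauge df ME dY; rewrite -/fC => /(congr1 (dsubmx : 'M_(1 + p, q) -> _)).
  rewrite map_dsubmx => ->; rewrite dsubmx_mul; last first.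
    apply/matrixP => i j'; rewrite !mxE fuchsianE big1 ?rmorph0 // => l _.
    have /matrixP/(_ i j') := C0 l; rewrite !mxE -/(M l) => ->.
    by rewrite rmorph0 mulr0.
  congr (_ *m _); apply/matrixP => i j'; rewrite !mxE !fuchsianE.
  by congr (f _); apply: eq_bigr => l _; rewrite !mxE.
move=> C' C'u tri.
pose D : 'M[k]_(1 + p) := block_mx 1%:M 0 0 C'.
have Du : D \in unitmx by rewrite unitmxE det_ublock det1 mul1r.
exists (D *m C); first by rewrite unitmx_mul Du.
move=> i.
have -> : D *m C *m B i *m invmx (D *m C) = D *m M i *m invmx D.
  have -> : invmx (D *m C) = invmx C *m invmx D.
    apply: invmx_uniq; rewrite mulmxA -(mulmxA D) mulmxV // mulmx1.
    by rewrite mulmxV.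
  by rewrite /M !mulmxA.
have -> : invmx D = block_mx 1%:M 0 0 (invmx C').
  apply: invmx_uniq; rewrite mulmx_block !mulmx0 !mul0mx mulmxV // mulmx1.
  by rewrite !addr0 add0r -scalar_mx_block.
rewrite -[M i]submxK C0 !mulmx_block -/(B' i).
rewrite !(mulmx0, mul0mx, mul1mx, mulmx1, addr0, add0r).
move=> r s; have [r' ->|r' ->] := split_ordP (r : 'I_(1 + p));
  have [s' ->|s' ->] := split_ordP (s : 'I_(1 + p)).
- by rewrite !ord1.
- by rewrite !ord1.
- by move=> _; apply: etrans (block_mxEdl _ _ _ _ _ _) _; rewrite mxE.
- by move=> lt; apply: etrans (block_mxEdr _ _ _ _ _ _) _; apply: tri.
Qed.

End Descent.

(** * Solving triangular systems by quadratures *)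

Lemma coef_map_der (K : diffFieldType) (p : {poly K}) i :
  (map_poly der p)`_i = der p`_i.
Proof. by rewrite coef_map_id0 // (derivation0 (@derD K)). Qed.

Section FractionDerivation.
Variables (K : diffFieldType) (q : {poly K}).

(* The derivation of K[X] extending that of K with X' = q. *)
Definition poly_der (p : {poly K}) : {poly K} := map_poly der p + q * p^`().

Lemma poly_derD p p' : poly_der (p + p') = poly_der p + poly_der p'.
Proof.
rewrite /poly_der derivD mulrDr addrACA; congr (_ + _).
by apply/polyP => i; rewrite coefD !coef_map_der coefD derD.
Qed.

Lemma poly_derM p p' : poly_der (p * p') = poly_der p * p' + p * poly_der p'.
Proof.
have e : map_poly der (p * p') = map_poly der p * p' + p * map_poly der p'.
  apply/polyP => i; rewrite coefD !coef_map_der !coefM (derivation_sum (@derD K)).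
  rewrite -big_split /=; apply: eq_bigr => j _.
  by rewrite !coef_map_der derM.
by rewrite /poly_der e derivM; ring.
Qed.

Definition fraction_der (f : ratfun K) : ratfun K :=
  let n := \n_(repr f) in let d := \d_(repr f) in
  (poly_der n * d - n * poly_der d)%:F / (d ^+ 2)%:F.

Lemma fraction_derE (n d : {poly K}) : d != 0 ->
  fraction_der (n%:F / d%:F) = (poly_der n * d - n * poly_der d)%:F / (d ^+ 2)%:F.
Proof.
move=> d0; rewrite /fraction_der; set f := n%:F / d%:F.
have := ratfun_repr f; have := denom_ratioP (repr f).
move: (\n_(repr f)) (\d_(repr f)) => n' d' d'0 /eqP.
rewrite eq_ratfun // => /eqP e.
apply/eqP; rewrite eq_ratfun ?expf_neq0 //; apply/eqP.
by apply/esym/quotient_identity; rewrite // -!poly_derM e.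
Qed.

Lemma fraction_derD f g : fraction_der (f + g) = fraction_der f + fraction_der g.
Proof.
rewrite (ratfun_repr f) (ratfun_repr g).
have := denom_ratioP (repr f); have := denom_ratioP (repr g).
move: (\n_(repr f)) (\d_(repr f)) (\n_(repr g)) (\d_(repr g)) => n d n' d' d'0 d0.
have d0F : d%:F != 0 :> ratfun K by rewrite tofrac_eq0.
have d'0F : d'%:F != 0 :> ratfun K by rewrite tofrac_eq0.
have [E1 E2] := @quotientD_morph {poly K} (ratfun K) (@tofrac _) n d n' d'
  (poly_der n) (poly_der d) (poly_der n') (poly_der d') d0F d'0F.
rewrite E1 (fraction_derE _ (mulf_neq0 d0 d'0)).
by rewrite (fraction_derE n d0) (fraction_derE n' d'0) -E2 poly_derD !poly_derM.
Qed.

Lemma fraction_derM f g :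
  fraction_der (f * g) = fraction_der f * g + f * fraction_der g.
Proof.
rewrite (ratfun_repr f) (ratfun_repr g).
have := denom_ratioP (repr f); have := denom_ratioP (repr g).
move: (\n_(repr f)) (\d_(repr f)) (\n_(repr g)) (\d_(repr g)) => n d n' d' d'0 d0.
have d0F : d%:F != 0 :> ratfun K by rewrite tofrac_eq0.
have d'0F : d'%:F != 0 :> ratfun K by rewrite tofrac_eq0.
have [E1 E2] := @quotientM_morph {poly K} (ratfun K) (@tofrac _) n d n' d'
  (poly_der n) (poly_der d) (poly_der n') (poly_der d') d0F d'0F.
rewrite E1 (fraction_derE _ (mulf_neq0 d0 d'0)).
by rewrite (fraction_derE n d0) (fraction_derE n' d'0) -E2 !poly_derM.
Qed.

Lemma fraction_der_poly (p : {poly K}) : fraction_der p%:F = (poly_der p)%:F.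
Proof.
have -> : p%:F = p%:F / 1%:F :> ratfun K by rewrite tofrac1 divr1.
have d1 : poly_der 1 = 0.
  by apply: (addIr (poly_der 1)); rewrite -{3}[1]mulr1 poly_derM mulr1 mul1r add0r.
by rewrite fraction_derE ?oner_neq0 // d1 mulr0 subr0 mulr1 expr1n tofrac1 divr1.
Qed.

(* A copy of K(X), so as not to use its derivation d/dX. *)
Definition fraction_alias : Type := ratfun K.
HB.instance Definition _ := GRing.Field.copy fraction_alias (ratfun K).
HB.instance Definition _ :=
  isDifferential.Build fraction_alias fraction_derD fraction_derM.

Lemma adjoin_solution : exists (L : diffFieldType) (h : {rmorphism K -> L}) (x : L),
  [/\ diff_morphism h, x != 0 & der x = (map_poly h q).[x]].
Proof.
pose h : {rmorphism K -> fraction_alias} := (@tofrac _ : {rmorphism {poly K} -> ratfun K}) \o polyC.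
have hE p : (map_poly h p).['X%:F : fraction_alias] = p%:F :> fraction_alias.
  have -> : map_poly h p = map_poly (@tofrac {poly K}) (map_poly polyC p).
    by rewrite -map_poly_comp.
  by rewrite horner_map /= -/(comp_poly _ _) comp_polyXr.
exists fraction_alias, h, ('X%:F : ratfun K); split.
- move=> y; rewrite [RHS]fraction_der_poly /poly_der derivC mulr0 addr0.
  congr (_%:F); apply/polyP => i; rewrite coef_map_der !coefC.
  by case: eqP => // _; rewrite (derivation0 (@derD K)).
- by rewrite tofrac_eq0 polyX_eq0.
- rewrite hE [LHS]fraction_der_poly /poly_der derivX mulr1.
  rewrite [X in X + q](_ : _ = 0) ?add0r //; apply/polyP => i.
  rewrite coef_map_der coefX coef0.
  by case: (i == 1)%N; rewrite ?(derivation1 (@derM K)) ?(derivation0 (@derD K)).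
Qed.

End FractionDerivation.

(** Each equation is solved by a new indeterminate, which is nonzero as an exponential must be. *)
Lemma adjoin_linear (K : diffFieldType) N (c t : nat -> K) :
  exists (L : diffFieldType) (h : {rmorphism K -> L}) (x : nat -> L), diff_morphism h /\
  forall r, (r < N)%N -> x r != 0 /\ der (x r) = h (c r) * x r + h (t r).
Proof.
elim: N => [|N [L [h [x [dh IH]]]]].
  by exists K, (idfun : {rmorphism K -> K}), t; split.
have [L' [h' [y [dh' y0 dy]]]] := adjoin_solution (h (c N) *: 'X + (h (t N))%:P).
exists L', (h' \o h : {rmorphism K -> L'}), (fun r => if r == N then y else h' (x r)).
split=> [z|r]; first by rewrite /= dh dh'.
rewrite ltnS leq_eqVlt; case: eqP => [-> _|_ /= /IH[xr dx]].
  split=> //; rewrite dy rmorphD /= map_polyZ map_polyX map_polyC /=.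
  by rewrite hornerD hornerZ hornerX hornerC.
by rewrite fmorph_eq0 -dh' dx rmorphD rmorphM.
Qed.

Section Quadratures.
Variables (K : diffFieldType) (S0 : set K).

Definition reachable (T : set K) : Prop := exists (m : nat) (E : nat -> set K),
  [/\ E 0%N = S0, forall i, (i < m)%N -> quadrature_step (E i) (E i.+1) & T = E m].

Definition quadrature_over (T : set K) (x : K) : Prop :=
  [\/ algebraic_over T x, exponential_over T x | integral_over T x].

Lemma quadrature_overS (T U : set K) x :
  (T `<=` U)%classic -> quadrature_over T x -> quadrature_over U x.
Proof.
move=> TU [[q [q0 Tq qx]]|[x0 [a Ta ax]]|[a Ta ax]].
- by apply: Or31; exists q; split=> // i; apply: TU.
- by apply: Or32; split=> //; exists a => //; apply: TU.
- by apply: Or33; exists a => //; apply: TU.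
Qed.

Lemma reachable_adjoin T x : reachable T -> quadrature_over T x ->
  reachable (diff_adjoin T [set x]%classic).
Proof.
move=> [m [E [E0 step ->]]] qx.
exists m.+1, (fun i => if i == m.+1 then diff_adjoin (E m) [set x]%classic else E i).
rewrite eqxx; split=> // i; rewrite ltnS leq_eqVlt eqSS => /predU1P[->|lt].
  by rewrite eqxx (ltn_eqF (ltnSn m)); exists x.
by rewrite !ltn_eqF //; [exact: step | exact: leqW].
Qed.

Lemma reachable_family (N : nat) (x : nat -> K) T : reachable T ->
  (forall i, (i < N)%N -> quadrature_over T (x i)) ->
  exists U, [/\ reachable U, (T `<=` U)%classic & forall i, (i < N)%N -> U (x i)].
Proof.
move=> rT; elim: N => [|N IH] qx; first by exists T; split.
have [U [rU TU Ux]] := IH (fun i lt => qx i (ltnW lt)).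
have sub y : (U `|` [set x N])%classic y -> diff_adjoin U [set x N]%classic y.
  exact: sub_diff_adjoin.
exists (diff_adjoin U [set x N]%classic); split.
- by apply: reachable_adjoin => //; apply: quadrature_overS (qx N (ltnSn N)).
- by move=> y /TU Uy; apply: sub; left.
- move=> i; rewrite ltnS leq_eqVlt => /predU1P[->|/Ux Uxi]; apply: sub; first by right.
  by left.
Qed.

(* The rows of W are found from the last one up: once an exponential x of the
   integral of the diagonal entry is available, the entries of a row divided
   by x are integrals. *)
Lemma triangular_solution p q (A : 'M[K]_p) (W : 'M[K]_(p, q)) T :
  reachable T -> (forall U, reachable U -> diff_subfield U) ->
  (forall r s, T (A r s)) -> upper_triangular A -> map_mx der W = A *m W ->
  (forall r, exists x, [/\ x != 0, T x & der x = A r r * x]) ->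
  exists U, [/\ reachable U, (T `<=` U)%classic & forall r s, U (W r s)].
Proof.
move=> rT dsub TA upA dW expA.
suff main d : (d <= p)%N -> exists U, [/\ reachable U, (T `<=` U)%classic
    & forall (r : 'I_p) s, (p - d <= r)%N -> U (W r s)].
  have [U [rU TU UW]] := main p (leqnn p).
  by exists U; split=> // r s; apply: UW; rewrite subnn.
elim: d => [|d IH] led.
  by exists T; split=> // r s; rewrite subn0 leqNgt ltn_ord.
have [U [rU TU UW]] := IH (ltnW led).
have ltr : (p - d.+1 < p)%N by lia.
pose r := Ordinal ltr; have [x [x0 Tx dx]] := expA r.
have dU := dsub _ rU; have sU := diff_subfield_subring dU.
(* [reachable_family] is indexed by natural numbers; indices that are not columns get the default
   0. *)
pose y i := if insub i is Some s then W r s / x else 0.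
have [|V [rV UV Vy]] := reachable_family (N := q) (x := y) rU.
  move=> i lti; rewrite /y; case: insubP => [s _ _|]; last by rewrite lti.
  apply: Or33; exists (\sum_(l | l != r) A r l * (W l s / x)); last first.
    rewrite (derivation_div (@derD K) (@derM K)) // dx.
    have /matrixP/(_ r s) := dW; rewrite !mxE => ->.
    rewrite (bigD1 r) //=; under [RHS]eq_bigr do rewrite mulrA.
    by rewrite -mulr_suml; field.
  rewrite big_mkcond; apply: (sr_sum sU) => l _; case: eqP => [_|/eqP ne] /=.
    exact: sr0.
  have [lt|ge] := ltnP l r; first by rewrite upA // mul0r; apply: sr0.
  apply: (srM sU); first exact/TU/TA.
  apply: (dsf_div dU); last exact: TU.
  apply: UW; have : (r != l :> nat) by rewrite eq_sym.
  by rewrite /= in ge *; lia.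
exists V; split=> //; first by move=> z /TU/UV.
move=> r' s ler; have [lt|ge] := ltnP r r'.
  by apply/UV/UW; move: lt => /=; lia.
have -> : r' = r by apply: val_inj; move: ge => /=; lia.
have := Vy s (ltn_ord s); rewrite /y valK => Vs.
rewrite -(divfK x0 (W r s)); apply: (srM (diff_subfield_subring (dsub _ rV))) => //.
exact/UV/TU.
Qed.

End Quadratures.

Lemma triangular_solvable (k : numClosedFieldType) p n (a : 'I_n -> k)
    (B : 'I_n -> 'M[k]_p) (F : diffFieldType) (iota : {rmorphism ratfun k -> F})
    (Y : 'M[F]_p) :
  picard_vessiot (fuchsian_mx a B) iota Y -> simultaneously_triangular B ->
  solvable_by_quadratures iota.
Proof.
move=> [di [Yu dY] gen _] [C Cu tri].
pose M i := C *m B i *m invmx C.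
have ME i : C *m B i = M i *m C by rewrite /M mulmxKV.
pose A := map_mx iota (fuchsian_mx a M).
pose dg r := if insub r is Some s then A s s else 0.
(* The first [p] elements are integrals of the diagonal entries, from x' = 0 * x + A_rr; the next
   [p] satisfy x' = A_rr * x + 0 and so are exponentials of the first ones. *)
have [K [j [x [dj dx]]]] := adjoin_linear p.*2
  (fun r => if (r < p)%N then 0 else dg (r - p)%N) (fun r => if (r < p)%N then dg r else 0).
pose f : {rmorphism ratfun k -> K} := j \o iota.
have df : diff_morphism f by move=> z; rewrite /f /= di dj.
pose S0 := range f.
have dsub U : reachable S0 U -> diff_subfield U /\ (S0 `<=` U)%classic.
  by move=> [m [E [E0 step ->]]]; apply: quadrature_chain_subfield.
have r0 : reachable S0 S0 by exists 0%N, (fun=> S0).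
have dgE (r : 'I_p) : dg r = A r r by rewrite /dg valK.
have S0A r s : S0 (j (A r s)) by rewrite mxE; exists (fuchsian_mx a M r s).
have [|T1 [rT1 _ T1x]] := reachable_family (N := p) (x := x) r0.
  move=> i lti; have [|_] := dx i; first by lia.
  rewrite lti rmorph0 mul0r add0r => dxi.
  by apply: Or33; exists (j (dg i)) => //; have := dgE (Ordinal lti) => /= ->.
have [|T [rT T1T Tx]] := reachable_family (N := p) (x := fun r => x (p + r)%N) rT1.
  move=> i lti; have [|x0] := dx (p + i)%N; first by lia.
  rewrite ifN ?addKn; last by lia.
  rewrite ifN ?rmorph0 ?addr0; last by lia.
  move=> dxi; apply: Or32; split=> //; exists (x i); first exact: T1x.
  have [|_] := dx i; first by lia.
  by rewrite lti rmorph0 mul0r add0r dxi => ->.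
(* [W] solves the triangular system, and the constant matrix [invmx C] recovers [Y] from it. *)
pose W := map_mx (f \o @ratfunC k) C *m map_mx j Y.
have [dT S0T] := dsub _ rT.
have dW : map_mx der W = map_mx j A *m W.
  have comp (X : 'M[ratfun k]_p) : map_mx f X = map_mx j (map_mx iota X).
    by apply/matrixP => r s; rewrite !mxE.
  rewrite /A -comp; apply: fuchsian_gauge df ME _.
  rewrite comp -(map_mxM j) -dY.
  by apply/matrixP => r s; rewrite !mxE dj.
have [|||||U [rU TU UW]] := @triangular_solution _ S0 p p (map_mx j A) W T rT.
- by move=> U /dsub[].
- by move=> r s; rewrite mxE; apply/S0T/S0A.
- move=> r s lt; rewrite !mxE fuchsianE big1 ?rmorph0 // => l _.
  by rewrite tri // rmorph0 mulr0.
- exact: dW.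
- move=> r; exists (x (p + r)%N); have [|x0] := dx (p + r)%N; first by have := ltn_ord r; lia.
  rewrite ifN ?addKn; last by lia.
  rewrite ifN ?rmorph0 ?addr0; last by lia.
  rewrite dgE => dxr; split=> //; first exact: (Tx r (ltn_ord r)).
  by rewrite mxE.
have [dU S0U] := dsub _ rU; have sU := diff_subfield_subring dU.
have UY r s : U (j (Y r s)).
  have -> : j (Y r s) = (map_mx (f \o @ratfunC k) (invmx C) *m W) r s.
    rewrite /W mulmxA -map_mxM mulVmx // map_mx1 mul1mx.
    by rewrite mxE.
  rewrite mxE; apply: (sr_sum sU) => l _; apply: (srM sU); last exact: UW.
  by rewrite mxE; apply: S0U; exists (ratfunC k (invmx C r l)).
exists K, j; split=> //; case: rU => m [E [E0 step UE]]; exists m, E; split=> //.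
(* The preimage in [F] of the last field of the chain is a differential subfield containing the
   generators, hence all of [F]. *)
rewrite -UE => _ [y _ <-].
have dV := der_subfield dj dU.
have : diff_adjoin (range iota) [set Y q.1 q.2 | q in [set: 'I_p * 'I_p]]%classic y.
  by rewrite gen.
move=> /(_ _ (conj dV _)); apply=> z [[c _ <-]|[[r s] _ <-]]; last exact: UY.
by apply: S0U; exists c.
Qed.

(** * From the conditions on the eigenvalues to the equivalence *)

Lemma eigenvalue_root (k : numClosedFieldType) q (M : 'M[k]_q) l :
  has_eigenvalue M l -> root (char_poly M) l.
Proof.
(* [eigenvalue] refers to row vectors, hence the transpose. *)
move=> [x x0 xE]; have -> : char_poly M = char_poly M^T.
  rewrite /char_poly -det_tr; congr (\det _).
  by apply/matrixP => i j; rewrite !mxE eq_sym.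
rewrite -eigenvalue_root_char; apply/eigenvalueP; exists x^T.
  by rewrite -trmx_mul xE linearZ.
by apply: contra_neq x0 => e; rewrite -[x]trmxK e trmx0.
Qed.

Theorem corollary1 (R : realType) (p n : nat) (hp : (2 <= p)%N)
    (a : 'I_n -> R[i]) (a_inj : injective a)
    (B : 'I_n -> 'M[R[i]]_p) (sumB : \sum_(i < n) B i = 0)
    (beta : 'I_n -> 'I_p -> R[i])
    (beta_eig : forall i : 'I_n,
      char_poly (B i) = \prod_(j < p) ('X - (beta i j)%:P))
    (beta_small : forall (i : 'I_n) (j : 'I_p),
      - (n%:R * (p%:R - 1))^-1 < complex.Re (beta i j))
    (beta_nonres : forall (i : 'I_n) (j l : 'I_p),
      ~ (exists k : int, beta i j - beta i l = k%:~R) ->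
      ~ rational (complex.Re (beta i j) - complex.Re (beta i l)) \/
      complex.Im (beta i j) <> complex.Im (beta i l))
    (F : diffFieldType) (iota : {rmorphism ratfun R[i] -> F}) (Y : 'M[F]_p)
    (FY : picard_vessiot (fuchsian_mx a B) iota Y) :
  solvable_by_quadratures iota <-> simultaneously_triangular B.
Proof.
split; last exact: triangular_solvable FY.
have eig i l : has_eigenvalue (B i) l -> exists j, l = beta i j.
  move=> /eigenvalue_root; rewrite beta_eig rootE horner_prod => /prodf_eq0[j _].
  by rewrite hornerXsubC subr_eq0 => /eqP e; exists j.
have ReM (x : R) : complex.Re (x%:C)%C = x by [].
move=> [K [j [dj [m [E [E0 step FE]]]]]].
have [di [Yu dY] _ _] := FY.
pose f : {rmorphism ratfun R[i] -> K} := j \o iota.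
have comp (X : 'M[ratfun R[i]]_p) : map_mx f X = map_mx j (map_mx iota X).
  by apply/matrixP => r s; rewrite !mxE.
apply: (liouvillian_triangular a_inj sumB _ _ (m := m) (E := E) (f := f)
  (Y := map_mx j Y)) => //.
(* A rational difference has rational real part and zero imaginary part, against both alternatives
   of [beta_nonres]; so it is an integer. *)
- move=> i l l' q e /eig[r ->] /eig[s ->] e0 rs.
  apply: contrapT => /beta_nonres.
  have -> : beta i r = beta i s + (q%:~R / e%:R)%:C%C.
    by rewrite rmorphM fmorphV rmorph_int rmorph_nat -rs addrC subrK.
  case: (beta i s) => x y /=; rewrite addr0 => -[]; last by [].
  apply; exists (q%:~R / e%:R) => //.
  by rewrite addrAC subrr add0r fmorph_div rmorph_int rmorph_nat.
- move=> lam lamE N sumN.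
  have [s sE] := choice (fun i => eig i _ (lamE i)).
  have ReD (I : finType) (g : I -> R[i]) : complex.Re (\sum_l g l) = \sum_l complex.Re (g l).
    by elim/big_rec2: _ => // l u v _ <-; case: (g l) v => [? ?] [].
  have := congr1 (@complex.Re R) sumN; rewrite ReD.
  have -> : complex.Re (- N%:R : R[i]) = - N%:R.
    have -> : (- N%:R : R[i]) = (- N%:R : R)%:C%C by rewrite rmorphN rmorph_nat.
    by [].
  (* For [n = 0] the bound contains the inverse of 0, but the sum is empty. *)
  move=> sumRe; case: (posnP n) => [n0|n_gt0].
    move: sumRe; rewrite big1 => [/esym/eqP|[i lti]]; last by exfalso; have := lti; rewrite n0.
    by rewrite oppr_eq0 pnatr_eq0 => /eqP.
  (* Adding the [n] bounds gives [N < 1/(p - 1)], which is at most 1 because [p >= 2]. *)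
  have lt : - n%:R * (n%:R * (p%:R - 1) : R)^-1 < - N%:R.
    rewrite -sumRe mulNr -mulrN; set b := _^-1.
    have -> : n%:R * - b = \sum_(i < n) - b by rewrite sumr_const card_ord mulr_natl.
    apply: ltr_sum => [|i _]; last by rewrite sE.
    by apply/hasP; exists (Ordinal n_gt0); rewrite ?mem_index_enum.
  have n0 : (n%:R : R) != 0 by rewrite pnatr_eq0 -lt0n.
  have p1 : (1 : R) <= p%:R - 1 by rewrite lerBrDr -(natrD R 1 1) ler_nat.
  move: lt; rewrite invfM mulNr mulVKf // ltrN2 => lt.
  have : (N%:R : R) < 1 by apply: lt_le_trans lt _; rewrite invf_le1 // (lt_le_trans ltr01).
  by rewrite (ltr_nat R N 1) ltnS leqn0 => /eqP.
- by move=> x; rewrite /f /= di dj.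
- by move=> r s; apply: FE; rewrite mxE; exists (Y r s).
- move=> x xY; rewrite -[x](mulmxK (_ : map_mx j Y \in unitmx)) ?map_unitmx //.
  by rewrite xY mul0mx.
- rewrite comp -map_mxM -dY.
  by apply/matrixP => r s; rewrite !mxE dj.
Qed.
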